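(* For $1\le i<j\le 3$, the vector $v_{(i,j)}\in M_{4A}$ is an idempotent whose eigenspace decomposition satisfies the fusion rule $(\mathcal{F}_{4A}^{(t)},* )$, where $\mathcal{F}_{4A}^{(t)}=\{1,0,\frac12,\frac38,t\}$ and $*$ is the symmetric map given by $1*1=\{1\}$, $1*0=\emptyset$, $1*\frac12=\{\frac12\}$, $1*\frac38=\{\frac38\}$, $1*t=\{t\}$; $0*0=\{0\}$, $0*\frac12=\{\frac12\}$, $0*\frac38=\{\frac38\}$, $0*t=\{t\}$; $\frac12*\frac12=\{1,0\}$, $\frac12*\frac38=\{\frac38\}$, $\frac12*t=\{t\}$; $\frac38*\frac38=\{1,0,\frac12\}$, $\frac38*t=\emptyset$; $t*t=\{1,0,\frac12\}$. Moreover, if $t\notin\{1,0,\frac12,\frac38\}$ then this fusion rule admits a $C_2\times C_2$-grading $\mathrm{gr}_{4A}^{(t)}:\langle a,b\mid a^2=b^2=(ab)^2=1\rangle\to P(\mathcal{F}_{4A}^{(t)})$ with $1\mapsto\{1,0,\frac12\}$, $a\mapsto\{\frac38\}$, $b\mapsto\{t\}$, $ab\mapsto\emptyset$. Finally, if $t=\frac38$ then this fusion rule admits a $C_2$-grading $\mathrm{gr}_{4A}^{(3/8)}:\langle a\mid a^2=1\rangle\to P(\mathcal{F}_{4A}^{(3/8)})$ with $1\mapsto\{1,0,\frac12\}$ and $a\mapsto\{\frac38\}$.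
   Context: Algebras are commutative but not necessarily associative, over a commutative ring $R$ with $1$ containing $\mathbb{R}$ as a subfield. For an idempotent $a\in V$ and $\lambda\in R$ put $V_\lambda^{(a)}=\{v\in V: a\cdot v=\lambda v\}$, and for $\Lambda\subseteq R$ put $V_\Lambda^{(a)}=\bigoplus_{\lambda\in\Lambda}V_\lambda^{(a)}$ ($V_\emptyset^{(a)}=0$). A fusion rule is a pair $(\mathcal{F},* )$ with $\mathcal{F}\subseteq R$ and $*:\mathcal{F}\times\mathcal{F}\to 2^{\mathcal{F}}$ symmetric. The eigenspace decomposition of an idempotent $a$ satisfies $(\mathcal{F},* )$ (equivalently, $a$ is an $(\mathcal{F},* )$-axis) if $V=\bigoplus_{\lambda\in\mathcal{F}}V_\lambda^{(a)}$ and $V_\lambda^{(a)}\cdot V_\mu^{(a)}\subseteq V_{\lambda*\mu}^{(a)}$ for all $\lambda,\mu\in\mathcal{F}$. The axis is primitive if $V_1^{(a)}=Ra$. For an abelian group $T$, a $T$-grading of $(\mathcal{F},* )$ is a map $\mathrm{gr}:T\to P(\mathcal{F})$ (power set) whose image is a partition of $\mathcal{F}$ (empty parts allowed) such that for $s,s'\in T$, $\alpha\in\mathrm{gr}(s)$, $\beta\in\mathrm{gr}(s')$ one has $\alpha*\beta\subseteq\mathrm{gr}(ss')$. The Monster fusion rule $(\mathcal{M},* )$ has $\mathcal{M}=\{1,0,\frac14,\frac1{32}\}$ and symmetric $*$ with $1*1=\{1\}$, $1*0=\emptyset$, $0*0=\{0\}$, $1*\frac14=0*\frac14=\{\frac14\}$,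 $\frac14*\frac14=\{1,0\}$, $\lambda*\frac1{32}=\{\frac1{32}\}$ for $\lambda\in\{1,0,\frac14\}$, $\frac1{32}*\frac1{32}=\{1,0,\frac14\}$. A primitive Frobenius $(\mathcal{M},* )$-axial algebra is an algebra generated by a set $A$ of primitive $(\mathcal{M},* )$-axes with a Frobenius form, i.e. a nonzero $R$-bilinear form $\langle\,,\rangle$ with $\langle u,v\cdot w\rangle=\langle u\cdot v,w\rangle$, normalised by $\langle a,a\rangle=1$ for axes $a\in A$. The Miyamoto involution $\tau(a)$ of an $(\mathcal{M},* )$-axis acts as $1$ on $V_1^{(a)}\oplus V_0^{(a)}\oplus V_{1/4}^{(a)}$ and as $-1$ on $V_{1/32}^{(a)}$. Property $\mathcal{P}$: $A=\{a_1,a_{-1},a_2,a_{-2},a_3,a_{-3}\}$ and on $A$, $\tau(a_1)=\tau(a_{-1})=(a_2,a_{-2})(a_3,a_{-3})$, $\tau(a_2)=\tau(a_{-2})=(a_1,a_{-1})(a_3,a_{-3})$, $\tau(a_3)=\tau(a_{-3})=(a_1,a_{-1})(a_2,a_{-2})$. Shape $4A$: for all distinct $i,j\in\{1,2,3\}$ the subalgebra $\langle\langle a_i,a_j\rangle\rangle$ generated by $a_i,a_j$ is of type $4A$, i.e. it is spanned by $a_{\pm i},a_{\pm j}$ and an idempotent $v=v_{(i,j)}=v_{(j,i)}$ such that, for all signs $\epsilon,\delta$: $a_{\epsilon i}\cdot a_{\delta j}=\frac1{64}(3a_{\epsilon i}+3a_{\delta j}+a_{-\epsilon i}+a_{-\delta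 j}-3v)$, $a_{\epsilon i}\cdot v=\frac1{16}(5a_{\epsilon i}-a_{-\epsilon i}-2a_j-2a_{-j}+3v)$, $a_{\delta j}\cdot v=\frac1{16}(5a_{\delta j}-a_{-\delta j}-2a_i-2a_{-i}+3v)$, $a_i\cdot a_{-i}=a_j\cdot a_{-j}=0$, $\langle a_{\epsilon i},a_{\delta j}\rangle=\frac1{32}$, $\langle a_i,a_{-i}\rangle=\langle a_j,a_{-j}\rangle=0$, $\langle a_{\epsilon i},v\rangle=\langle a_{\delta j},v\rangle=\frac38$, $\langle v,v\rangle=2$. Universal algebra: let $\hat X$ be the free commutative non-associative magma on $\hat a_{\pm1},\hat a_{\pm2},\hat a_{\pm3}$; let $\sim$ be the equivalence relation on $\hat X\times\hat X$ generated by $(\hat x\cdot\hat y,\hat z)\sim(\hat x,\hat y\cdot\hat z)$; let $\hat R=\mathbb{R}[\lambda_{[\hat x,\hat y]}]$ be the polynomial ring with one indeterminate for each $\sim$-class; let $\hat M=\hat R\hat X$ be the algebra of formal $\hat R$-linear combinations of elements of $\hat X$, with $\hat R$-bilinear form $\langle\hat x,\hat y\rangle=\lambda_{[\hat x,\hat y]}$. For ideals $I$ of $\hat M$ and $J\ne\hat R$ of $\hat R$ with $J\hat M\subseteq I$ and $\langle I,\hat M\rangle\subseteq J$, the quotient $\hat M/I$ is an algebra with form over its coefficient ring $\hat R/J$, with marked generators $a_{\pm i}$ the images of $\hat a_{\pm i}$. Let $\mathcal{C}_{4A}$ be the class of such quotients which are primitive Frobenius $(\mathcal{M},* )$-axial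 algebras (with axes the marked generators) satisfying property $\mathcal{P}$ and having shape $4A$. $M_{4A}$ denotes the universal member of $\mathcal{C}_{4A}$ (given by the smallest pair $(I,J)$; all members of $\mathcal{C}_{4A}$ are quotients of it). Its coefficient ring is the polynomial ring $\mathbb{R}[t]$ in $t=\langle a_1,v_{(2,3)}\rangle$. In the statement about $M_{4A}$, $t$ is this element of the coefficient ring $\mathbb{R}[t]$; in the statements about gradings, $(\mathcal{F}_{4A}^{(t)},* )$ is considered with $t$ taking a value (an arbitrary real number, or the indeterminate itself) as indicated. When $t=\frac38$, the labels $\frac38$ and $t$ coincide and the corresponding entries of the table are merged by taking unions (so $\frac38*\frac38=\{1,0,\frac12\}$). *)

(* Defs.v *)
From HB Require Import structures.
From Stdlib Require Import Relations.
From mathcomp Require Import all_boot all_algebra ring_quotient.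
From mathcomp Require Import boolp classical_sets reals.
From mathcomp Require Import finmap.
From mathcomp.multinomials Require Import monalg.

Set Implicit Arguments.
Unset Strict Implicit.
Unset Printing Implicit Defensive.

Import GRing.Theory Quotient.Exports.
Local Open Scope classical_set_scope.
Local Open Scope ring_scope.
Local Open Scope quotient_scope.

Reserved Notation "x *a y" (at level 40, left associativity).

(* Commutative, not necessarily associative algebras with a bilinear form. *)
Record formAlg (S : comNzRingType) := FormAlg {
  alg_sort :> lmodType S;
  amul : alg_sort -> alg_sort -> alg_sort;
  aform : alg_sort -> alg_sort -> S;
  amulC : commutative amul;
  amulDl : left_distributive amul +%R;
  amulZl : forall r x y, amul (r *: x) y = r *: amul x y;
  aformDl : forall x y z, aform (x + y) z = aform x z + aform y z;
  aformDr : forall x y z, aform x (y + z) = aform x y + aform x z;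
  aformZl : forall r x y, aform (r *: x) y = r * aform x y;
  aformZr : forall r x y, aform x (r *: y) = r * aform x y }.

Arguments amul {S V} : rename.
Arguments aform {S V} : rename.

Declare Scope alg_scope.
Delimit Scope alg_scope with ALG.
Notation "x *a y" := (amul x y) : alg_scope.
Open Scope alg_scope.

Section FusionRules.
Variable S : comNzRingType.

Record fusion_rule := FusionRule {
  frset : set S;
  frop : S -> S -> set S;
  frop_sub : forall x y, frset x -> frset y -> frop x y `<=` frset;
  frop_sym : forall x y, frop x y = frop y x }.

(* The fusion rule given by a table on a type [L] of labels, the label [l]    *)
(* standing for the scalar [val l]. Labels with the same value are identified *)
(* and their table entries merged by taking unions.                           *)
Section Table.
Variables (L : Type) (val : L -> S) (tab : L -> L -> set L).
Hypothesis tabC : forall l m, tab l m = tab m l.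

Definition table_op (x y : S) : set S :=
  [set z | exists l m, [/\ val l = x, val m = y & (val @` tab l m) z]].

Fact table_op_sub x y :
  range val x -> range val y -> table_op x y `<=` range val.
Proof. by move=> _ _ z [l [m [_ _ [n _ <-]]]]; exists n. Qed.

Fact table_op_sym x y : table_op x y = table_op y x.
Proof.
by apply/seteqP; split=> z [l [m [lx my lm]]]; exists m, l; rewrite tabC.
Qed.

Definition table_rule : fusion_rule := FusionRule table_op_sub table_op_sym.
End Table.

(* Gradings by an abelian group [T], written additively. *)
Definition is_grading (T : zmodType) (F : fusion_rule) (gr : T -> set S) :=
  [/\ trivIset setT gr,
      \bigcup_s gr s = frset F
    & forall s s' x y, gr s x -> gr s' y -> frop F x y `<=` gr (s + s')].

End FusionRules.

Section Axes.
Variables (S : comNzRingType) (V : formAlg S).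
Implicit Types (a x y : V) (A B : set V).

Definition idempotent_elt a := a *a a = a.

Definition eigenspace a (l : S) : set V := [set x | a *a x = l *: x].

Definition eigen_family a (L : set S) (s : seq S) (f : S -> V) :=
  uniq s /\ forall l, l \in s -> L l /\ eigenspace a l (f l).

Definition eigensum a (L : set S) : set V :=
  [set x | exists s f, eigen_family a L s f /\ x = \sum_(l <- s) f l].

Definition eigen_direct a (L : set S) :=
  forall s f, eigen_family a L s f ->
    \sum_(l <- s) f l = 0 -> forall l, l \in s -> f l = 0.

Definition satisfies_fusion a (F : fusion_rule S) :=
  [/\ eigen_direct a (frset F), eigensum a (frset F) = setT
    & forall l m x y, frset F l -> frset F m -> eigenspace a l x -> eigenspace a m y ->
        eigensum a (frop F l m) (x *a y)].

Definition is_axis (F : fusion_rule S) a :=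
  idempotent_elt a /\ satisfies_fusion a F.

Definition primitive_elt a := eigenspace a 1 = range (fun r : S => r *: a).

Definition is_subalg B :=
  [/\ B 0, forall x y, B x -> B y -> B (x + y),
      forall (r : S) x, B x -> B (r *: x) & forall x y, B x -> B y -> B (x *a y)].

Definition gen_subalg A : set V :=
  [set x | forall B, is_subalg B -> A `<=` B -> B x].

Definition frobenius_form :=
  (exists x y : V, aform x y <> 0) /\
  (forall u v w : V, aform u (v *a w) = aform (u *a v) w).

Definition primitive_frobenius_axial (F : fusion_rule S) A :=
  [/\ forall a, A a -> is_axis F a /\ primitive_elt a,
      gen_subalg A = setT, frobenius_form & forall a, A a -> aform a a = 1].

End Axes.

(* Reals are mapped to the coefficient ring [S] by [iota], which is injective *)
(* since [S] is nontrivial.                                                   *)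
Section Monster.
Variables (R : realType) (S : comNzRingType) (iota : {rmorphism R -> S}).

Variant mlabel := mon1 | mon0 | mon4 | mon32.

Definition mval (l : mlabel) : S :=
  match l with mon1 => 1 | mon0 => 0 | mon4 => iota (1 / 4) | mon32 => iota (1 / 32) end.

Definition mtab (l m : mlabel) : set mlabel :=
  match l, m with
  | mon1, mon1 => [set mon1]
  | mon1, mon0 | mon0, mon1 => set0
  | mon0, mon0 => [set mon0]
  | (mon1 | mon0), mon4 | mon4, (mon1 | mon0) => [set mon4]
  | mon4, mon4 => [set mon1; mon0]
  | (mon1 | mon0 | mon4), mon32 | mon32, (mon1 | mon0 | mon4) => [set mon32]
  | mon32, mon32 => [set mon1; mon0; mon4]
  end.

Fact mtabC l m : mtab l m = mtab m l. Proof. by case: l; case: m. Qed.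

Definition monster_rule : fusion_rule S := table_rule mval mtabC.

Definition is_miyamoto (V : formAlg S) (a : V) (tau : V -> V) :=
  forall x y, eigensum a [set 1; 0; iota (1 / 4)] x ->
    eigenspace a (iota (1 / 32)) y -> tau (x + y) = x - y.

Variant flabel := fus1 | fus0 | fus2 | fus38 | fust.

Definition fval (t : S) (l : flabel) : S :=
  match l with
  | fus1 => 1 | fus0 => 0 | fus2 => iota (1 / 2) | fus38 => iota (3 / 8) | fust => t
  end.

Definition ftab (l m : flabel) : set flabel :=
  match l, m with
  | fus1, fus1 => [set fus1]
  | fus1, fus0 | fus0, fus1 => set0
  | fus0, fus0 => [set fus0]
  | (fus1 | fus0), fus2 | fus2, (fus1 | fus0) => [set fus2]
  | fus2, fus2 => [set fus1; fus0]
  | (fus1 | fus0 | fus2), fus38 | fus38, (fus1 | fus0 | fus2) => [set fus38]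
  | (fus1 | fus0 | fus2), fust | fust, (fus1 | fus0 | fus2) => [set fust]
  | fus38, fus38 => [set fus1; fus0; fus2]
  | fus38, fust | fust, fus38 => set0
  | fust, fust => [set fus1; fus0; fus2]
  end.

Fact ftabC l m : ftab l m = ftab m l. Proof. by case: l; case: m. Qed.

Definition F4A (t : S) : fusion_rule S := table_rule (fval t) ftabC.

Definition F4A_admits_C2xC2_grading (t : S) :=
  exists gr : 'Z_2 * 'Z_2 -> set S,
    is_grading (F4A t) gr /\
    let a := (1, 0) in let b := (0, 1) in
    [/\ gr 0 = [set 1; 0; iota (1 / 2)], gr a = [set iota (3 / 8)],
        gr b = [set t] & gr (a + b) = set0].

Definition F4A_admits_C2_grading (t : S) :=
  exists gr : 'Z_2 -> set S,
    [/\ is_grading (F4A t) gr, gr 0 = [set 1; 0; iota (1 / 2)]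
      & gr 1 = [set iota (3 / 8)]].

End Monster.

(* Signed indices: [a i true] is a_i and [a i false] is a_{-i}, where the     *)
(* indices 1, 2, 3 are i1, i2, i3.                                            *)
Definition i1 : 'I_3 := @Ordinal 3 0 isT.
Definition i2 : 'I_3 := @Ordinal 3 1 isT.
Definition i3 : 'I_3 := @Ordinal 3 2 isT.

Section Shape4A.
Variables (R : realType) (S : comNzRingType) (iota : {rmorphism R -> S}).
Variables (V : formAlg S) (a : 'I_3 -> bool -> V).

Definition marked : set V := [set x | exists i e, x = a i e].

Definition propertyP :=
  forall i e, exists2 tau, is_miyamoto iota (a i e) tau &
    forall j d, tau (a j d) = if j == i then a j d else a j (~~ d).

Definition type4A (i j : 'I_3) (v : V) :=
  [/\ gen_subalg [set a i true; a j true] =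
        [set x | exists c1 c2 c3 c4 c5 : S,
           x = c1 *: a i true + c2 *: a i false
               + c3 *: a j true + c4 *: a j false + c5 *: v],
      idempotent_elt v,
      forall e d, [/\
        a i e *a a j d = iota (1 / 64) *:
          (a i e *+ 3 + a j d *+ 3 + a i (~~ e) + a j (~~ d) - v *+ 3),
        a i e *a v = iota (1 / 16) *:
          (a i e *+ 5 - a i (~~ e) - a j true *+ 2 - a j false *+ 2 + v *+ 3),
        a j d *a v = iota (1 / 16) *:
          (a j d *+ 5 - a j (~~ d) - a i true *+ 2 - a i false *+ 2 + v *+ 3)
        & [/\ aform (a i e) (a j d) = iota (1 / 32),
              aform (a i e) v = iota (3 / 8) & aform (a j d) v = iota (3 / 8)]],
      a i true *a a i false = 0 /\ a j true *a a j false = 0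
    & [/\ aform (a i true) (a i false) = 0, aform (a j true) (a j false) = 0
        & aform v v = 2]].

Definition shape4A_vectors (v : 'I_3 -> 'I_3 -> V) :=
  forall i j, i != j -> v i j = v j i /\ type4A i j (v i j).

Definition class4A :=
  [/\ primitive_frobenius_axial (monster_rule iota) marked, propertyP
    & exists v, shape4A_vectors v].

End Shape4A.

(* The free commutative magma: words modulo the congruence generated by       *)
(* commutativity.                                                             *)
Inductive word := Gen of 'I_3 & bool | Mul of word & word.

HB.instance Definition _ := gen_eqMixin word.
HB.instance Definition _ := gen_choiceMixin word.

Inductive wcong : word -> word -> Prop :=
| wcong_comm x y : wcong (Mul x y) (Mul y x)
| wcong_mul x x' y y' : wcong x x' -> wcong y y' -> wcong (Mul x y) (Mul x' y')
| wcong_refl x : wcong x x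
| wcong_sym x y : wcong x y -> wcong y x
| wcong_trans x y z : wcong x y -> wcong y z -> wcong x z.

Definition weq : rel word := fun x y => `[< wcong x y >].

Fact weq_equiv : equiv_class_of weq.
Proof.
split=> [x|x y|y x z]; first exact/asboolP/wcong_refl.
  by apply/asboolP/asboolP => /wcong_sym.
by move=> /asboolP xy /asboolP yz; apply/asboolP/(wcong_trans xy yz).
Qed.

Canonical weq_equiv_rel := EquivRelPack weq_equiv.
Canonical weq_encModRel := defaultEncModRel weq.

Definition magma := {eq_quot weq}.
HB.instance Definition _ := EqQuotient.on magma.
HB.instance Definition _ := Choice.on magma.

Definition mgen (i : 'I_3) (e : bool) : magma := \pi_magma (Gen i e).
Definition mmulw (x y : magma) : magma := \pi_magma (Mul (repr x) (repr y)).

Lemma mmulw_pi x y :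
  mmulw (\pi_magma x) (\pi_magma y) = \pi_magma (Mul x y).
Proof.
have reprE z : wcong (repr (\pi_magma z)) z.
  by apply/asboolP/(@eqquotP _ _ magma _ _); rewrite reprK.
by apply/(@eqquotP _ _ magma _ _)/asboolP/wcong_mul; apply: reprE.
Qed.

Lemma mmulwC : commutative mmulw.
Proof.
move=> x y; rewrite /mmulw; apply/(@eqquotP _ _ magma _ _)/asboolP.
exact: wcong_comm.
Qed.

Variant pair_step : magma * magma -> magma * magma -> Prop :=
  PairStep x y z : pair_step (mmulw x y, z) (x, mmulw y z).

Definition peq : rel (magma * magma) :=
  fun p q => `[< clos_refl_sym_trans _ pair_step p q >].

Fact peq_equiv : equiv_class_of peq.
Proof.
split=> [x|x y|y x z]; first exact/asboolP/rst_refl.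
  by apply/asboolP/asboolP => xy; apply: rst_sym.
by move=> /asboolP xy /asboolP yz; apply/asboolP; apply: rst_trans xy yz.
Qed.

Canonical peq_equiv_rel := EquivRelPack peq_equiv.
Canonical peq_encModRel := defaultEncModRel peq.

Definition pair_class := {eq_quot peq}.
HB.instance Definition _ := EqQuotient.on pair_class.
HB.instance Definition _ := Choice.on pair_class.

Section BilinearExtension.
Variables (K : choiceType) (S : comNzRingType) (W : lmodType S).
Variable f : K -> K -> W.

Definition bilin_ext (x y : {malg S[K]}) : W :=
  \sum_(k <- msupp x) \sum_(l <- msupp y) (x@_k * y@_l) *: f k l.

Lemma bilin_extEw (d d' : {fset K}) x y :
  (msupp x `<=` d)%fset -> (msupp y `<=` d')%fset ->
  bilin_ext x y = \sum_(k <- d) \sum_(l <- d') (x@_k * y@_l) *: f k l.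
Proof.
move=> xd yd'; rewrite /bilin_ext (big_fset_incl _ xd) /=.
  apply/eq_bigr=> k _; apply/big_fset_incl => // l _ /mcoeff_outdom ->.
  by rewrite mulr0 scale0r.
by move=> k _ /mcoeff_outdom ->; rewrite big1 // => l _; rewrite mul0r scale0r.
Qed.

Lemma bilin_extDl x x' y :
  bilin_ext (x + x') y = bilin_ext x y + bilin_ext x' y.
Proof.
rewrite (bilin_extEw (msuppD_le x x') (fsubset_refl _)).
rewrite (bilin_extEw (fsubsetUl _ (msupp x')) (fsubset_refl (msupp y))).
rewrite (bilin_extEw (fsubsetUr (msupp x) _) (fsubset_refl (msupp y))).
rewrite -big_split; apply/eq_bigr=> k _ /=; rewrite -big_split.
by apply/eq_bigr=> l _ /=; rewrite mcoeffD mulrDl scalerDl.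
Qed.

Lemma bilin_extDr x y y' :
  bilin_ext x (y + y') = bilin_ext x y + bilin_ext x y'.
Proof.
rewrite (bilin_extEw (fsubset_refl _) (msuppD_le y y')).
rewrite (bilin_extEw (fsubset_refl (msupp x)) (fsubsetUl _ (msupp y'))).
rewrite (bilin_extEw (fsubset_refl (msupp x)) (fsubsetUr (msupp y) _)).
rewrite -big_split; apply/eq_bigr=> k _ /=; rewrite -big_split.
by apply/eq_bigr=> l _ /=; rewrite mcoeffD mulrDr scalerDl.
Qed.

Lemma bilin_extZl r x y : bilin_ext (r *: x) y = r *: bilin_ext x y.
Proof.
rewrite (bilin_extEw (msuppZ_le _ _) (fsubset_refl _)) scaler_sumr.
apply/eq_bigr=> k _; rewrite scaler_sumr.
by apply/eq_bigr=> l _; rewrite mcoeffZ -mulrA scalerA.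
Qed.

Lemma bilin_extZr r x y : bilin_ext x (r *: y) = r *: bilin_ext x y.
Proof.
rewrite (bilin_extEw (fsubset_refl _) (msuppZ_le _ _)) scaler_sumr.
apply/eq_bigr=> k _; rewrite scaler_sumr.
by apply/eq_bigr=> l _; rewrite mcoeffZ mulrCA scalerA.
Qed.

Lemma bilin_extU k l : bilin_ext << 1 *g k >> << 1 *g l >> = f k l.
Proof.
rewrite (bilin_extEw (@msuppU_le _ _ k 1) (@msuppU_le _ _ l 1)).
by rewrite !big_seq_fset1 !mcoeffUU mulr1 scale1r.
Qed.

Lemma bilin_extC x y :
  (forall k l, f k l = f l k) -> bilin_ext x y = bilin_ext y x.
Proof.
move=> fC; rewrite /bilin_ext exchange_big; apply/eq_bigr=> l _.
by apply/eq_bigr=> k _; rewrite mulrC fC.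
Qed.
End BilinearExtension.

Section QuotientAlgebra.
Variables (S0 : comNzRingType) (M : formAlg S0).

(* [idealr] denotes proper ideals. The form need not be symmetric, so for it  *)
(* to descend to the quotient both arguments have to be considered. In the    *)
(* free algebra below, [idM_formr] follows from [idM_forml] as soon as the    *)
(* generators are idempotent modulo [idM].                                    *)
Record ideal_pair := IdealPair {
  idM : zmodClosed M;
  idR : idealr S0;
  idM_scale : forall (r : S0) x, x \in idM -> r *: x \in idM;
  idM_mul : forall x y, x \in idM -> x *a y \in idM;
  idR_scale : forall (r : S0) (x : M), r \in idR -> r *: x \in idM;
  idM_forml : forall x y : M, x \in idM -> aform x y \in idR;
  idM_formr : forall x y : M, x \in idM -> aform y x \in idR }.

Definition qring (P : ideal_pair) : comNzRingType := {ideal_quot (idR P)}.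
Definition qpi (P : ideal_pair) (r : S0) : qring P := \pi_{ideal_quot (idR P)} r.

Definition qmod (P : ideal_pair) := Quotient.quot (idM P).
HB.instance Definition _ P := GRing.Zmodule.on (qmod P).
Definition mpi (P : ideal_pair) (x : M) : qmod P := \pi_(Quotient.quot (idM P)) x.

Section Quotient.
Variable P : ideal_pair.
Local Notation Q := (qmod P).
Local Notation S := (qring P).

Lemma qpi_eq r s : (qpi P r = qpi P s) <-> r - s \in idR P.
Proof.
rewrite /qpi; split=> [/eqP|rs]; first by rewrite -Quotient.idealrBE.
by apply/eqP; rewrite -Quotient.idealrBE.
Qed.

Lemma mpi_eq x y : (mpi P x = mpi P y) <-> x - y \in idM P.
Proof.
rewrite /mpi; split=> [/eqP|xy]; first by rewrite -Quotient.idealrBE.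
by apply/eqP; rewrite -Quotient.idealrBE.
Qed.

Lemma qpiK (r : S) : qpi P (repr r) = r. Proof. exact: reprK. Qed.
Lemma mpiK (x : Q) : mpi P (repr x) = x. Proof. exact: reprK. Qed.

Fact qpi_zmod_morphism : zmod_morphism (qpi P).
Proof. exact: pi_is_zmod_morphism. Qed.
Fact qpi_monoid_morphism : monoid_morphism (qpi P).
Proof. exact: pi_is_monoid_morphism. Qed.
HB.instance Definition _ :=
  GRing.isZmodMorphism.Build S0 S (qpi P) qpi_zmod_morphism.
HB.instance Definition _ :=
  GRing.isMonoidMorphism.Build S0 S (qpi P) qpi_monoid_morphism.

Fact mpi_zmod_morphism : zmod_morphism (mpi P).
Proof. exact: pi_is_zmod_morphism. Qed.
HB.instance Definition _ :=
  GRing.isZmodMorphism.Build M Q (mpi P) mpi_zmod_morphism.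

Definition qscale (r : S) (x : Q) : Q := mpi P (repr r *: repr x).
Definition qmul (x y : Q) : Q := mpi P (repr x *a repr y).
Definition qform (x y : Q) : S := qpi P (aform (repr x) (repr y)).

Lemma repr_qpi r : repr (qpi P r) - r \in idR P.
Proof. by apply/qpi_eq; rewrite qpiK. Qed.

Lemma repr_mpi x : repr (mpi P x) - x \in idM P.
Proof. by apply/mpi_eq; rewrite mpiK. Qed.

Lemma qscaleE r x : qscale (qpi P r) (mpi P x) = mpi P (r *: x).
Proof.
apply/mpi_eq; rewrite -[_ *: _](subrK (repr (qpi P r) *: x)) -scalerBr.
rewrite -addrA -scalerBl rpredD //; first by apply/idM_scale/repr_mpi.
by apply: idR_scale; apply: repr_qpi.
Qed.

Lemma qmulE x y : qmul (mpi P x) (mpi P y) = mpi P (x *a y).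
Proof.
have mB (u v w : M) : u *a w - v *a w = (u - v) *a w.
  by rewrite amulDl -[- v]scaleN1r amulZl scaleN1r.
apply/mpi_eq; rewrite -[_ *a repr _](subrK (x *a repr (mpi P y))) mB.
rewrite -addrA [x *a _]amulC [x *a y]amulC mB.
by rewrite rpredD //; apply: idM_mul; apply: repr_mpi.
Qed.

Lemma qformE x y : qform (mpi P x) (mpi P y) = qpi P (aform x y).
Proof.
have BL (u v w : M) : aform u w - aform v w = aform (u - v) w.
  by rewrite aformDl -[- v]scaleN1r aformZl mulN1r.
have BR (u v w : M) : aform u v - aform u w = aform u (v - w).
  by rewrite aformDr -[- w]scaleN1r aformZr mulN1r.
apply/qpi_eq; rewrite -[aform _ _](subrK (aform x (repr (mpi P y)))) BL.
rewrite -addrA BR rpredD //.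
  by apply: idM_forml; apply: repr_mpi.
by apply: idM_formr; apply: repr_mpi.
Qed.

Fact qscaleA r s (x : Q) : qscale r (qscale s x) = qscale (r * s) x.
Proof.
by rewrite -[r]qpiK -[s]qpiK -[x]mpiK -rmorphM /= !qscaleE scalerA.
Qed.

Fact qscale1 : left_id (1 : S) qscale.
Proof. by move=> x; rewrite -[x]mpiK -(rmorph1 (qpi P)) qscaleE scale1r. Qed.

Fact qscaleDr : right_distributive qscale +%R.
Proof.
move=> r x y; rewrite -[r]qpiK -[x]mpiK -[y]mpiK.
by rewrite -raddfD /= !qscaleE scalerDr raddfD.
Qed.

Fact qscaleDl (x : Q) : {morph qscale^~ x : r s / r + s}.
Proof.
move=> r s; rewrite -[r]qpiK -[s]qpiK -[x]mpiK.
by rewrite -raddfD /= !qscaleE scalerDl raddfD.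
Qed.

HB.instance Definition _ :=
  GRing.Zmodule_isLmodule.Build S Q qscaleA qscale1 qscaleDr qscaleDl.

Lemma mpiZ r x : mpi P (r *: x) = qpi P r *: mpi P x.
Proof. by rewrite -qscaleE. Qed.

Fact qmulC : commutative qmul.
Proof. by move=> x y; rewrite /qmul amulC. Qed.

Fact qmulDl : left_distributive qmul +%R.
Proof.
move=> x y z; rewrite -[x]mpiK -[y]mpiK -[z]mpiK.
by rewrite -raddfD /= !qmulE amulDl raddfD.
Qed.

Fact qmulZl (r : S) (x y : Q) : qmul (r *: x) y = r *: qmul x y.
Proof.
rewrite -[r]qpiK -[x]mpiK -[y]mpiK.
by rewrite -mpiZ !qmulE amulZl mpiZ.
Qed.

Fact qformDl x y z : qform (x + y) z = qform x z + qform y z.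
Proof.
rewrite -[x]mpiK -[y]mpiK -[z]mpiK.
by rewrite -raddfD /= !qformE aformDl raddfD.
Qed.

Fact qformDr x y z : qform x (y + z) = qform x y + qform x z.
Proof.
rewrite -[x]mpiK -[y]mpiK -[z]mpiK.
by rewrite -raddfD /= !qformE aformDr raddfD.
Qed.

Fact qformZl (r : S) (x y : Q) : qform (r *: x) y = r * qform x y.
Proof.
rewrite -[r]qpiK -[x]mpiK -[y]mpiK.
by rewrite -mpiZ !qformE aformZl rmorphM.
Qed.

Fact qformZr (r : S) (x y : Q) : qform x (r *: y) = r * qform x y.
Proof.
rewrite -[r]qpiK -[x]mpiK -[y]mpiK.
by rewrite -mpiZ !qformE aformZr rmorphM.
Qed.

Definition quot_alg : formAlg S :=
  @FormAlg S Q qmul qform qmulC qmulDl qmulZl qformDl qformDr qformZl qformZr.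

End Quotient.
End QuotientAlgebra.

Arguments qpi {S0 M} P r.
Arguments mpi {S0 M} P x.

Section Universal.
Variable R : realType.

(* The polynomial ring with one indeterminate for each class of pairs. *)
Definition Rhat : comNzRingType := {malg R[{cmonom pair_class}]}.

Definition lam (x y : magma) : Rhat := << 1 *g ucm (\pi_pair_class (x, y)) >>.

Definition hmul : {malg Rhat[magma]} -> {malg Rhat[magma]} -> {malg Rhat[magma]} :=
  bilin_ext (fun x y => << 1 *g mmulw x y >>).

Definition hform : {malg Rhat[magma]} -> {malg Rhat[magma]} -> Rhat :=
  bilin_ext (W := Rhat^o) lam.

Fact hmulC : commutative hmul.
Proof. by move=> x y; apply/bilin_extC => k l; rewrite mmulwC. Qed.

Fact hmulDl : left_distributive hmul +%R.
Proof. by move=> x y z; apply/bilin_extDl. Qed.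

Fact hmulZl r x y : hmul (r *: x) y = r *: hmul x y.
Proof. exact: bilin_extZl. Qed.

Fact hformDl x y z : hform (x + y) z = hform x z + hform y z.
Proof. exact: (@bilin_extDl _ _ Rhat^o). Qed.

Fact hformDr x y z : hform x (y + z) = hform x y + hform x z.
Proof. exact: (@bilin_extDr _ _ Rhat^o). Qed.

Fact hformZl r x y : hform (r *: x) y = r * hform x y.
Proof. exact: (@bilin_extZl _ _ Rhat^o). Qed.

Fact hformZr r x y : hform x (r *: y) = r * hform x y.
Proof. exact: (@bilin_extZr _ _ Rhat^o). Qed.

Definition Mhat : formAlg Rhat :=
  @FormAlg Rhat {malg Rhat[magma]} hmul hform hmulC hmulDl hmulZl
    hformDl hformDr hformZl hformZr.

Definition hgen (i : 'I_3) (e : bool) : Mhat := << 1 *g mgen i e >>.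

Definition quot_gen (P : ideal_pair Mhat) (i : 'I_3) (e : bool) : quot_alg P :=
  mpi P (hgen i e).

Definition quot_real (P : ideal_pair Mhat) : {rmorphism R -> qring P} :=
  qpi P \o (@malgC {cmonom pair_class} R).

Definition in_C4A (P : ideal_pair Mhat) := class4A (quot_real P) (quot_gen P).

Definition is_M4A (P : ideal_pair Mhat) :=
  in_C4A P /\
  forall P', in_C4A P' ->
    {subset idM P <= idM P'} /\ {subset idR P <= idR P'}.

End Universal.

(* Main.v *)
(* M_4A is spanned over its coefficient ring by twelve vectors: the six axes, the
   three vectors v_(i,j) and the three vectors a_k v_(i,j) (up to a correction).
   The fusion rule of the axes forces their products one after the other, with
   coefficients linear in t, so that the eigenvectors of v_(i,j) and their products
   are obtained by a finite computation. Decomposing vectors into eigenvectors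
   requires the differences of the eigenvalues 1, 0, 1/2, 3/8, t to act injectively on
   M_4A. For this, the multiplication table is realised over the reals for every real
   value x of t; each of these twelve-dimensional algebras belongs to the class, so
   by universality M_4A specialises to all of them, and a vector annihilated by a
   nonzero polynomial in t has coefficients which vanish at every x. *)

Require Import Defs.
From HB Require Import structures.
From Stdlib Require Import ZArith Relations.
From mathcomp Require Import all_boot all_algebra zify ssrZ.
From mathcomp Require Import ring lra.
From mathcomp Require Import boolp classical_sets reals finmap.
From mathcomp.multinomials Require Import monalg.

Set Implicit Arguments.
Unset Strict Implicit.
Unset Printing Implicit Defensive.

Import GRing.Theory Num.Theory.
Local Open Scope classical_set_scope.
Local Open Scope ring_scope.
Local Notation eigenspace := Defs.eigenspace.
Local Notation mpi := Defs.mpi.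
Delimit Scope Z_scope with BZ.

(** Every identity is settled by [vm_compute] on formal combinations of atoms with integer
    polynomials in t as coefficients, and [ev] transports it to any algebra. So a single table
    serves both directions: it is derived in an arbitrary member of the class and it defines the
    models. Integer arithmetic suffices because nonzero integers are invertible in a ring containing
    the reals; in 192 = 64 * 3, the factor 64 comes from the shape and 3 from the products of two
    distinct v_(i,j).

    A product that is still unknown is kept as a formal symbol. The fusion rule of an axis then
    yields a linear equation, and the equations are chosen so that one unknown is left with a
    nonzero integer coefficient. No polynomial in t is ever divided by, so no value of t is
    exceptional.

    The other obstacle is that the coefficient ring is given only as a quotient with infinitely many
    generators. The Frobenius identity moves the factors of a word across the form until a generator
    is left, which makes every coefficient a polynomial in t; only then can specialisations at real
    numbers detect vectors. *)

(** * Reflected linear algebra over integer polynomials in t *)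

Definition pol := seq Z.

Fixpoint padd (p q : pol) : pol :=
  match p, q with
  | [::], _ => q
  | _, [::] => p
  | x :: p', y :: q' => Z.add x y :: padd p' q'
  end.

Definition pscale (z : Z) (p : pol) : pol := map (Z.mul z) p.

Fixpoint pmul (p q : pol) : pol :=
  if p is x :: p' then padd (pscale x q) (Z0 :: pmul p' q) else [::].

Definition pzero (p : pol) := all (Z.eqb Z0) p.

Inductive ix := X1 | X2 | X3.

Definition ixeqb i j :=
  match i, j with X1, X1 | X2, X2 | X3, X3 => true | _, _ => false end.

Definition nxt i := match i with X1 => X2 | X2 => X3 | X3 => X1 end.
Definition prv i := match i with X1 => X3 | X2 => X1 | X3 => X2 end.

Definition third i j := if ixeqb j (nxt i) then prv i else nxt i.

(* [A i true] and [A i false] stand for a_i and a_{-i}, [W i] for v_(j,k) where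
   {i, j, k} = {1, 2, 3}, and [H i] for a_i v_(j,k) - (t/2) (a_i - a_{-i}), which
   depends symmetrically on a_i and a_{-i}. [Gap x y] stands for the deviation of
   a product not yet determined from its value in the table. *)
Inductive atom := A of ix & bool | W of ix | H of ix | Gap of atom & atom.

Fixpoint atomeqb x y :=
  match x, y with
  | A i e, A j d => ixeqb i j && (e == d)
  | W i, W j | H i, H j => ixeqb i j
  | Gap x x', Gap y y' => atomeqb x y && atomeqb x' y'
  | _, _ => false
  end.

Definition basic x := if x is Gap _ _ then false else true.

Definition fvec := seq (atom * pol).

Definition fscale (p : pol) (c : fvec) : fvec := [seq (q.1, pmul p q.2) | q <- c].

Definition coef x (c : fvec) : pol :=
  foldr (fun q p => if atomeqb x q.1 then padd q.2 p else p) [::] c.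

(** The fuel only makes the recursion structural: out of fuel, the remaining list is returned
    unmerged, which preserves its value. *)
Fixpoint nfrec n (c : fvec) : fvec :=
  if n is n'.+1 then
    if c is q :: c' then
      let p := coef q.1 c in
      let r := nfrec n' [seq q' <- c' | ~~ atomeqb q.1 q'.1] in
      if pzero p then r else (q.1, p) :: r
    else [::]
  else c.

Definition nf c := nfrec (size c) c.

Definition fzero c := all (fun q => pzero q.2) (nf c).

Definition fvsub (c d : fvec) : fvec := c ++ fscale [:: (-1)%BZ] d.

Definition feq c d := fzero (fvsub c d).

Definition fbil (mulT : atom -> atom -> fvec) (c d : fvec) : fvec :=
  nf (flatten [seq flatten [seq fscale (pmul p.2 q.2) (mulT p.1 q.1) | q <- d] | p <- c]).

Section Eval.
Variables (S : comNzRingType) (t : S) (V : lmodType S) (g : atom -> V).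

Definition zev (z : Z) : S := (int_of_Z z)%:~R.

Lemma zevD x y : zev (Z.add x y) = zev x + zev y.
Proof. by rewrite /zev -intrD -(raddfD int_of_Z). Qed.

Lemma zevM x y : zev (Z.mul x y) = zev x * zev y.
Proof. by rewrite /zev -intrM -(rmorphM int_of_Z). Qed.

Fixpoint pev (p : pol) : S := if p is x :: p' then zev x + t * pev p' else 0.

Lemma pevD p q : pev (padd p q) = pev p + pev q.
Proof.
elim: p q => [|x p IH] [|y q] //=; rewrite ?add0r ?addr0 //.
by rewrite zevD IH; ring.
Qed.

Lemma pevZ z p : pev (pscale z p) = zev z * pev p.
Proof. by elim: p => [|x p IH] /=; rewrite ?mulr0 // zevM IH; ring. Qed.

Lemma pevM p q : pev (pmul p q) = pev p * pev q.
Proof.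
elim: p => [|x p IH] /=; rewrite ?mul0r // pevD pevZ /= IH.
by rewrite (_ : zev Z0 = 0) //; ring.
Qed.

Lemma pev_pzero p : pzero p -> pev p = 0.
Proof.
by elim: p => //= -[] //= p IH /IH ->; rewrite mulr0 addr0.
Qed.

Definition ev (c : fvec) : V := \sum_(q <- c) pev q.2 *: g q.1.

Lemma ev_nil : ev [::] = 0. Proof. by rewrite /ev big_nil. Qed.

Lemma ev_cons q c : ev (q :: c) = pev q.2 *: g q.1 + ev c.
Proof. by rewrite /ev big_cons. Qed.

Lemma ev_cat c d : ev (c ++ d) = ev c + ev d.
Proof. by rewrite /ev big_cat. Qed.

Lemma ev_scale p c : ev (fscale p c) = pev p *: ev c.
Proof.
rewrite /ev big_map scaler_sumr; apply: eq_bigr => q _ /=.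
by rewrite pevM scalerA.
Qed.

Lemma ev_flatten (I : Type) (r : seq I) (F : I -> fvec) :
  ev (flatten [seq F i | i <- r]) = \sum_(i <- r) ev (F i).
Proof. by elim: r => [|i r IH]; rewrite /= ?big_nil ?ev_nil // ev_cat big_cons IH. Qed.

Lemma ixeqbP i j : reflect (i = j) (ixeqb i j).
Proof. by case: i; case: j; constructor. Qed.

Lemma atomeqbP x y : reflect (x = y) (atomeqb x y).
Proof.
elim: x y => [i e|i|i|x1 IH1 x2 IH2] [j d|j|j|y1 y2] /=; try by constructor.
- by apply: (iffP andP) => [[/ixeqbP -> /eqP ->]|[-> ->]] //; split=> //; apply/ixeqbP.
- by apply: (iffP (ixeqbP _ _)) => [->|[]].
- by apply: (iffP (ixeqbP _ _)) => [->|[]].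
- by apply: (iffP andP) => [[/(IH1 y1) -> /(IH2 y2) ->]|[<- <-]] //;
  split; [apply/(IH1 x1)|apply/(IH2 x2)].
Qed.

Lemma ev_coef x c :
  ev c = pev (coef x c) *: g x + ev [seq q <- c | ~~ atomeqb x q.1].
Proof.
elim: c => [|[y p] c IH] /=; first by rewrite ev_nil scale0r addr0.
rewrite ev_cons /= IH; case: atomeqbP => [<-|_] /=.
  by rewrite pevD scalerDl addrA.
by rewrite ev_cons /= addrCA.
Qed.

Lemma ev_nfrec n c : ev (nfrec n c) = ev c.
Proof.
elim: n c => [|n IH] [|q c] //; rewrite [RHS](ev_coef q.1) /=.
case: (atomeqbP q.1 q.1) => // _ /=.
set p := padd _ _; case: ifP => [/pev_pzero ->|_].
  by rewrite scale0r add0r IH.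
by rewrite ev_cons IH.
Qed.

Lemma ev_nf c : ev (nf c) = ev c. Proof. exact: ev_nfrec. Qed.

Lemma fzero_ev c : fzero c -> ev c = 0.
Proof.
rewrite /fzero -(ev_nf c); elim: (nf c) => [|q d IH] /=; first by rewrite ev_nil.
by move=> /andP[/pev_pzero q0 /IH d0]; rewrite ev_cons q0 d0 scale0r addr0.
Qed.

Lemma ev_sub c d : ev (fvsub c d) = ev c - ev d.
Proof.
rewrite ev_cat ev_scale /= mulr0 addr0 (_ : zev _ = -1) ?scaleN1r //.
Qed.

Lemma feq_ev c d : feq c d -> ev c = ev d.
Proof. by move/fzero_ev; rewrite ev_sub => /eqP; rewrite subr_eq0 => /eqP. Qed.

End Eval.

Section EvalMul.
Variables (S : comNzRingType) (t : S) (V : formAlg S) (g : atom -> V).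
Local Notation eval := (ev t g).

Lemma amul0l (x : V) : 0 *a x = 0.
Proof. by rewrite -{1}(scale0r (0 : V)) amulZl scale0r. Qed.
Lemma amul0r (x : V) : x *a 0 = 0.
Proof. by rewrite amulC amul0l. Qed.
Lemma amulDr (x y z : V) : x *a (y + z) = x *a y + x *a z.
Proof. by rewrite amulC amulDl ![_ *a x]amulC. Qed.
Lemma amulZr r (x y : V) : x *a (r *: y) = r *: (x *a y).
Proof. by rewrite amulC amulZl amulC. Qed.
Lemma amul_sumr I (r : seq I) (F : I -> V) x :
  x *a (\sum_(i <- r) F i) = \sum_(i <- r) x *a F i.
Proof. by elim: r => [|i r IH]; rewrite ?big_nil ?amul0r // !big_cons amulDr IH. Qed.
Lemma amul_suml I (r : seq I) (F : I -> V) x :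
  (\sum_(i <- r) F i) *a x = \sum_(i <- r) F i *a x.
Proof. by rewrite amulC amul_sumr; apply: eq_bigr => i _; rewrite amulC. Qed.

(** [k] is the denominator cleared in the table, and [P] selects the atoms on which the table is
    trusted. *)
Lemma ev_fbil (P : pred atom) mulT (c d : fvec) (k : S) :
  (forall x y, P x -> P y -> eval (mulT x y) = k *: (g x *a g y)) ->
  all (fun q => P q.1) c -> all (fun q => P q.1) d ->
  eval (fbil mulT c d) = k *: (eval c *a eval d).
Proof.
move=> Tk Pc Pd; rewrite ev_nf ev_flatten.
rewrite [eval c in RHS]/ev amul_suml scaler_sumr.
elim: c Pc => [|p c IH] /= ; first by rewrite !big_nil.
move=> /andP[Pp /IH {}IH]; rewrite !big_cons IH; congr (_ + _).
rewrite ev_flatten [eval d]/ev amulZl amul_sumr !scaler_sumr.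
elim: d Pd {IH} => [|q d IH] /= ; first by rewrite !big_nil.
move=> /andP[Pq /IH {}IH]; rewrite !big_cons IH; congr (_ + _).
rewrite ev_scale Tk // amulZr !scalerA pevM; congr (_ *: _); ring.
Qed.

End EvalMul.

(** * The multiplication table, the form and the eigenvectors *)

Definition c0 (n : Z) : pol := [:: n].
Definition c1 (n : Z) : pol := [:: Z0; n].
Definition sA i p : fvec := [:: (A i true, p); (A i false, p)].
Definition dA i p : fvec := [:: (A i true, p); (A i false, pscale (-1)%BZ p)].

Section Table.
Local Open Scope Z_scope.

(* Tables of products and of the form, multiplied by 192 to clear denominators;
   coefficients are integer polynomials in t. *)
Definition mulAA i e j d : fvec :=
  if ixeqb i j then if e == d then [:: (A i e, c0 192)] else [::]
  else [:: (A i e, c0 9); (A j d, c0 9); (A i (~~ e), c0 3); (A j (~~ d), c0 3);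
           (W (third i j), c0 (-9))].

Definition mulAW i e j : fvec :=
  if ixeqb i j then [:: (H i, c0 192); (A i e, c1 96); (A i (~~ e), c1 (-96))]
  else [:: (A i e, c0 60); (A i (~~ e), c0 (-12)); (W j, c0 36)]
       ++ sA (third i j) (c0 (-24)).

Definition mulWW i j : fvec :=
  if ixeqb i j then [:: (W i, c0 192)]
  else let k := third i j in
       [:: (H k, c0 512); (H i, c0 (-256)); (H j, c0 (-256));
           (W i, c0 48); (W j, c0 48); (W k, c0 (-48))] ++ sA k (c1 (-256)).

Definition mulAH i e j : fvec :=
  if ixeqb i j then [:: (H i, c0 48); (A i e, c1 72); (A i (~~ e), c1 (-24))]
  else [:: (H i, c0 12); (A i e, c1 30); (A i (~~ e), c1 (-6));
           (H j, c0 24); (H (third i j), c0 (-24))].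

Definition mulWH i j : fvec :=
  if ixeqb i j then [:: (H i, c0 96); (W i, c1 48)]
  else let k := third i j in
       [:: (H j, c0 48); (H k, c0 48); (W i, c1 24)]
       ++ sA j (c1 (-32)) ++ sA k (c1 (-64)).

Definition mulHH i j : fvec :=
  if ixeqb i j then [:: (W i, c1 12); (H i, c1 48)] ++ sA i (c1 12)
  else let k := third i j in
       [:: (W i, c1 3); (W j, c1 3); (W k, c1 6);
           (H i, c1 24); (H j, c1 24); (H k, c1 (-24))] ++ sA k (c1 (-6)).

Definition mulT x y : fvec :=
  match x, y with
  | A i e, A j d => mulAA i e j d
  | A i e, W j | W j, A i e => mulAW i e j
  | W i, W j => mulWW i j
  | A i e, H j | H j, A i e => mulAH i e j
  | W i, H j | H j, W i => mulWH i j
  | H i, H j => mulHH i j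
  | Gap _ _, _ | _, Gap _ _ => [::]
  end.

Definition gramT x y : pol :=
  match x, y with
  | A i e, A j d => if ixeqb i j then if e == d then [:: 192] else [::] else [:: 6]
  | A i _, W j | W j, A i _ => if ixeqb i j then [:: 0; 192] else [:: 72]
  | W i, W j => if ixeqb i j then [:: 384] else [:: 96; -512]
  | A i _, H j | H j, A i _ => if ixeqb i j then [:: 0; 96] else [:: 0; 36]
  | W i, H j | H j, W i => if ixeqb i j then [:: 0; 192] else [:: 0; -48]
  | H i, H j => if ixeqb i j then [:: 0; 48; 48] else [:: 0; 12; 24]
  | Gap _ _, _ | _, Gap _ _ => [::]
  end.

(* The products of level [n] are determined in the [n]-th stage of the derivation. *)
Definition level x y : nat :=
  match x, y with
  | A i e, W j | W j, A i e => if ixeqb i j && ~~ e then 1 else 0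
  | W i, W j => if ixeqb i j then 0 else 2
  | A i _, H j | H j, A i _ => if ixeqb i j then 3 else 4
  | W i, H j | H j, W i => if ixeqb i j then 6 else 5
  | H i, H j => if ixeqb i j then 7 else 8
  | _, _ => 0
  end%nat.

Definition mem1 (x : atom) : fvec := [:: (x, [:: 1])].

(** With the axis, the 5 + 4 + 2 eigenvectors for 0, 1/4 and 1/32 make twelve. Positions matter
    below: entries 1 and 2 here, and 0 and 1 of [a_eig4], come from the 4A subalgebras that a_i
    generates with a_j and with a_k; later entries involve [H]. *)
Definition a_eig0 i e : seq fvec :=
  let j := nxt i in let k := prv i in let n := A i (~~ e) in let a := A i e in
  [:: [:: (n, c0 1)];
      [:: (W k, c0 2); (a, c0 (-1))] ++ sA j (c0 4);
      [:: (W j, c0 2); (a, c0 (-1))] ++ sA k (c0 4);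
      [:: (W i, c0 1); (H i, c0 (-4)); (a, c1 1); (n, c1 2)];
      [:: (H j, c0 8); (H k, c0 8); (H i, c0 (-4)); (a, c1 (-1))]].
Definition a_eig4 i e : seq fvec :=
  let j := nxt i in let k := prv i in let n := A i (~~ e) in let a := A i e in
  [:: [:: (W k, c0 (-3)); (a, c0 1); (n, c0 1)] ++ sA j (c0 2);
      [:: (W j, c0 (-3)); (a, c0 1); (n, c0 1)] ++ sA k (c0 2);
      [:: (H i, c0 2); (a, c1 (-1)); (n, c1 (-1))];
      [:: (H j, c0 1); (H k, c0 (-1))]].
Definition a_eig32 i : seq fvec := [:: dA (nxt i) (c0 1); dA (prv i) (c0 1)].

End Table.

Definition ixs := [:: X1; X2; X3].
Definition basics : seq atom :=
  flatten [seq [:: A i true; A i false; W i; H i] | i <- ixs].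

Definition fform (c d : fvec) : pol :=
  foldr padd [::] [seq foldr padd [::] [seq pmul (pmul p.2 q.2) (gramT p.1 q.1) | q <- d] | p <- c].

Definition frob_check :=
  all (fun x => all (fun y => all (fun z =>
    pzero (padd (fform (mulT x y) (mem1 z)) (pscale (-1)%BZ (fform (mem1 x) (mulT y z)))))
    basics) basics) basics.

Definition eigcheck (c : fvec) (p : pol) (v : fvec) := feq (fbil mulT c v) (fscale p v).

Section WTable.
Local Open Scope Z_scope.

Definition v_eig0 i : seq fvec :=
  let j := nxt i in let k := prv i in
  [:: [:: (H i, c0 (-4)); (W i, c1 1)] ++ sA i (c0 1);
      [:: (W i, c0 (-3))] ++ sA j (c0 4) ++ sA k (c0 4);
      [:: (H j, c0 3); (H k, c0 (-3))] ++ sA j (c1 (-1)) ++ sA k (c1 1);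
      [:: (W j, c0 6); (W k, c0 6); (H i, c0 32); (H j, c0 (-16)); (H k, c0 (-16));
          (W i, [:: -3; -4])]].
Definition v_eig2 i : seq fvec :=
  let j := nxt i in let k := prv i in
  [:: [:: (H i, c0 2); (W i, c1 (-1))];
      sA j (c0 1) ++ sA k (c0 (-1));
      [:: (H j, c0 1); (H k, c0 1); (W i, c1 1)] ++ sA j (c1 (-1)) ++ sA k (c1 (-1));
      [:: (W j, c0 1); (W k, c0 (-1)); (H j, c0 (-8)); (H k, c0 8)]].
End WTable.

Definition a_eig i e (l : mlabel) : seq fvec :=
  match l with
  | mon1 => [:: mem1 (A i e)] | mon0 => a_eig0 i e | mon4 => a_eig4 i e | mon32 => a_eig32 i
  end.
(** Eigenvalues times 192, to match the scaling of the table. *)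
Definition mpol (l : mlabel) : pol :=
  match l with mon1 => [:: 192%BZ] | mon0 => [::] | mon4 => [:: 48%BZ] | mon32 => [:: 6%BZ] end.
Definition mlabs := [:: mon1; mon0; mon4; mon32].
Definition mtabs (l m : mlabel) : seq mlabel :=
  match l, m with
  | mon1, mon1 => [:: mon1]
  | mon1, mon0 | mon0, mon1 => [::]
  | mon0, mon0 => [:: mon0]
  | (mon1 | mon0), mon4 | mon4, (mon1 | mon0) => [:: mon4]
  | mon4, mon4 => [:: mon1; mon0]
  | (mon1 | mon0 | mon4), mon32 | mon32, (mon1 | mon0 | mon4) => [:: mon32]
  | mon32, mon32 => [:: mon1; mon0; mon4]
  end.

Definition v_eig i (l : flabel) : seq fvec :=
  match l with
  | fus1 => [:: mem1 (W i)] | fus0 => v_eig0 i | fus2 => v_eig2 i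
  | fus38 => [:: dA (nxt i) (c0 1%BZ); dA (prv i) (c0 1%BZ)] | fust => [:: dA i (c0 1%BZ)]
  end.
Definition fpol (l : flabel) : pol :=
  match l with
  | fus1 => [:: 192%BZ] | fus0 => [::] | fus2 => [:: 96%BZ] | fus38 => [:: 72%BZ]
  | fust => [:: 0%BZ; 192%BZ] end.
Definition flabs := [:: fus1; fus0; fus2; fus38; fust].
Definition ftabs (l m : flabel) : seq flabel :=
  match l, m with
  | fus1, fus1 => [:: fus1]
  | fus1, fus0 | fus0, fus1 => [::]
  | fus0, fus0 => [:: fus0]
  | (fus1 | fus0), fus2 | fus2, (fus1 | fus0) => [:: fus2]
  | fus2, fus2 => [:: fus1; fus0]
  | (fus1 | fus0 | fus2), fus38 | fus38, (fus1 | fus0 | fus2) => [:: fus38]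
  | (fus1 | fus0 | fus2), fust | fust, (fus1 | fus0 | fus2) => [:: fust]
  | fus38, fus38 => [:: fus1; fus0; fus2]
  | fus38, fust | fust, fus38 => [::]
  | fust, fust => [:: fus1; fus0; fus2]
  end.

(** * Computable tests for eigenvectors, fusion and spanning *)

Section Check.
Variables (L : Type) (labs : seq L) (lp : L -> pol) (tabs : L -> L -> seq L).
Variables (a : fvec) (E : L -> seq fvec).

(* A vector of the algebra lies in the sum of the eigenspaces of labels in [s] as
   soon as the operators (a - l) with l in [s] annihilate it, because differences of
   eigenvalues are regular: fusion is checked by computation, without division. *)
Definition annf (s : seq L) (c : fvec) : fvec :=
  foldr (fun l c => nf (fvsub (fbil mulT a c) (fscale (lp l) c))) c s.

Definition eig_check := all (fun l => all (eigcheck a (lp l)) (E l)) labs.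

Definition fusion_check :=
  all (fun l => all (fun m => all (fun x => all (fun y =>
    fzero (annf (tabs l m) (fbil mulT x y))) (E m)) (E l)) labs) labs.
End Check.

Section Cert.
Variables (L : Type) (labs : seq L) (E : L -> seq fvec).
Variable cert : atom -> Z * (L -> seq pol).

Definition lincomb (cs : seq pol) (Es : seq fvec) : fvec :=
  flatten [seq fscale p.1 p.2 | p <- zip cs Es].

Definition span_check :=
  all (fun x => ~~ Z.eqb 0%BZ (cert x).1 &&
    feq (fscale [:: (cert x).1] (mem1 x))
        (flatten [seq lincomb ((cert x).2 l) (E l) | l <- labs])) basics.
End Cert.

Section Certs.
Local Open Scope Z_scope.

Definition sgn (e : bool) : Z -> Z := fun z => if e then z else - z.

(* A multiplier m and, for each eigenvalue, the coefficients of the eigenvectors in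
   the decomposition of m x. *)
Definition a_cert i e x : Z * (mlabel -> seq pol) :=
  let c m p1 p0 p4 p32 := (m, fun l => match l with
    | mon1 => p1 | mon0 => p0 | mon4 => p4 | mon32 => p32 end) in
  match x with
  | A i' e' =>
    if ixeqb i' i then
      if e == e' then c 1 [:: [:: 1]] [::] [::] [::] else c 1 [::] [:: [:: 1]] [::] [::]
    else if ixeqb i' (nxt i) then
      c 32 [:: [:: 1]] [:: [:: -2]; [:: 3]] [:: [:: 2]] [:: [:: sgn e' 16]]
    else c 32 [:: [:: 1]] [:: [:: -2]; [::]; [:: 3]] [:: [::]; [:: 2]]
              [:: [::]; [:: sgn e' 16]]
  | W j =>
    if ixeqb j i then
      c 1 [:: [:: 0; 1]] [:: [::]; [::]; [::]; [:: 1]] [:: [::]; [::]; [:: 2]] [::]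
    else if ixeqb j (nxt i) then
      c 8 [:: [:: 3]] [:: [:: 2]; [::]; [:: 1]] [:: [::]; [:: -2]] [::]
    else c 8 [:: [:: 3]] [:: [:: 2]; [:: 1]] [:: [:: -2]] [::]
  | H j =>
    if ixeqb j i then c 2 [:: [:: 0; 1]] [:: [:: 0; 1]] [:: [::]; [::]; [:: 1]] [::]
    else c 16 [:: [:: 0; 3]] [:: [:: 0; 2]; [::]; [::]; [::]; [:: 1]]
              [:: [::]; [::]; [:: 2]; [:: sgn (ixeqb j (nxt i)) 8]] [::]
  | Gap _ _ => c 0 [::] [::] [::] [::]
  end.

Definition v_cert i x : Z * (flabel -> seq pol) :=
  let c m p1 p0 p2 p38 pt := (m, fun l => match l with
    | fus1 => p1 | fus0 => p0 | fus2 => p2 | fus38 => p38 | fust => pt end) in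
  match x with
  | A j e =>
    if ixeqb j i then c 2 [:: [:: 0; 1]] [:: [:: 1]] [:: [:: 2]] [::] [:: [:: sgn e 1]]
    else let d := ixeqb j (nxt i) in
      c 16 [:: [:: 3]] [:: [::]; [:: 1]] [:: [::]; [:: sgn d 4]]
        (if d then [:: [:: sgn e 8]] else [:: [::]; [:: sgn e 8]]) [::]
  | W j =>
    if ixeqb j i then c 1 [:: [:: 1]] [::] [::] [::] [::]
    else let d := ixeqb j (nxt i) in
      c 12 [:: [:: 3; -16]] [:: [::]; [:: 0; 4]; [:: sgn d 16]; [:: 1]]
        [:: [:: -16]; [:: 0; sgn d 16]; [:: 16]; [:: sgn d 6]] [::] [::]
  | H j =>
    if ixeqb j i then c 2 [:: [:: 0; 1]] [::] [:: [:: 1]] [::] [::]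
    else let d := ixeqb j (nxt i) in
      c 24 [:: [:: 0; -3]] [:: [::]; [:: 0; 3]; [:: sgn d 4]]
        [:: [::]; [:: 0; sgn d 4]; [:: 12]] [::] [::]
  | Gap _ _ => c 0 [::] [::] [::] [::] [::]
  end.
End Certs.

Definition bas (c : fvec) := all (fun q => basic q.1) c.

Definition basic_check L (labs : seq L) (E : L -> seq fvec) :=
  all (fun l => all bas (E l)) labs.

(** Coefficients are polynomials in t, so each evaluation settles all values of t at once. *)
Lemma a_checks i e :
  [/\ eig_check mlabs mpol (mem1 (A i e)) (a_eig i e),
      fusion_check mlabs mpol mtabs (mem1 (A i e)) (a_eig i e),
      span_check mlabs (a_eig i e) (a_cert i e)
    & basic_check mlabs (a_eig i e)].
Proof. by case: i; case: e; split; vm_compute. Qed.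

Lemma v_checks i :
  [/\ eig_check flabs fpol (mem1 (W i)) (v_eig i),
      fusion_check flabs fpol ftabs (mem1 (W i)) (v_eig i),
      span_check flabs (v_eig i) (v_cert i)
    & basic_check flabs (v_eig i)].
Proof. by case: i; split; vm_compute. Qed.

Lemma frob_checks : frob_check. Proof. by vm_compute. Qed.

Lemma mulTC : all (fun x => all (fun y => feq (mulT x y) (mulT y x)) basics) basics.
Proof. by vm_compute. Qed.

Lemma basic_mulT x y : bas (mulT x y).
Proof.
by case: x => [i e|i|i|? ?]; case: y => [j d|j|j|? ?] //;
  case: i; case: j; try case: e; try case: d.
Qed.

Lemma all_basics (P : pred atom) x : all P basics -> basic x -> P x.
Proof.
by rewrite /= => /and5P[? ? ? ? /and5P[? ? ? ? /and5P[? ? ? ? _]]]; case: x => [[] []|[]|[]|].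
Qed.

(** * Relations that force the undetermined products *)

Section Stages.
Local Open Scope Z_scope.

Definition atom_rank x : nat :=
  (match x with
  | A X1 _ => 0 | A X2 _ => 1 | A X3 _ => 2 | W X1 => 3 | W X2 => 4 | W X3 => 5
  | H X1 => 6 | H X2 => 7 | H X3 => 8 | Gap _ _ => 9
  end)%nat.

(** Ordering by rank gives one symbol for both orders of a product of positive level. *)
Definition gap x y := if (atom_rank x <= atom_rank y)%N then Gap x y else Gap y x.

(* Products of level above [n] are left undetermined. *)
Definition mulT_gap n x y : fvec :=
  mulT x y ++ if (n < level x y)%N then mem1 (gap x y) else [::].

Variable n : nat.
Let mul := fbil (mulT_gap n).

(** The eigenvalue is m/192. Undetermined products stay as [Gap] entries and fail the test unless
    they cancel, so a success is already valid at stage [n]. *)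
Definition eigU i e m v := bas v && feq (mul (mem1 (A i e)) v) (fscale (c0 m) v).

(* Resurrection: if y and z0 are 0-eigenvectors and z4 is a 1/4-eigenvector of
   a, then a (y (z0 + z4)) = (1/4) y z4. *)
Definition resurrection i e (y z0 z4 : fvec) : bool * fvec :=
  let yz := mul y (z0 ++ z4) in
  ([&& eigU i e 0 y, eigU i e 0 z0, eigU i e 48 z4 & bas yz],
   fvsub (fscale (c0 4) (mul (mem1 (A i e)) yz)) (fscale (c0 192) (mul y z4))).

Definition eig0v i e m := nth [::] (a_eig0 i e) (if ixeqb m (nxt i) then 1 else 2)%N.
Definition eig4v i e m := nth [::] (a_eig4 i e) (if ixeqb m (nxt i) then 0 else 1)%N.
Definition eig0h i e := nth [::] (a_eig0 i e) 3%N.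
Definition eig0hh i e := nth [::] (a_eig0 i e) 4%N.
Definition eig4h i e := nth [::] (a_eig4 i e) 2%N.
Definition eig4hh i e := nth [::] (a_eig4 i e) 3%N.

(* For 0-eigenvectors x, x' and 1/4-eigenvectors y, y', this compares a w
   with its value for w = 9 x x' + 4 y y' + 6 (x y' + y x'), the combination in which
   the products of two undetermined vectors cancel. *)
Definition rel_square i e : bool * fvec :=
  let a := mem1 (A i e) in let j := nxt i in let k := prv i in
  let al1 := eig0v i e j in let al2 := eig0v i e k in
  let be1 := eig4v i e j in let be2 := eig4v i e k in
  let X := mul al1 be2 ++ mul be1 al2 in
  let K := nf (fscale (c0 9) (mul al1 al2) ++ fscale (c0 4) (mul be1 be2) ++ fscale (c0 6) X) in
  ([&& eigU i e 0 al1, eigU i e 0 al2, eigU i e 48 be1, eigU i e 48 be2 & bas K],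
   fvsub (fscale (c0 2) (mul a K))
     (fscale (pscale 384 (fform be1 be2)) a ++ fscale (c0 576) X)).

End Stages.

(** For w = v_(j,k) this is 4 a (a w) = a w + 3 t a, scaled by 192^2. *)
Definition rel_plus n i e : fvec :=
  let w := mem1 (W i) in let a := mem1 (A i e) in
  let y := fbil (mulT_gap n) a w in
  fvsub (fscale (c0 4%BZ) (fbil (mulT_gap n) a y)) (fscale (c0 192%BZ) y ++ fscale (pmul (c0 192%BZ) (c1 576%BZ)) a).

(** Rule 0 * 0 = {0}, applied to 0-eigenvectors from the two 4A subalgebras containing the axis. *)
Definition rel_zero n i e : fvec :=
  fbil (mulT_gap n) (mem1 (A i e)) (fbil (mulT_gap n) (eig0v i e (nxt i)) (eig0v i e (prv i))).

(** Rule 0 * 1/4 = {1/4}, antisymmetrised: the product of the two vectors v cancels, and of [H j]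
    and [H k] only the difference occurs. It complements [rel_zero], which involves their sum. *)
Definition rel_quarter n i e : fvec :=
  let D := fbil (mulT_gap n) (eig0v i e (nxt i)) (eig4v i e (prv i)) ++
    fscale (c0 (-1)%BZ) (fbil (mulT_gap n) (eig0v i e (prv i)) (eig4v i e (nxt i))) in
  fvsub (fscale (c0 4%BZ) (fbil (mulT_gap n) (mem1 (A i e)) D)) (fscale (c0 192%BZ) D).

Section Generation.
Variables i j : ix.
Local Open Scope Z_scope.

(* Words in a_i and a_j which recover v_(i,j), a_{-i} and a_{-j}. *)
Definition gen1 := fvsub (fbil mulT (mem1 (A i true)) (mem1 (A j true)))
  [:: (A i true, c0 9); (A j true, c0 9)].
Definition gen2 := fvsub (fbil mulT (mem1 (A i true)) gen1) (fbil mulT (mem1 (A j true)) gen1).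
Definition gen3 := fvsub (fbil mulT (mem1 (A i true)) gen2)
  (fscale (c0 864) gen1 ++ [:: (A i true, c0 (-133920)); (A j true, c0 7020)]).

End Generation.

(** * Spans, eigenspaces and fusion over a ring with regular differences *)

Section Spanned.
Variables (S : comNzRingType) (V : lmodType S).

Definition spanned (X : seq V) : set V :=
  [set v | exists c : nat -> S, v = \sum_(i < size X) c i *: X`_i].

Lemma spanned0 X : spanned X 0.
Proof. by exists (fun=> 0); rewrite big1 // => i _; rewrite scale0r. Qed.

Lemma spannedD X u v : spanned X u -> spanned X v -> spanned X (u + v).
Proof.
move=> [c ->] [d ->]; exists (fun i => c i + d i).
by rewrite -big_split; apply: eq_bigr => i _ /=; rewrite scalerDl.
Qed.

Lemma spannedZ X r u : spanned X u -> spanned X (r *: u).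
Proof.
move=> [c ->]; exists (fun i => r * c i).
by rewrite scaler_sumr; apply: eq_bigr => i _; rewrite scalerA.
Qed.

Lemma spanned_nth X i : spanned X X`_i.
Proof.
have [iX|?] := ltnP i (size X); last by rewrite nth_default //; apply: spanned0.
exists (fun j => (j == i)%:R); rewrite (bigD1 (Ordinal iX)) //= eqxx scale1r.
rewrite big1 ?addr0 // => j /negbTE; rewrite -val_eqE /= => ->.
by rewrite scale0r.
Qed.

Lemma spanned_ind (X : seq V) (Q : V -> Prop) : Q 0 -> (forall x y, Q x -> Q y -> Q (x + y)) ->
    (forall r x, Q x -> Q (r *: x)) -> (forall i, (i < size X)%N -> Q X`_i) ->
  forall x, spanned X x -> Q x.
Proof.
move=> Q0 QD QZ QX x [c ->]; elim/big_rec: _ => // i y _; apply: QD; apply: QZ.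
exact: QX.
Qed.

End Spanned.

Section Eigen.
Variables (S : comNzRingType) (V : formAlg S) (a : V).

Definition regular (r : S) := forall x : V, r *: x = 0 -> x = 0.

Lemma eigensum0 L : eigensum a L 0.
Proof. by exists [::], (fun=> 0); rewrite big_nil. Qed.

Lemma eigensum1 (L : set S) l x : L l -> eigenspace a l x -> eigensum a L x.
Proof.
move=> Ll alx; exists [:: l], (fun=> x); rewrite big_seq1; split=> //.
by split=> // m; rewrite inE => /eqP ->.
Qed.

Lemma eigenspaceD l x y :
  eigenspace a l x -> eigenspace a l y -> eigenspace a l (x + y).
Proof. by rewrite /eigenspace /= => ax ay; rewrite amulDr ax ay scalerDr. Qed.

Lemma eigenspace0 l : eigenspace a l 0.
Proof. by rewrite /eigenspace /= amul0r scaler0. Qed.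

Lemma eigenspaceZ l r x : eigenspace a l x -> eigenspace a l (r *: x).
Proof. by rewrite /eigenspace /= => ax; rewrite amulZr ax !scalerA mulrC. Qed.

Lemma eigensumD L x y : eigensum a L x -> eigensum a L y -> eigensum a L (x + y).
Proof.
move=> [s [f [[us fs] ->]]] [r [g [[ur gr] ->]]].
(* The two families may use different scalars; both are extended by zero to the union of their
   lists. *)
pose F (s : seq S) (f : S -> V) l := if l \in s then f l else 0.
have big_undup (s1 s2 : seq S) (f1 : S -> V) : uniq s1 -> {subset s1 <= s2} -> uniq s2 ->
    \sum_(l <- s1) f1 l = \sum_(l <- s2) F s1 f1 l.
  move=> u1 s12 u2; rewrite /F -big_mkcond -big_filter /=; apply: perm_big.
  rewrite uniq_perm ?filter_uniq // => l; rewrite mem_filter.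
  by case: (boolP (l \in s1)) => // /s12 ->.
exists (undup (s ++ r)), (fun l => F s f l + F r g l); split; last first.
  rewrite big_split /=; congr (_ + _); apply: big_undup; rewrite ?undup_uniq // => l;
  by rewrite mem_undup mem_cat => ->; rewrite ?orbT.
split; first exact: undup_uniq.
move=> l; rewrite mem_undup mem_cat => lsr; split.
  by case/orP: lsr => [/fs|/gr] [].
apply: eigenspaceD; rewrite /F.
  by case: ifP => [/fs[]|_] //; apply: eigenspace0.
by case: ifP => [/gr[]|_] //; apply: eigenspace0.
Qed.

Lemma eigensumZ L r x : eigensum a L x -> eigensum a L (r *: x).
Proof.
move=> [s [f [[us fs] ->]]]; exists s, (fun l => r *: f l); split.
  by split=> // l /fs[Ll el]; split=> //; apply: eigenspaceZ.
by rewrite scaler_sumr.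
Qed.

Lemma eigensum_sum L I (r : seq I) (F : I -> V) :
  (forall i, eigensum a L (F i)) -> eigensum a L (\sum_(i <- r) F i).
Proof.
by move=> LF; elim/big_rec: _ => [|i x _]; [exact: eigensum0 | exact/eigensumD/LF].
Qed.

(** Applying a - [val i] to the sum removes the term at [i] and scales the others by differences of
    eigenvalues; induction and regularity then cancel these factors. *)
Lemma eigen_free (I : eqType) (val : I -> S) (s : seq I) (f : I -> V) :
    uniq s -> {in s &, forall i j, i != j -> regular (val i - val j)} ->
    {in s, forall i, eigenspace a (val i) (f i)} ->
  \sum_(i <- s) f i = 0 -> {in s, forall i, f i = 0}.
Proof.
elim: s f => [|i s IH] f //= /andP[is_ us] reg fs; rewrite big_cons => fi0.
have fs0 : {in s, forall j, f j = 0}.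
  move=> j js; apply: (reg j i); rewrite ?inE ?eqxx ?js ?orbT //.
    by apply: contraNneq is_ => <-.
  have: \sum_(j <- s) (val j - val i) *: f j = 0.
    have := congr1 (amul a) fi0.
    rewrite amulDr amul0r amul_sumr fs ?mem_head // big_seq_cond.
    rewrite (eq_bigr (fun j => val j *: f j)) => [|k /andP[ks _]]; last first.
      by rewrite fs // inE ks orbT.
    rewrite -big_seq_cond => /eqP; rewrite addrC addr_eq0 => /eqP ai0.
    under eq_bigr do rewrite scalerBl.
    by rewrite sumrB -scaler_sumr ai0 -opprD -scalerDr fi0 scaler0 oppr0.
  move/(IH _ us); apply=> // [k l ks ls|k ks].
    by apply: reg; rewrite inE ?ks ?ls orbT.
  by apply: eigenspaceZ; apply: fs; rewrite inE ks orbT.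
move=> j; rewrite inE => /predU1P[->|/fs0 //].
by rewrite -[RHS]fi0 big_seq big1 ?addr0.
Qed.

Definition ann (s : seq S) (v : V) := foldr (fun l v => a *a v - l *: v) v s.

Lemma annD s u v : ann s (u + v) = ann s u + ann s v.
Proof. by elim: s => //= l s ->; rewrite amulDr scalerDr opprD addrACA. Qed.

Lemma annZ s r v : ann s (r *: v) = r *: ann s v.
Proof. by elim: s => //= l s ->; rewrite amulZr scalerBr !scalerA mulrC. Qed.

Lemma ann0 s : ann s 0 = 0.
Proof. by rewrite -{1}(scale0r (0 : V)) annZ scale0r. Qed.

Lemma ann_sum s I (r : seq I) (F : I -> V) :
  ann s (\sum_(i <- r) F i) = \sum_(i <- r) ann s (F i).
Proof. by elim: r => [|i r IH]; rewrite ?big_nil ?ann0 // !big_cons annD IH. Qed.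

Lemma ann_eigen s l x :
  eigenspace a l x -> ann s x = (\prod_(m <- s) (l - m)) *: x.
Proof.
move=> ax; elim: s => [|m s IH] /=; first by rewrite big_nil scale1r.
by rewrite big_cons IH amulZr ax !scalerA mulrBl scalerBl mulrC.
Qed.

End Eigen.

Section TableFusion.
Variables (S : comNzRingType) (V : formAlg S) (a : V).
Variables (L : eqType) (val : L -> S) (tab : L -> L -> set L).
Hypothesis tabC : forall l m, tab l m = tab m l.
Variables (labs : seq L) (tabs : L -> L -> seq L) (K : L -> set V).
Hypotheses (labsT : forall l, l \in labs) (labsU : uniq labs).
Hypothesis reg : forall l m, l != m -> regular V (val l - val m).
Hypothesis tabsP : forall l m n, tab l m n <-> n \in tabs l m.
Hypothesis Kspan :
  forall x, exists2 f, forall l, K l (f l) & x = \sum_(l <- labs) f l.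
Hypothesis Keig : forall l x, K l x -> eigenspace a (val l) x.
Hypothesis Kmul :
  forall l m x y, K l x -> K m y -> ann a (map val (tabs l m)) (x *a y) = 0.

(** Subtracting x from the l-th component of its decomposition gives eigenvectors with sum zero; by
    freeness x equals that component. *)
Lemma eigenspace_sub l x : eigenspace a (val l) x -> K l x.
Proof.
move=> ax; have [f Kf xf] := Kspan x.
pose g m := f m - if m == l then x else 0.
have gE m : eigenspace a (val m) (g m).
  rewrite /g -scaleN1r; apply: eigenspaceD; first exact/Keig.
  apply: eigenspaceZ; case: eqP => [-> //|_]; exact: eigenspace0.
have g0 : \sum_(m <- labs) g m = 0.
  rewrite sumrB -xf -big_mkcond /= -big_filter.
  rewrite (@perm_big _ _ _ _ _ [:: l]) ?big_seq1 ?subrr //.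
  rewrite uniq_perm ?filter_uniq // => m.
  by rewrite mem_filter labsT andbT inE.
have := eigen_free labsU (fun m n _ _ => @reg m n) (fun m _ => gE m) g0 (labsT l).
by rewrite /g eqxx => /eqP; rewrite subr_eq0 => /eqP <-.
Qed.

(** On the component of label l the product of operators is multiplication by the product of the
    differences [val l] - [val m], m in s. This is injective for l outside s, so such components
    vanish. *)
Lemma ann_eigensum (s : seq L) x :
  ann a (map val s) x = 0 -> eigensum a (val @` [set` s]) x.
Proof.
have [f Kf ->] := Kspan x; rewrite ann_sum => ann0.
have f0 l : l \notin s -> f l = 0.
  have regs (r : seq L) : l \notin r ->
      forall z : V, (\prod_(m <- map val r) (val l - m)) *: z = 0 -> z = 0.
    elim: r => [|m r IH] /=; first by move=> _ z; rewrite big_nil scale1r.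
    rewrite inE negb_or => /andP[lm /IH {}IH] z.
    by rewrite big_cons -scalerA => /(reg lm)/IH.
  move=> ls; apply: (regs _ ls); rewrite -(ann_eigen (a := a)); last exact/Keig.
  apply: (@eigen_free _ _ a _ val labs (fun m => ann a (map val s) (f m))) => //.
    by move=> m n _ _; apply: reg.
  move=> m _; rewrite (ann_eigen _ (Keig (Kf m))).
  by apply: eigenspaceZ; apply/Keig.
apply: eigensum_sum => l; have [ls|/f0 ->] := boolP (l \in s); last exact: eigensum0.
by apply: (@eigensum1 _ _ _ _ (val l)); [exists l | apply/Keig].
Qed.

Lemma table_fusion : satisfies_fusion a (table_rule val tabC).
Proof.
split.
- move=> s f [us fs] sf0; apply: (@eigen_free _ _ a _ id s f us) => //.
    move=> l m /fs[[l' _ <-] _] /fs[[m' _ <-] _] lm.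
    by apply: reg; apply: contra_neq lm => ->.
  by move=> l /fs[].
- apply/seteqP; split=> // x _; have [f Kf ->] := Kspan x.
  apply: eigensum_sum => l.
  by apply: (@eigensum1 _ _ _ _ (val l)); [exists l | apply/Keig].
move=> _ _ x y [l _ <-] [m _ <-] /eigenspace_sub Kx /eigenspace_sub Ky.
have [s [f [[us fs] ->]]] := ann_eigensum (Kmul Kx Ky).
exists s, f; split=> //; split=> // n /fs[[k ks <-] ak]; split=> //.
by exists l, m; split=> //; exists k => //; apply/tabsP.
Qed.

End TableFusion.

Definition mcode l := match l with mon1 => 0 | mon0 => 1 | mon4 => 2 | mon32 => 3 end%N.
Definition mdecode n := match n with 0 => mon1 | 1 => mon0 | 2 => mon4 | _ => mon32 end%N.
Lemma mcodeK : cancel mcode mdecode. Proof. by case. Qed.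
HB.instance Definition _ := Equality.copy mlabel (can_type mcodeK).

Definition fcode l :=
  match l with fus1 => 0 | fus0 => 1 | fus2 => 2 | fus38 => 3 | fust => 4 end%N.
Definition fdecode n :=
  match n with 0 => fus1 | 1 => fus0 | 2 => fus2 | 3 => fus38 | _ => fust end%N.
Lemma fcodeK : cancel fcode fdecode. Proof. by case. Qed.
HB.instance Definition _ := Equality.copy flabel (can_type fcodeK).

Section Scalars.
Variables (R : realType) (S : comNzRingType) (iota : {rmorphism R -> S}).

Lemma zev_iota z : zev S z = iota ((int_of_Z z)%:~R).
Proof. by rewrite /zev rmorph_int. Qed.

Lemma zev_nat z n : int_of_Z z = Posz n -> zev S z = iota n%:R.
Proof. by move=> zn; rewrite zev_iota zn. Qed.

Lemma zev_neq0 z : ~~ Z.eqb 0%BZ z -> (int_of_Z z)%:~R != 0 :> R.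
Proof. by rewrite intr_eq0; case: z => // p _; rewrite -lt0n; lia. Qed.

Lemma iota_cancel (V : lmodType S) (r : R) (x y : V) :
  r != 0 -> iota r *: x = iota r *: y -> x = y.
Proof.
move=> r0 /(congr1 (GRing.scale (iota r^-1))).
by rewrite !scalerA -rmorphM mulVf // rmorph1 !scale1r.
Qed.

Lemma zev_cancel (V : lmodType S) z (x y : V) :
  ~~ Z.eqb 0%BZ z -> zev S z *: x = zev S z *: y -> x = y.
Proof. by move=> /zev_neq0 z0; rewrite zev_iota; apply: iota_cancel. Qed.

Lemma c0E (t : S) z : pev t (c0 z) = zev S z.
Proof. by rewrite /= mulr0 addr0. Qed.

End Scalars.

(** * Fusion rules in any algebra spanned by vectors obeying the table *)

Section TableAlgebra.
Variables (R : realType) (S : comNzRingType) (iota : {rmorphism R -> S}).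
Variables (V : formAlg S) (t : S) (b : atom -> V).
Local Notation eval := (ev t b).
Local Notation z192 := (zev S 192%BZ).

Definition table_ok := forall x y, basic x -> basic y ->
  eval (mulT x y) = z192 *: (b x *a b y).

Definition spanning := forall v, exists c : atom -> S,
  v = \sum_(x <- basics) c x *: b x.

Hypotheses (tbl : table_ok) (spn : spanning).

Lemma ev_mul c d : bas c -> bas d -> eval (fbil mulT c d) = z192 *: (eval c *a eval d).
Proof. exact: ev_fbil. Qed.

Lemma bas_cat c d : bas (c ++ d) = bas c && bas d.
Proof. exact: all_cat. Qed.

Lemma bas_scale p c : bas c -> bas (fscale p c).
Proof. by rewrite /bas /fscale all_map. Qed.

Lemma bas_flatten (I : Type) (r : seq I) (F : I -> fvec) :
  (forall i, bas (F i)) -> bas (flatten [seq F i | i <- r]).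
Proof. by move=> bF; elim: r => //= i r IH; rewrite bas_cat bF. Qed.

Lemma bas_nf c : bas c -> bas (nf c).
Proof.
rewrite /nf; move: (size c) => n; elim: n c => [|n IH] [|q c] //= /andP[bq bc].
have br : bas (nfrec n [seq q' <- c | ~~ atomeqb q.1 q'.1]).
  by apply: IH; rewrite /bas all_filter; apply: sub_all bc => q' /= ->; exact: implybT.
by case: ifP => //= _; rewrite bq.
Qed.

Lemma bas_bil c d : bas (fbil mulT c d).
Proof.
apply/bas_nf/bas_flatten => p; apply/bas_flatten => q.
exact/bas_scale/basic_mulT.
Qed.

Lemma ev_mem1 x : eval (mem1 x) = b x.
Proof. by rewrite /mem1 ev_cons ev_nil addr0 /= mulr0 addr0 scale1r. Qed.

Lemma z192_cancel (x y : V) : z192 *: x = z192 *: y -> x = y.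
Proof. exact: (zev_cancel iota). Qed.

Section Check.
Variables (L : eqType) (val : L -> S) (tab : L -> L -> set L).
Hypothesis tabC : forall l m, tab l m = tab m l.
Variables (labs : seq L) (tabs : L -> L -> seq L) (lp : L -> pol).
Hypotheses (labsT : forall l, l \in labs) (labsU : uniq labs).
Hypothesis reg : forall l m, l != m -> regular V (val l - val m).
Hypothesis tabsP : forall l m n, tab l m n <-> n \in tabs l m.
Hypothesis lpE : forall l, pev t (lp l) = z192 * val l.
Variables (a : fvec) (E : L -> seq fvec) (cert : atom -> Z * (L -> seq pol)).
Hypotheses (bas_a : bas a) (basE : basic_check labs E).
Hypotheses (eigE : eig_check labs lp a E) (fusE : fusion_check labs lp tabs a E).
Hypothesis spanE : span_check labs E cert.

Let K l : set V := spanned [seq eval e | e <- E l].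

Lemma K_sum l (P : V -> Prop) : P 0 -> (forall x y, P x -> P y -> P (x + y)) ->
    (forall r x, P x -> P (r *: x)) ->
    (forall i, (i < size (E l))%N -> P (eval (nth [::] (E l) i))) ->
  forall x, K l x -> P x.
Proof.
move=> P0 PD PZ PE; apply: spanned_ind => // i.
by rewrite size_map => iE; rewrite (nth_map [::]) //; apply: PE.
Qed.

Lemma K_eigen l x : K l x -> eigenspace (eval a) (val l) x.
Proof.
apply: K_sum x => [|x y|r x|i iE].
- exact: eigenspace0.
- exact: eigenspaceD.
- exact: eigenspaceZ.
have /(all_nthP [::])/(_ i iE)/(feq_ev t b) := allP eigE l (labsT l).
have /(all_nthP [::])/(_ i iE) bEi := allP basE l (labsT l).
by rewrite ev_mul // ev_scale lpE -scalerA => /z192_cancel.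
Qed.

(** Multiplication by the axis in the scaled table costs one factor 192 per operator. *)
Lemma ev_annf s c : bas c -> bas (annf lp a s c) /\
  eval (annf lp a s c) = z192 ^+ size s *: ann (eval a) (map val s) (eval c).
Proof.
move=> bc; elim: s => [|l s [bs IH]] /=; first by rewrite expr0 scale1r.
split.
  apply/bas_nf; rewrite /fvsub bas_cat bas_bil /=; exact/bas_scale/bas_scale.
rewrite ev_nf ev_sub ev_mul // ev_scale IH lpE exprS amulZr scalerBr !scalerA.
by congr (_ - _ *: _); ring.
Qed.

(** Bilinearity reduces this to the listed eigenvectors, where the computed check gives zero up to a
    power of 192. *)
Lemma K_mul l m x y :
  K l x -> K m y -> ann (eval a) (map val (tabs l m)) (x *a y) = 0.
Proof.
pose N := ann (eval a) (map val (tabs l m)).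
move=> + Ky; apply: (@K_sum l (fun x => N (x *a y) = 0)) => [|{}x x'|r {}x|i iE]; rewrite /N.
- by rewrite amul0l ann0.
- by move=> x0 x0'; rewrite amulDl annD x0 x0' addr0.
- by move=> x0; rewrite amulZl annZ x0 scaler0.
move: y Ky; apply: (@K_sum m (fun y => N (_ *a y) = 0)) => [|{}x x'|r {}x|j jE]; rewrite /N.
- by rewrite amul0r ann0.
- by move=> x0 x0'; rewrite amulDr annD x0 x0' addr0.
- by move=> x0; rewrite amulZr annZ x0 scaler0.
have /(all_nthP [::])/(_ i iE) bEi := allP basE l (labsT l).
have /(all_nthP [::])/(_ j jE) bEj := allP basE m (labsT m).
have /allP/(_ m (labsT m)) := allP fusE l (labsT l).
move/(all_nthP [::])/(_ i iE)/(all_nthP [::])/(_ j jE)/(fzero_ev t b).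
have [_ ->] := ev_annf (tabs l m) (bas_bil (nth [::] (E l) i) (nth [::] (E m) j)).
rewrite ev_mul // annZ scalerA -exprSr.
elim: (size _).+1 => [|n IH]; first by rewrite expr0 scale1r.
by rewrite exprS -scalerA -{1}(scaler0 _ z192) => /z192_cancel.
Qed.

Lemma K_lincomb l cs : K l (eval (lincomb cs (E l))).
Proof.
rewrite ev_flatten; have sub i : K l (eval (nth [::] (E l) i)).
  have [iE|iE] := ltnP i (size (E l)); last first.
    by rewrite nth_default // ev_nil; apply: spanned0.
  by have := spanned_nth [seq eval e | e <- E l] i; rewrite (nth_map [::]).
elim: (E l) cs sub => [|e Es IH] [|c cs] sub; rewrite ?big_nil; try exact: spanned0.
rewrite /= big_cons; apply: spannedD; last by apply: IH => i; apply: (sub i.+1).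
by rewrite ev_scale; apply/spannedZ/(sub 0%N).
Qed.

Lemma K_span v : exists2 f, forall l, K l (f l) & v = \sum_(l <- labs) f l.
Proof.
pose Q v := exists2 f, forall l, K l (f l) & v = \sum_(l <- labs) f l.
have Q0 : Q 0 by exists (fun=> 0); [move=> l; apply: spanned0 | rewrite big1].
have QD x y : Q x -> Q y -> Q (x + y).
  move=> [f Kf ->] [g Kg ->]; exists (fun l => f l + g l); rewrite ?big_split //.
  by move=> l; exact: spannedD (Kf l) (Kg l).
have QZ r x : Q x -> Q (r *: x).
  move=> [f Kf ->]; exists (fun l => r *: f l); rewrite ?scaler_sumr //.
  by move=> l; exact: spannedZ (Kf l).
have [c ->] := spn v.
(* The certificate decomposes an integer multiple of each atom; the multiplier is inverted in the
   reals. *)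
have Qb x : basic x -> Q (b x).
  move=> /(all_basics spanE)/andP[].
  set m := (cert x).1; set cs := (cert x).2 => /(zev_neq0 R) m0 /(feq_ev t b).
  rewrite ev_scale c0E ev_mem1 ev_flatten (zev_iota iota) => bE.
  have -> : b x = iota ((int_of_Z m)%:~R^-1) *: \sum_(l <- labs) eval (lincomb (cs l) (E l)).
    by rewrite -bE scalerA -rmorphM mulVf // rmorph1 scale1r.
  by apply: QZ; exists (fun l => eval (lincomb (cs l) (E l))) => // l; apply: K_lincomb.
have: all basic basics by [].
elim: basics => [_|x s IH /= /andP[bx /IH Qs]]; rewrite ?big_nil // big_cons.
exact: QD (QZ _ _ (Qb _ bx)) Qs.
Qed.

Lemma check_fusion : satisfies_fusion (eval a) (table_rule val tabC) /\
  forall l x, eigenspace (eval a) (val l) x -> K l x.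
Proof.
split; first exact: (table_fusion tabC labsT labsU reg tabsP K_span K_eigen K_mul).
by move=> l x; apply: (eigenspace_sub labsT labsU reg K_span K_eigen).
Qed.

End Check.

Lemma iota_regular (r : R) : r != 0 -> regular V (iota r).
Proof. by move=> r0 x; rewrite -{1}(scaler0 _ (iota r)); apply: iota_cancel. Qed.

Lemma mlabs_all l : l \in mlabs. Proof. by case: l. Qed.

Lemma mlabs_uniq : uniq mlabs. Proof. by []. Qed.

Definition mreal (l : mlabel) : R :=
  match l with mon1 => 1 | mon0 => 0 | mon4 => 1 / 4 | mon32 => 1 / 32 end.

Lemma mvalE l : mval iota l = iota (mreal l).
Proof. by case: l => //=; rewrite ?rmorph1 ?rmorph0. Qed.

Lemma mreal_inj : injective mreal.
Proof. by case; case=> //= e; exfalso; lra. Qed.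

Lemma mval_inj : injective (mval iota).
Proof. by move=> l m; rewrite !mvalE => /fmorph_inj/mreal_inj. Qed.

Lemma mval_regular l m : l != m -> regular V (mval iota l - mval iota m).
Proof.
move=> lm; rewrite !mvalE -rmorphB; apply: iota_regular.
by rewrite subr_eq0; apply: contra_neq lm => /mreal_inj.
Qed.

Lemma mtabsP l m n : mtab l m n <-> n \in mtabs l m.
Proof.
case: l; case: m; case: n; rewrite /= ?in_nil ?inE; split=> //;
  try by [intuition discriminate | intuition].
Qed.

Lemma mpolE l : pev t (mpol l) = z192 * mval iota l.
Proof.
rewrite mvalE; case: l; rewrite /= ?mulr0 ?addr0 ?rmorph0 ?rmorph1 ?mulr0 ?mulr1 //.
- by rewrite (@zev_nat _ _ iota 192%BZ 192) // (@zev_nat _ _ iota 48%BZ 48) //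
        -rmorphM; congr (iota _); lra.
- by rewrite (@zev_nat _ _ iota 192%BZ 192) // (@zev_nat _ _ iota 6%BZ 6) //
        -rmorphM; congr (iota _); lra.
Qed.

Lemma axis_fusion i e :
  satisfies_fusion (b (A i e)) (monster_rule iota) /\
  forall l x, eigenspace (b (A i e)) (mval iota l) x ->
    spanned [seq eval c | c <- a_eig i e l] x.
Proof.
have [eigE fusE spanE basE] := a_checks i e; rewrite -(ev_mem1 (A i e)).
exact: (check_fusion mtabC mlabs_all mlabs_uniq mval_regular mtabsP mpolE _ basE eigE fusE spanE).
Qed.

(** The list for eigenvalue 1 is the axis alone, and the whole eigenspace lies in its span. *)
Lemma axis_primitive i e : idempotent_elt (b (A i e)) -> primitive_elt (b (A i e)).
Proof.
move=> ii; apply/seteqP; split=> [x|_ [r _ <-]]; last first.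
  by rewrite /eigenspace /= amulZr ii scale1r.
move/((axis_fusion i e).2 mon1) => [c ->]; exists (c 0%N) => //.
by rewrite big_ord1 /= -(ev_mem1 (A i e)).
Qed.

Lemma flabs_all l : l \in flabs. Proof. by case: l. Qed.

Lemma flabs_uniq : uniq flabs. Proof. by []. Qed.

Lemma ftabsP l m n : ftab l m n <-> n \in ftabs l m.
Proof.
case: l; case: m; case: n; rewrite /= ?in_nil ?inE; split=> //;
  try by [intuition discriminate | intuition].
Qed.

Lemma fpolE l : pev t (fpol l) = z192 * fval iota t l.
Proof.
case: l; rewrite /= ?mulr0 ?addr0 ?mulr1 //.
- by rewrite (@zev_nat _ _ iota 192%BZ 192) // (@zev_nat _ _ iota 96%BZ 96) //
        -rmorphM; congr (iota _); lra.
- by rewrite (@zev_nat _ _ iota 192%BZ 192) // (@zev_nat _ _ iota 72%BZ 72) //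
        -rmorphM; congr (iota _); lra.
- by rewrite (_ : zev S 0%BZ = 0) // add0r mulrC.
Qed.

Lemma v_fusion i :
    (forall l m, l != m -> regular V (fval iota t l - fval iota t m)) ->
  satisfies_fusion (b (W i)) (F4A iota t).
Proof.
move=> reg; have [eigE fusE spanE basE] := v_checks i; rewrite -(ev_mem1 (W i)).
have bw : bas (mem1 (W i)) by [].
by have [] := check_fusion ftabC flabs_all flabs_uniq reg ftabsP fpolE bw basE eigE fusE spanE.
Qed.

End TableAlgebra.

(** * Consequences of the Monster fusion rule for a primitive axis *)

Section Axis.
Variables (R : realType) (S : comNzRingType) (iota : {rmorphism R -> S}).
Variables (V : formAlg S) (a : V).
Hypotheses (axis : is_axis (monster_rule iota) a) (prim : primitive_elt a).
Hypothesis frob : forall u v w : V, aform u (v *a w) = aform (u *a v) w.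
Hypothesis norm : aform a a = 1.

(** Labels of equal value would merge entries of the table; since [mval] is injective, the entry is
    exactly [mtab l m]. *)
Lemma monster_mul l m x y :
    eigenspace a (mval iota l) x -> eigenspace a (mval iota m) y ->
  eigensum a (mval iota @` mtab l m) (x *a y).
Proof.
move=> ax ay; have [_ [_ _ /(_ (mval iota l) (mval iota m))]] := axis.
move=> /(_ x y (ex_intro2 _ _ l I erefl) (ex_intro2 _ _ m I erefl) ax ay).
move=> [s [f [[us fs] ->]]]; exists s, f; split=> //; split=> // k /fs [+ ak].
by move=> [l' [m' [/mval_inj -> /mval_inj -> ?]]].
Qed.

Lemma eigensum_single l x : eigensum a [set l] x -> eigenspace a l x.
Proof.
move=> [s [f [[_ fs] ->]]]; rewrite big_seq.
elim/big_rec: _ => [|k y ks ay]; first exact: eigenspace0.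
by have [-> ak] := fs k ks; apply: eigenspaceD.
Qed.

Lemma eigenspace0E x : a *a x = 0 -> eigenspace a 0 x.
Proof. by rewrite /eigenspace /= scale0r. Qed.

Lemma monster00 x y : a *a x = 0 -> a *a y = 0 -> a *a (x *a y) = 0.
Proof.
move=> /eigenspace0E ax /eigenspace0E ay.
have := @monster_mul mon0 mon0 x y ax ay; rewrite /= image_set1 => /eigensum_single.
by rewrite /eigenspace /= scale0r.
Qed.

Lemma monster04 x y : a *a x = 0 -> a *a y = iota (1 / 4) *: y ->
  a *a (x *a y) = iota (1 / 4) *: (x *a y).
Proof.
move=> /eigenspace0E ax ay.
by have := @monster_mul mon0 mon4 x y ax ay; rewrite /= image_set1 => /eigensum_single.
Qed.

Lemma aform0l x : aform (0 : V) x = 0.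
Proof. by rewrite -{1}(scale0r (0 : V)) aformZl mul0r. Qed.

Lemma aform0r (x : V) : aform x 0 = 0.
Proof. by rewrite -{1}(scale0r (0 : V)) aformZr mul0r. Qed.

Lemma axis_form x : aform a (a *a x) = aform a x.
Proof. by rewrite frob axis.1. Qed.

(** Symmetry against an axis comes from a = a a, by moving the factors with the Frobenius
    identity. *)
Lemma axis_formC x : aform x a = aform a x.
Proof. by rewrite -[X in aform x X]axis.1 frob amulC -frob amulC axis_form. Qed.

(** The product lies in V_1 + V_0, so by primitivity a (x y) is a multiple of a; pairing with a
    gives the factor <a, x y> = <a x, y>. *)
Lemma monster44 x y : a *a x = iota (1 / 4) *: x -> a *a y = iota (1 / 4) *: y ->
  a *a (x *a y) = (iota (1 / 4) * aform x y) *: a.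
Proof.
move=> ax ay; have [s [f [[_ fs] sE]]] := @monster_mul mon4 mon4 x y ax ay.
have [r ar] : exists r, a *a (x *a y) = r *: a.
  rewrite sE big_seq; elim/big_rec: _ => [|k z /fs[k01 ak] [r ar]].
    by exists 0; rewrite amul0r scale0r.
  have [q aq] : exists q, a *a f k = q *: a.
    case: k01 ak => l [-> <-|-> <-] /= ak; last first.
      by exists 0; rewrite [LHS]ak !scale0r.
    have [q _ qE] : range (fun r : S => r *: a) (f 1) by rewrite -prim.
    by exists q; rewrite -qE amulZr axis.1.
  by exists (q + r); rewrite amulDr ar aq scalerDl.
rewrite ar; congr (_ *: _).
rewrite -[r]mulr1 -norm -aformZr -ar axis_form frob ax aformZl //.
Qed.

(* On V_1 + V_0 + V_{1/4}, the operator a (a - 1/4) is 3/4 times the projection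
   onto the axis. *)
Definition plus x := a *a (a *a x) =
  iota (1 / 4) *: (a *a x) + (iota (3 / 4) * aform a x) *: a.

Lemma plusD x y : plus x -> plus y -> plus (x + y).
Proof.
rewrite /plus => ax ay; rewrite !amulDr ax ay aformDr mulrDr scalerDl scalerDr.
by rewrite addrACA.
Qed.

Lemma plusZ r x : plus x -> plus (r *: x).
Proof.
rewrite /plus => ax; rewrite !amulZr ax aformZr scalerDr !scalerA.
by congr (_ *: _ + _ *: _); ring.
Qed.

Lemma plus_axis z r : a *a z = r *: a -> plus z.
Proof.
move=> az; have ra : aform a z = r by rewrite -axis_form az aformZr norm mulr1.
rewrite /plus az amulZr axis.1 ra scalerA -scalerDl; congr (_ *: _).
rewrite -mulrDl -rmorphD (_ : 1 / 4 + 3 / 4 = 1 :> R) ?rmorph1 ?mul1r //; lra.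
Qed.

Lemma plus0 x : a *a x = 0 -> plus x.
Proof. by move=> ax; apply: (@plus_axis x 0); rewrite scale0r. Qed.

(** The axis is orthogonal to x up to the factor 3/4, since <a, x> = <a, a x> = 1/4 <a, x>. *)
Lemma plus4 x : a *a x = iota (1 / 4) *: x -> plus x.
Proof.
move=> ax; have ax0 : iota (3 / 4) * aform a x = 0.
  rewrite (_ : 3 / 4 = 1 - 1 / 4 :> R); last by lra.
  by rewrite rmorphB rmorph1 mulrBl mul1r -aformZr -ax axis_form subrr.
by rewrite /plus ax0 scale0r addr0 ax amulZr ax.
Qed.

Lemma plus_mul p q p' q' :
    a *a p = 0 -> a *a p' = 0 -> a *a q = iota (1 / 4) *: q ->
    a *a q' = iota (1 / 4) *: q' ->
  plus ((p + q + a) *a (p' + q' + a)).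
Proof.
move=> ap ap' aq aq'; rewrite !amulDl !amulDr ![_ *a a]amulC ap ap' aq aq' axis.1.
have pa : plus a by apply: (@plus_axis a 1); rewrite axis.1 scale1r.
have p0 : plus 0 by apply: plus0; rewrite amul0r.
do ![apply: plusD => //|apply: plusZ]; try exact: plus4.
- exact/plus0/monster00.
- exact/plus4/monster04.
- by rewrite amulC; apply/plus4/monster04.
- exact: plus_axis (monster44 aq aq').
Qed.

End Axis.

Definition ord_of (i : ix) : 'I_3 := match i with X1 => i1 | X2 => i2 | X3 => i3 end.

Lemma pev_sum (S : comNzRingType) (t : S) I (r : seq I) (F : I -> pol) :
  pev t (foldr padd [::] [seq F i | i <- r]) = \sum_(i <- r) pev t (F i).
Proof. by elim: r => [|i r IH] /=; rewrite ?big_nil // big_cons pevD IH. Qed.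

Lemma ev_form (S : comNzRingType) (t : S) (V : formAlg S) (g : atom -> V) (P : pred atom)
    (k : S) c d :
    (forall x y, P x -> P y -> k * aform (g x) (g y) = pev t (gramT x y)) ->
    all (fun q => P q.1) c -> all (fun q => P q.1) d ->
  pev t (fform c d) = k * aform (ev t g c) (ev t g d).
Proof.
move=> gG; rewrite pev_sum; elim: c => [|p c IH] /=.
  by rewrite big_nil ev_nil aform0l mulr0.
move=> /andP[Pp Pc] Pd; rewrite big_cons ev_cons aformDl mulrDr IH //.
congr (_ + _); rewrite pev_sum {IH}; elim: d Pd => [|q d IH] /=.
  by rewrite big_nil ev_nil aform0r mulr0.
move=> /andP[Pq Pd]; rewrite big_cons ev_cons aformDr mulrDr IH //.
by congr (_ + _); rewrite !pevM -gG // aformZl aformZr; ring.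
Qed.

(** * Derivation of the table in a member of the class *)

Section Derivation.
Variables (R : realType) (S : comNzRingType) (iota : {rmorphism R -> S}).
Variables (V : formAlg S) (a : 'I_3 -> bool -> V) (v : 'I_3 -> 'I_3 -> V).
Hypothesis (cls : class4A iota a) (hv : shape4A_vectors iota a v).
Let t := aform (a i1 true) (v i2 i3).
Local Notation z192 := (zev S 192%BZ).

Definition bvec x : V := match x with
  | A i e => a (ord_of i) e
  | W i => v (ord_of (nxt i)) (ord_of (prv i))
  | H i => a (ord_of i) true *a v (ord_of (nxt i)) (ord_of (prv i))
           - (iota (1 / 2) * t) *: (a (ord_of i) true - a (ord_of i) false)
  | Gap _ _ => 0
  end.

Definition gvec x : V :=
  if x is Gap y z then z192 *: (bvec y *a bvec z) - ev t bvec (mulT y z) else bvec x.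

Definition stage n := forall x y, basic x -> basic y -> (level x y <= n)%N ->
  ev t bvec (mulT x y) = z192 *: (bvec x *a bvec y).

Local Notation evg := (ev t gvec).

Lemma ev_gvec c : bas c -> evg c = ev t bvec c.
Proof.
elim: c => [|[x p] c IH] /=; first by rewrite !ev_nil.
by move=> /andP[bx /IH]; rewrite !ev_cons => ->; case: x bx.
Qed.

Lemma gap_gvec x y : basic x -> basic y ->
  gvec (gap x y) = z192 *: (bvec x *a bvec y) - ev t bvec (mulT x y).
Proof.
rewrite /gap; case: ifP => //= _ bx y_; rewrite amulC; congr (_ - _).
have := all_basics (all_basics mulTC bx) y_.
by move/(feq_ev t bvec) ->.
Qed.

Lemma gap_eq0 x y : basic x -> basic y -> gvec (gap x y) = 0 ->
  ev t bvec (mulT x y) = z192 *: (bvec x *a bvec y).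
Proof. by move=> bx y_ /eqP; rewrite gap_gvec // subr_eq0 => /eqP. Qed.

Lemma zevn z n : int_of_Z z = Posz n -> zev S z = n%:R.
Proof. by rewrite /zev => ->; rewrite -pmulrn. Qed.

Lemma zevNn z n : int_of_Z z = Negz n -> zev S z = - n.+1%:R.
Proof. by rewrite /zev => ->; rewrite NegzE mulrNz -pmulrn. Qed.

Lemma c1E z : pev t (c1 z) = zev S z * t.
Proof. by rewrite /= mulr0 addr0 [zev S Z0](_ : _ = 0) // add0r mulrC. Qed.

Lemma natr_cancel n (x y : S) : n.+1%:R * x = n.+1%:R * y -> x = y.
Proof.
by rewrite -(rmorph_nat iota) => /(@iota_cancel _ _ iota S^o); apply; rewrite pnatr_eq0.
Qed.

Lemma iota_nat (r : R) m n : m%:R * r = n%:R -> m%:R * iota r = n%:R.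
Proof. by move=> mr; rewrite -(rmorph_nat iota) -rmorphM mr rmorph_nat. Qed.

Lemma ord_of_neq i j : ~~ ixeqb i j -> ord_of i != ord_of j.
Proof. by case: i; case: j. Qed.

Lemma vW i j : ~~ ixeqb i j -> v (ord_of i) (ord_of j) = bvec (W (third i j)).
Proof.
by move=> ij; have [+ _] := hv (ord_of_neq ij); move: ij; case: i; case: j => //= _ ->.
Qed.

Lemma shapeA i j : ~~ ixeqb i j -> type4A iota a (ord_of i) (ord_of j) (bvec (W (third i j))).
Proof. by move=> ij; rewrite -vW //; case: (hv (ord_of_neq ij)). Qed.

Lemma thirdK i j : ~~ ixeqb i j -> (~~ ixeqb i (third i j)) * (third i (third i j) = j) *
  (third j (third i j) = i) * (~~ ixeqb j (third i j)) * (~~ ixeqb j i) * (third j i = third i j).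
Proof. by case: i; case: j. Qed.

Definition tbl x y := ev t bvec (mulT x y) = z192 *: (bvec x *a bvec y).

Lemma tblC x y : basic x -> basic y -> tbl x y -> tbl y x.
Proof.
move=> bx y_; rewrite /tbl amulC => <-.
by have := all_basics (all_basics mulTC y_) bx; move/(feq_ev t bvec).
Qed.

Ltac zsimp := rewrite ?(@zevn 192%BZ 192) ?(@zevn 9%BZ 9) ?(@zevn 3%BZ 3)
  ?(@zevNn (-9)%BZ 8) ?(@zevn 60%BZ 60) ?(@zevNn (-12)%BZ 11) ?(@zevn 36%BZ 36)
  ?(@zevNn (-24)%BZ 23) ?(@zevn 96%BZ 96) ?(@zevNn (-96)%BZ 95) //.

Lemma axisA i e : is_axis (monster_rule iota) (bvec (A i e)) /\ primitive_elt (bvec (A i e)).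
Proof. by have [[ax _ _ _] _ _] := cls; apply: ax; exists (ord_of i), e. Qed.

Lemma normA i e : aform (bvec (A i e)) (bvec (A i e)) = 1.
Proof. by have [[_ _ _ nm] _ _] := cls; apply: nm; exists (ord_of i), e. Qed.

Lemma frobV (x y z : V) : aform x (y *a z) = aform (x *a y) z.
Proof. by have [[_ _ [_ fr] _] _ _] := cls. Qed.

Lemma mulA0 i e x y : bvec (A i e) *a x = 0 -> bvec (A i e) *a y = 0 ->
  bvec (A i e) *a (x *a y) = 0.
Proof. exact: monster00 (axisA i e).1 _ _. Qed.

Lemma mulA4 i e x y : bvec (A i e) *a x = 0 -> bvec (A i e) *a y = iota (1 / 4) *: y ->
  bvec (A i e) *a (x *a y) = iota (1 / 4) *: (x *a y).
Proof. exact: monster04 (axisA i e).1 _ _. Qed.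

Lemma mulA44 i e x y : bvec (A i e) *a x = iota (1 / 4) *: x ->
    bvec (A i e) *a y = iota (1 / 4) *: y ->
  bvec (A i e) *a (x *a y) = (iota (1 / 4) * aform x y) *: bvec (A i e).
Proof. by apply: monster44; rewrite ?normA //; case: (axisA i e) => // ? ?; exact: frobV. Qed.

Lemma mul_opp i e : bvec (A i e) *a bvec (A i (~~ e)) = 0.
Proof.
have ij : ~~ ixeqb i (nxt i) by case: i.
have [_ _ _ [a0 _] _] := shapeA ij; case: e => /=; first exact: a0.
by rewrite amulC a0.
Qed.

Lemma tblAA i e j d : tbl (A i e) (A j d).
Proof.
rewrite /tbl /= /mulAA; case ij: (ixeqb i j).
  move/ixeqbP: ij => <-; case: eqP => [<-|/eqP ed].
    by rewrite ev_cons ev_nil c0E addr0 (axisA i e).1.1.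
  have -> : d = ~~ e by case: e d ed => -[].
  by rewrite ev_nil mul_opp scaler0.
have [_ _ /(_ e d)[-> _ _ _] _ _] := shapeA (negbT ij).
rewrite scalerA; zsimp; rewrite (@iota_nat _ _ 3); last by lra.
rewrite !ev_cons ev_nil addr0 !c0E; zsimp.
rewrite -!scaler_nat !(scalerDr, scalerN, scalerA) -!natrM scaleNr.
by rewrite !addrA.
Qed.

Lemma mulAW_ne i e j : ~~ ixeqb i j -> tbl (A i e) (W j).
Proof.
move=> ij; rewrite /tbl /= /mulAW (negPf ij).
have [_ _ /(_ e e)[_ + _ _] _ _] := shapeA (thirdK ij).1.1.1.1.1.
rewrite (thirdK ij).1.1.1.1.2 /= => ->.
rewrite scalerA; zsimp; rewrite (@iota_nat _ _ 12); last by lra.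
rewrite !ev_cons ev_nil addr0 !c0E; zsimp.
rewrite -!scaler_nat !(scalerDr, scalerN, scalerA) -!natrM !scaleNr.
rewrite -!addrA; congr (_ + (_ + _)).
by rewrite [LHS]addrC -[LHS]addrA.
Qed.

Lemma tblAW i : tbl (A i true) (W i).
Proof.
rewrite /tbl /= /mulAW (introT (ixeqbP i i)) //.
rewrite !ev_cons ev_nil addr0 !c0E !c1E; zsimp => /=.
rewrite scalerBr scalerA mulrA (@iota_nat _ _ 96); last by lra.
by rewrite mulNr scaleNr -scalerBr subrK.
Qed.

Lemma tblWW i : tbl (W i) (W i).
Proof.
rewrite /tbl /= /mulWW (introT (ixeqbP i i)) // !ev_cons ev_nil addr0 c0E.
have ij : ~~ ixeqb (nxt i) (prv i) by case: i.
have [_ ii _ _ _] := shapeA ij; have <- : third (nxt i) (prv i) = i by case: (i).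
by rewrite ii.
Qed.

Lemma stage0 : stage 0.
Proof.
move=> x y bx y_; rewrite leqn0 => /eqP lev.
have tAW i e j : level (A i e) (W j) = 0%N -> tbl (A i e) (W j).
  rewrite /=; case ij: (ixeqb i j); last by move=> _; apply/mulAW_ne/negbT.
  by move/ixeqbP: ij => <-; case: e => // _; apply: tblAW.
move: x y bx y_ lev => [i e|i|i|//] [j d|j|j|//] bx y_ lev;
  try by move: lev; rewrite /=; case: ixeqb.
- exact: tblAA.
- exact: tAW.
- by apply: tblC => //; apply: tAW.
- by move: lev => /=; case ij: (ixeqb i j) => // _; move/ixeqbP: ij => <-; apply: tblWW.
Qed.

Lemma aformC i e x : aform x (bvec (A i e)) = aform (bvec (A i e)) x.
Proof. exact: axis_formC (axisA i e).1 frobV x. Qed.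

Lemma formAA i e j d : z192 * aform (bvec (A i e)) (bvec (A j d)) = pev t (gramT (A i e) (A j d)).
Proof.
rewrite /=; case ij: (ixeqb i j) => /=; last first.
  have [_ _ /(_ e d)[_ _ _ [-> _ _]] _ _] := shapeA (negbT ij).
  by rewrite mulr0 addr0; zsimp; rewrite (@zevn 6%BZ 6) // (@iota_nat _ _ 6) //; lra.
move/ixeqbP: ij => <-; case: eqP => [<-|/eqP ed] /=.
  by have /= -> := normA i e; rewrite mulr0 addr0 mulr1.
have ij : ~~ ixeqb i (nxt i) by case: (i).
have [_ _ _ _ [a0 _ _]] := shapeA ij.
case: e d ed => -[] //= _; first by rewrite a0 mulr0.
by have /= -> := aformC i true (bvec (A i false)); rewrite a0 mulr0.
Qed.

Lemma formAW_ne i e j : ~~ ixeqb i j -> aform (bvec (A i e)) (bvec (W j)) = iota (3 / 8).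
Proof.
move=> ij; have := shapeA (thirdK ij).1.1.1.1.1.
rewrite (thirdK ij).1.1.1.1.2 => -[_ _ /(_ e e)[_ _ _ [_ -> _]] _ _] //.
Qed.

Lemma form_mulAA i e j d x : ~~ ixeqb i j ->
  z192 * aform x (bvec (A i e) *a bvec (A j d)) =
  9%:R * aform x (bvec (A i e)) + 9%:R * aform x (bvec (A j d))
  + 3%:R * aform x (bvec (A i (~~ e))) + 3%:R * aform x (bvec (A j (~~ d)))
  - 9%:R * aform x (bvec (W (third i j))).
Proof.
move=> ij; rewrite -aformZr -tblAA /= /mulAA (negPf ij).
rewrite !ev_cons ev_nil addr0 !c0E; zsimp.
by rewrite !aformDr !aformZr mulNr !addrA.
Qed.

Lemma formA_ne i e j d : ~~ ixeqb i j -> aform (bvec (A i e)) (bvec (A j d)) = iota (1 / 32).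
Proof. by move=> ij; have [_ _ /(_ e d)[_ _ _ [-> _ _]] _ _] := shapeA ij. Qed.

(** In <a_i, a_j a_k> = <a_k, a_i a_j>, expanded by the shape, everything cancels except these two
    values. As the signs are free, t depends neither on the index nor on the sign. *)
Lemma form_tau i e k d : ~~ ixeqb i k ->
  aform (bvec (A i e)) (bvec (W i)) = aform (bvec (A k d)) (bvec (W k)).
Proof.
move=> ik; pose j := third i k.
have [ij kj jk ki [tij tjk]] : [/\ ~~ ixeqb i j, ~~ ixeqb k j, ~~ ixeqb j k, ~~ ixeqb k i
    & third i j = k /\ third j k = i] by move: ik; rewrite /j; case: (i); case: (k).
have E : aform (bvec (A i e)) (bvec (A j true) *a bvec (A k d)) =
         aform (bvec (A k d)) (bvec (A i e) *a bvec (A j true)) by rewrite frobV aformC.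
have := form_mulAA true d (bvec (A i e)) jk; rewrite E form_mulAA // !formA_ne // tij tjk.
by move/addrI/oppr_inj/natr_cancel.
Qed.

Lemma tauE i e : aform (bvec (A i e)) (bvec (W i)) = t.
Proof.
have tX1 j d : ~~ ixeqb j X1 -> aform (bvec (A j d)) (bvec (W j)) = t.
  by move=> j1; rewrite (form_tau d true j1).
by case: i; [rewrite (form_tau e true (isT : ~~ ixeqb X1 X2))| |]; rewrite tX1.
Qed.

Definition axial_atom x := match x with A _ _ | W _ => true | _ => false end.

(** Both sides of <[W i], a_i a_k> = <a_i, a_k [W i]> expand by the shape; the left one contains
    <[W i], [W j]> and the rest is known. *)
Lemma formWW i j : ~~ ixeqb i j ->
  z192 * aform (bvec (W i)) (bvec (W j)) = 96%:R - 512%:R * t.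
Proof.
move=> ij; pose k := third i j.
have [ik ki kj [tik tki]] : [/\ ~~ ixeqb i k, ~~ ixeqb k i, ~~ ixeqb k j
    & third i k = j /\ third k i = j] by move: ij; rewrite /k; case: (i); case: (j).
have E : aform (bvec (W i)) (bvec (A i true) *a bvec (A k true)) =
         aform (bvec (A i true)) (bvec (A k true) *a bvec (W i)).
  by rewrite [bvec (A i true) *a _]amulC frobV aformC amulC.
have AWi : z192 * aform (bvec (A i true)) (bvec (A k true) *a bvec (W i)) = 36%:R * t.
  rewrite -aformZr -(mulAW_ne _ ki) /= /mulAW (negPf ki) tki !ev_cons ev_nil addr0 !c0E; zsimp.
  rewrite !aformDr !aformZr tauE !(formA_ne _ _ ik, formA_ne _ _ ij).
  by ring.
have := form_mulAA true true (bvec (W i)) ik; rewrite E AWi tik !aformC !tauE.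
rewrite !formAW_ne // => e36; apply: (@natr_cancel 8).
have {}e36 : 9%:R * aform (bvec (W i)) (bvec (W j)) =
   12%:R * t + 12%:R * iota (3 / 8) - 36%:R * t by rewrite e36; ring.
have c38 : 192%:R * iota (3 / 8) = 72%:R by apply: iota_nat; lra.
rewrite mulrCA e36; zsimp; rewrite !(mulrBr, mulrDr) [_ * (12%:R * iota _)]mulrCA c38.
by ring.
Qed.

Lemma formG x y : axial_atom x -> axial_atom y ->
  z192 * aform (bvec x) (bvec y) = pev t (gramT x y).
Proof.
have AWE i e j : z192 * aform (bvec (A i e)) (bvec (W j)) = pev t (gramT (A i e) (W j)).
  rewrite /=; case ij: (ixeqb i j) => /=.
    move/ixeqbP: ij => <-; have /= -> := tauE i e.
    by rewrite mulr0 addr0 (_ : zev S Z0 = 0) // add0r mulrC.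
  have /= -> := formAW_ne e (negbT ij); rewrite mulr0 addr0 (@zevn 72%BZ 72) //.
  by zsimp; rewrite (@iota_nat _ _ 72) //; lra.
case: x y => [i e|i|//|//] [j d|j|//|//] _ _.
- exact: formAA.
- exact: AWE.
- by rewrite aformC; exact: AWE.
rewrite [gramT _ _]/=; case ij: (ixeqb i j).
  move/ixeqbP: ij => <-; have nij : ~~ ixeqb (nxt i) (prv i) by case: (i).
  have [_ _ _ _ [_ _]] := shapeA nij; rewrite (_ : third _ _ = i); last by case: (i).
  by move=> ->; rewrite /= mulr0 addr0; zsimp; rewrite (@zevn 384%BZ 384) // -natrM.
rewrite formWW ?ij //= mulr0 addr0 (@zevn 96%BZ 96) // (@zevNn (-512)%BZ 511) //.
by rewrite mulrN mulrC.
Qed.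

Section Stage.
Variable n : nat.
Hypothesis stn : stage n.

(** A table value together with its deviation symbol is correct whatever the product is, so
    computation can proceed before the product is known. *)
Lemma ev_mulT_gap x y : basic x -> basic y -> evg (mulT_gap n x y) = z192 *: (gvec x *a gvec y).
Proof.
move=> bx y_; rewrite ev_cat ev_gvec ?basic_mulT //.
have -> : gvec x = bvec x by case: x bx.
have -> : gvec y = bvec y by case: y y_.
case: ltnP => [_|lev]; last by rewrite ev_nil addr0 stn.
by rewrite ev_mem1 gap_gvec // addrC subrK.
Qed.

Lemma evU c d : bas c -> bas d -> evg (fbil (mulT_gap n) c d) = z192 *: (evg c *a evg d).
Proof. exact: ev_fbil ev_mulT_gap. Qed.

Lemma eigUP i e m c : eigU n i e m c ->
  z192 *: (bvec (A i e) *a evg c) = zev S m *: evg c.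
Proof.
move=> /andP[bc /(feq_ev t gvec)]; rewrite evU // ev_mem1 => ->.
by rewrite ev_scale c0E.
Qed.

Lemma eigU0 i e c : eigU n i e 0%BZ c -> bvec (A i e) *a evg c = 0.
Proof.
move/eigUP; rewrite (_ : zev S 0%BZ = 0) // scale0r -{1}(scaler0 _ z192).
exact: (z192_cancel iota).
Qed.

Lemma z48 : zev S 48%BZ = z192 * iota (1 / 4).
Proof.
by rewrite (@zev_nat _ _ iota 192%BZ 192) // (@zev_nat _ _ iota 48%BZ 48) //
        -rmorphM; congr (iota _); lra.
Qed.

Lemma eigU4 i e c : eigU n i e 48%BZ c -> bvec (A i e) *a evg c = iota (1 / 4) *: evg c.
Proof. by move/eigUP; rewrite z48 -scalerA => /(z192_cancel iota). Qed.

Lemma resurrectionP i e y z0 z4 :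
  (resurrection n i e y z0 z4).1 -> evg (resurrection n i e y z0 z4).2 = 0.
Proof.
rewrite /resurrection => /and4P[Ey E0 E4 byz].
have [by_ _] := andP Ey; have [b0 _] := andP E0; have [b4 _] := andP E4.
rewrite ev_sub !ev_scale !c0E evU // ev_mem1 !evU ?bas_cat ?b0 // ev_cat.
rewrite !amulZr amulDr amulDr.
rewrite (mulA0 (eigU0 Ey) (eigU0 E0)) (mulA4 (eigU0 Ey) (eigU4 E4)) add0r.
rewrite !scalerA -scalerBl (_ : _ - _ = 0) ?scale0r //.
rewrite (@zev_nat _ _ iota 192%BZ 192) // (@zev_nat _ _ iota 4%BZ 4) //.
by rewrite -!rmorphM -rmorphB -[RHS](rmorph0 iota); congr (iota _); lra.
Qed.

Lemma rel_squareP i e : (rel_square n i e).1 -> evg (rel_square n i e).2 = 0.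
Proof.
rewrite /rel_square; set al1 := eig0v _ _ _; set al2 := eig0v _ _ _.
set be1 := eig4v _ _ _; set be2 := eig4v _ _ _.
move=> /and5P[El1 El2 Eb1 Eb2 bK].
have [bl1 _] := andP El1; have [bl2 _] := andP El2.
have [bb1 _] := andP Eb1; have [bb2 _] := andP Eb2.
have awbe m : all (fun q => axial_atom q.1) (eig4v i e m).
  by rewrite /eig4v; case: ifP; case: i {al1 al2 be1 be2 El1 El2 Eb1 Eb2 bK bl1 bl2 bb1 bb2}.
have Bf : pev t (fform be1 be2) = z192 * aform (evg be1) (evg be2).
  rewrite !ev_gvec //; exact: (ev_form formG (awbe _) (awbe _)).
rewrite ev_sub ev_scale evU // ev_nf !ev_cat !ev_scale !ev_cat !evU // ev_mem1 pevZ Bf !c0E.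
rewrite !(amulDr, amulZr).
rewrite (mulA0 (eigU0 El1) (eigU0 El2)) (mulA44 (eigU4 Eb1) (eigU4 Eb2)).
rewrite (mulA4 (eigU0 El1) (eigU4 Eb2)) [evg be1 *a _]amulC (mulA4 (eigU0 El2) (eigU4 Eb1)).
rewrite !scaler0 add0r !scalerDr !scalerA; apply/eqP; rewrite subr_eq0; apply/eqP.
have zE k m : int_of_Z k = Posz m -> zev S k = iota m%:R := @zev_nat _ _ iota k m.
have E1 : zev S 2%BZ * z192 * (zev S 4%BZ * z192) * iota (1 / 4) = zev S 384%BZ * z192.
  by rewrite (zE 2%BZ 2) // (zE 192%BZ 192) // (zE 384%BZ 384) // (zE 4%BZ 4) //
             -!rmorphM; congr (iota _); lra.
have E2 : zev S 2%BZ * z192 * (zev S 6%BZ * z192) * iota (1 / 4) = zev S 576%BZ * z192.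
  by rewrite (zE 2%BZ 2) // (zE 192%BZ 192) // (zE 576%BZ 576) // (zE 6%BZ 6) //
             -!rmorphM; congr (iota _); lra.
by rewrite mulrA E1 E2 mulrA.
Qed.

End Stage.

Lemma plus_cancel i e m x : ~~ Z.eqb 0%BZ m ->
  plus iota (bvec (A i e)) (zev S m *: x) -> plus iota (bvec (A i e)) x.
Proof.
move=> /(zev_neq0 R) m0 /(plusZ (iota ((int_of_Z m)%:~R^-1))).
by rewrite (zev_iota iota) scalerA -rmorphM mulVf // rmorph1 scale1r.
Qed.

(** Although a_i v_(j,k) is unknown, v_(j,k) is a combination of s_j, s_k and s_j s_k with s_m = a_m
    + a_{-m}. Each s_m lies in V_1 + V_0 + V_{1/4}, and this part is closed under products. *)
Lemma plusW i e : plus iota (bvec (A i e)) (bvec (W i)).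
Proof.
(* The factors 3 and 2 cancel v_(i,j) between the 0- and the 1/4-eigenvector, so that 16 s_j = p + q
   + a. *)
pose p j := fscale (c0 3%BZ) (eig0v i e j) ++ [:: (A i (~~ e), c0 (-2)%BZ)].
pose q j := fscale (c0 2%BZ) (eig4v i e j).
have Ep j : eigU 0 i e 0 (p j) by rewrite /p /eig0v; case: ifP; case: (i); case: (e); vm_compute.
have Eq j : eigU 0 i e 48 (q j) by rewrite /q /eig4v; case: ifP; case: (i); case: (e); vm_compute.
have sE j : ~~ ixeqb i j ->
    zev S 16%BZ *: evg (sA j (c0 1%BZ)) = evg (p j) + evg (q j) + bvec (A i e).
  move=> ij; rewrite -(c0E t) -ev_scale -[bvec (A i e)]/(gvec (A i e)).
  rewrite -(ev_mem1 t gvec (A i e)) -!ev_cat; apply: feq_ev.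
  by rewrite /p /q; move: ij; case: (i); case: (e); case: (j) => // _; vm_compute.
have st0 := stage0.
have pm j k : plus iota (bvec (A i e))
    ((evg (p j) + evg (q j) + bvec (A i e)) *a (evg (p k) + evg (q k) + bvec (A i e))).
  apply: plus_mul; rewrite ?normA //; try exact: (axisA i e).1; try exact: (axisA i e).2;
  try exact: frobV; try exact: (eigU0 st0 (Ep _)); exact: (eigU4 st0 (Eq _)).
have ps j : ~~ ixeqb i j -> plus iota (bvec (A i e)) (evg (sA j (c0 1%BZ))).
  move=> ij; apply: (@plus_cancel i e 16%BZ) => //; rewrite sE //.
  apply: plusD; first apply: plusD.
  - apply: plus0; rewrite ?normA //; try exact: (axisA i e).1;
      try exact: frobV; exact: (eigU0 st0 (Ep _)).
  - apply: plus4; rewrite ?normA //; try exact: (axisA i e).1;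
      try exact: frobV; exact: (eigU4 st0 (Eq _)).
  - apply: (@plus_axis _ _ _ _ _ _ _ _ _ 1); rewrite ?normA ?scale1r //; try exact: (axisA i e).1;
      try exact: frobV; exact: (axisA i e).1.1.
pose j := nxt i; pose k := prv i; pose s m := sA m (c0 1%BZ).
have ij : ~~ ixeqb i j by rewrite /j; case: (i).
have ik : ~~ ixeqb i k by rewrite /k; case: (i).
have pss : plus iota (bvec (A i e)) (evg (s j) *a evg (s k)).
  do 2![apply: (@plus_cancel i e 16%BZ) => //].
  by rewrite -amulZl -amulZr !sE.
apply: (@plus_cancel i e 36%BZ) => //.
have /(feq_ev t gvec) : feq (fscale (c0 36%BZ) (mem1 (W i)))
    (fscale (c0 24%BZ) (s j) ++ fscale (c0 24%BZ) (s k)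
     ++ fscale (c0 (-1)%BZ) (fbil (mulT_gap 0) (s j) (s k))).
  by rewrite /s /j /k; case: (i); vm_compute.
rewrite !ev_cat !ev_scale ev_mem1 evU // !c0E => ->.
apply: plusD; last apply: plusD; do ?apply: plusZ => //; exact: ps.
Qed.

Section Stage.
Variable n : nat.
Hypothesis stn : stage n.

Lemma rel_plusP i e : bas (fbil (mulT_gap n) (mem1 (A i e)) (mem1 (W i))) ->
  evg (rel_plus n i e) = 0.
Proof.
move=> baw; rewrite /rel_plus ev_sub ev_cat !ev_scale !evU // !ev_mem1 pevM !c0E c1E.
rewrite !amulZr !scalerA -[gvec (A i e)]/(bvec (A i e)) -[gvec (W i)]/(bvec (W i)).
rewrite [bvec (A i e) *a (_ *a _)](plusW i e) tauE scalerDr !scalerA.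
apply/eqP; rewrite subr_eq0; apply/eqP.
have zE k m : int_of_Z k = Posz m -> zev S k = iota m%:R := @zev_nat _ _ iota k m.
congr (_ *: _ + _ *: _).
  by rewrite (zE 4%BZ 4) // (zE 192%BZ 192) // -!rmorphM; congr (iota _); lra.
rewrite !mulrA (zE 4%BZ 4) // (zE 192%BZ 192) // (zE 576%BZ 576) // -!rmorphM.
by congr (iota _ * _); lra.
Qed.

Lemma gap0 c x y m : evg c = 0 -> feq c [:: (gap x y, c0 m)] -> ~~ Z.eqb 0%BZ m ->
  gvec (gap x y) = 0.
Proof.
move=> c_0 /(feq_ev t gvec); rewrite c_0 ev_cons ev_nil addr0 c0E.
rewrite -{1}(scaler0 V (zev S m)) => /esym e m0.
exact: (zev_cancel iota m0 e).
Qed.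

Lemma next_stage :
    (forall x y, basic x -> basic y -> level x y = n.+1 -> gvec (gap x y) = 0) ->
  stage n.+1.
Proof.
move=> nx x y bx y_; rewrite leq_eqVlt => /predU1P[lev|lev].
  by apply: gap_eq0 => //; apply: nx.
exact: stn.
Qed.

End Stage.

Lemma level_cases (P : atom -> atom -> Prop) n x y :
    (forall u w, basic u -> basic w -> P u w -> P w u) ->
    (forall i, n = 0%N -> P (A i false) (W i)) ->
    (forall i j, n = 1%N -> ~~ ixeqb i j -> P (W i) (W j)) ->
    (forall i e, n = 2%N -> P (A i e) (H i)) ->
    (forall i e j, n = 3%N -> ~~ ixeqb i j -> P (A i e) (H j)) ->
    (forall i j, n = 4%N -> ~~ ixeqb i j -> P (W i) (H j)) ->
    (forall i, n = 5%N -> P (W i) (H i)) ->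
    (forall i, n = 6%N -> P (H i) (H i)) ->
    (forall i j, n = 7%N -> ~~ ixeqb i j -> P (H i) (H j)) ->
  basic x -> basic y -> level x y = n.+1 -> P x y.
Proof.
move=> PC c1 c2 c3 c4 c5 c6 c7 c8.
by move: x y => [[] []|[]|[]|//] [[] []|[]|[]|//] _ _ //= /esym[] nE;
  do 2?[by first [exact: c1 | exact: c2 | exact: c3 | exact: c4 | exact: c5 | exact: c6
                 | exact: c7 | exact: c8] | apply: PC => //].
Qed.

Lemma gapC u w : basic u -> basic w -> gvec (gap u w) = 0 -> gvec (gap w u) = 0.
Proof.
move=> bu bw; rewrite !gap_gvec // amulC => <-; congr (_ - _).
by have := all_basics (all_basics mulTC bu) bw; move/(feq_ev t bvec).
Qed.

(** The other unknown products enter the relations at a_i and at a_{-i} with equal coefficients. The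
    difference isolates a_{-i} v_(j,k), with coefficient 18432 = 2 * 256 * 36. *)
Lemma stage1 : stage 1.
Proof.
apply: next_stage stage0 _ => x y.
apply: (@level_cases (fun x y => gvec (gap x y) = 0)) => //; first exact: gapC.
move=> i _; apply: (@gap0 ((rel_square 0 i true).2 ++ fscale (c0 (-1)%BZ) (rel_square 0 i false).2) _ _ 18432%BZ) => //.
  rewrite ev_cat ev_scale !(rel_squareP stage0) ?scaler0 ?addr0 //; by case: i; vm_compute.
by case: i; vm_compute.
Qed.

(** At the axis of the third index, [W i] and [W j] are the v's of the two 4A subalgebras, and their
    product is the only unknown left in [rel_square]. *)
Lemma stage2 : stage 2.
Proof.
apply: next_stage stage1 _ => x y.
apply: (@level_cases (fun x y => gvec (gap x y) = 0)) => //; first exact: gapC.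
move=> i j _ ij; apply: (@gap0 (rel_square 1 (third i j) true).2 _ _ 6912%BZ) => //.
  by rewrite (rel_squareP stage1) //; case: i ij; case: j => // _; vm_compute.
by case: i ij; case: j => // _; vm_compute.
Qed.

(** [H i] is a_i v_(j,k) up to axes, so the relation for a (a w) determines a [H i]. *)
Lemma stage3 : stage 3.
Proof.
apply: next_stage stage2 _ => x y.
apply: (@level_cases (fun x y => gvec (gap x y) = 0)) => //; first exact: gapC.
move=> i e _; apply: (@gap0 (rel_plus 2 i e) _ _ 768%BZ) => //.
  by rewrite (rel_plusP stage2) //; case: i; case: e; vm_compute.
by case: i; case: e; vm_compute.
Qed.

Lemma rel_zeroP i e : evg (rel_zero 3 i e) = 0.
Proof.
have E m : eigU 3 i e 0 (eig0v i e m) by rewrite /eig0v; case: ifP; case: i; case: e; vm_compute.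
have b m := (andP (E m)).1.
rewrite /rel_zero !(evU stage3) ?ev_mem1 //; last first.
  by clear E b; case: i; case: e; vm_compute.
by rewrite amulZr (mulA0 (eigU0 stage3 (E _)) (eigU0 stage3 (E _))) !scaler0.
Qed.

Lemma rel_quarterP i e : evg (rel_quarter 3 i e) = 0.
Proof.
have E m : eigU 3 i e 0 (eig0v i e m) by rewrite /eig0v; case: ifP; case: i; case: e; vm_compute.
have F m : eigU 3 i e 48 (eig4v i e m) by clear E; rewrite /eig4v; case: ifP; case: i; case: e; vm_compute.
have bE m := (andP (E m)).1; have bF m := (andP (F m)).1.
rewrite /rel_quarter; set D := _ ++ _; have bD : bas D.
  by rewrite /D; clear E F bE bF D; case: i; case: e; vm_compute.
have DE : bvec (A i e) *a evg D = iota (1 / 4) *: evg D.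
  rewrite /D ev_cat ev_scale !(evU stage3) // amulDr !amulZr.
  rewrite (mulA4 (eigU0 stage3 (E _)) (eigU4 stage3 (F _))).
  rewrite (mulA4 (eigU0 stage3 (E _)) (eigU4 stage3 (F _))).
  by rewrite scalerDr !scalerA; congr (_ *: _ + _ *: _); ring.
rewrite ev_sub !ev_scale (evU stage3) // ev_mem1 !c0E [_ *a _]DE !scalerA.
rewrite (@zev_nat _ _ iota 192%BZ 192) // (@zev_nat _ _ iota 4%BZ 4) // -!rmorphM.
by rewrite -scalerBl -rmorphB (_ : _ - _ = 0) ?rmorph0 ?scale0r //; lra.
Qed.

(** [rel_zero] gives a ([H j] + [H k]) and [rel_quarter] gives their difference; the factor 12
    balances the coefficients, and the sign selects the summand. *)
Lemma stage4 : stage 4.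
Proof.
apply: next_stage stage3 _ => x y.
apply: (@level_cases (fun x y => gvec (gap x y) = 0)) => //; first exact: gapC.
move=> i e j _ ij.
apply: (@gap0 (fscale (c0 12%BZ) (rel_zero 3 i e) ++
  fscale (c0 (if ixeqb j (nxt i) then -1 else 1)%BZ) (rel_quarter 3 i e)) _ _ 49152%BZ) => //.
  by rewrite ev_cat !ev_scale rel_zeroP rel_quarterP !scaler0 addr0.
by case: i ij; case: e; case: j => // _; vm_compute.
Qed.

(** Twice the 1/4-eigenvector cancels [H j] in z0 + z4, which leaves [W j] - t a_j; hence y (z0 +
    z4) is known, and [W i] [H j] appears only in y z4. *)
Lemma stage5 : stage 5.
Proof.
apply: next_stage stage4 _ => x y.
apply: (@level_cases (fun x y => gvec (gap x y) = 0)) => //; first exact: gapC.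
move=> i j _ ij.
apply: (@gap0 (resurrection 4 j true (eig0v j true (third i j)) (eig0h j true)
  (fscale (c0 2%BZ) (eig4h j true))).2 _ _ (-1536)%BZ) => //.
  by apply: (resurrectionP stage4); case: i ij; case: j => // _; vm_compute.
by case: i ij; case: j => // _; vm_compute.
Qed.

(** At the axis of index [nxt i], the factor 8 cancels [H i] in z0 + z4, while y contains [W i]; so
    [W i] [H i] appears only in y z4. *)
Lemma stage6 : stage 6.
Proof.
apply: next_stage stage5 _ => x y.
apply: (@level_cases (fun x y => gvec (gap x y) = 0)) => //; first exact: gapC.
move=> i _; apply: (@gap0 (resurrection 5 (nxt i) true (eig0v (nxt i) true (prv i)) (eig0hh (nxt i) true)
  (fscale (c0 8%BZ) (eig4hh (nxt i) true))).2 _ _ 3072%BZ) => //.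
  by apply: (resurrectionP stage5); case: i; vm_compute.
by case: i; vm_compute.
Qed.

(** As z0 + z4 = [W i] - t a_i, the square of [H i] is met only in y z4, here with y = z0. *)
Lemma stage7 : stage 7.
Proof.
apply: next_stage stage6 _ => x y.
apply: (@level_cases (fun x y => gvec (gap x y) = 0)) => //; first exact: gapC.
move=> i _; apply: (@gap0 (resurrection 6 i true (eig0h i true) (eig0h i true)
  (fscale (c0 2%BZ) (eig4h i true))).2 _ _ 3072%BZ) => //.
  by apply: (resurrectionP stage6); case: i; vm_compute.
by case: i; vm_compute.
Qed.

(** The relation at i determines [H i] ([H j] + [H k]); adding the one at j and subtracting the one
    at k leaves twice [H i] [H j]. *)
Lemma stage8 : stage 8.
Proof.
apply: next_stage stage7 _ => x y.
apply: (@level_cases (fun x y => gvec (gap x y) = 0)) => //; first exact: gapC.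
move=> i j _ ij.
pose r i := (resurrection 7 i true (eig0hh i true) (eig0h i true) (fscale (c0 2%BZ) (eig4h i true))).2.
have r0 k : evg (r k) = 0 by apply: (resurrectionP stage7); case: k; vm_compute.
have rE : feq (r i ++ r j ++ fscale (c0 (-1)%BZ) (r (third i j)))
    [:: (gap (H i) (H j), c0 (-12288)%BZ)].
  by rewrite /r; clear r r0; case: i ij; case: j => // _; vm_compute.
move: r r0 rE => r r0 /gap0 -> //.
by rewrite !ev_cat ev_scale !r0 scaler0 !addr0.
Qed.

Lemma bvec_table : table_ok t bvec.
Proof.
move=> x y bx y_; apply: stage8 => //.
by move: x y bx y_ => [[] []|[]|[]|//] [[] []|[]|[]|//].
Qed.

End Derivation.

(** * The real model at a value x of t, and evaluation of the free algebra in it *)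

HB.instance Definition _ := hasDecEq.Build atom atomeqbP.
HB.instance Definition _ := gen_choiceMixin atom.

Section MalgLin.
Variables (K : choiceType) (S : comNzRingType).

Lemma malgZU (c : S) (k : K) : << c *g k >> = c *: << 1 *g k >> :> {malg S[K]}.
Proof. by apply/malgP => k'; rewrite mcoeffZ !mcoeffU mulrnAr mulr1. Qed.

Lemma malg_ind (Q : {malg S[K]} -> Prop) :
    Q 0 -> (forall u v, Q u -> Q v -> Q (u + v)) -> (forall c u, Q u -> Q (c *: u)) ->
    (forall k, Q << 1 *g k >>) ->
  forall u, Q u.
Proof.
move=> Q0 QD QZ QU u; rewrite [u]monalgE; elim/big_rec: _ => // k y _ Qy.
by apply: QD => //; rewrite malgZU; apply: QZ.
Qed.

End MalgLin.

Lemma Mhat_ind (R : realType) (Q : Mhat R -> Prop) :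
    Q 0 -> (forall u v, Q u -> Q v -> Q (u + v)) -> (forall c u, Q u -> Q (c *: u)) ->
    (forall k : magma, Q << 1 *g k >>) ->
  forall u, Q u.
Proof. exact: malg_ind. Qed.

Section Model.
Variables (R : realType) (x : R).

(** All atoms serve as basis; the [Gap] atoms are extra elements with zero products and zero
    form. *)
Definition model_mod : lmodType R := {malg R[atom]}.
Definition mb (y : atom) : model_mod := << 1 *g y >>.

Definition mmul0 (y z : atom) : model_mod := 192%:R^-1 *: ev x mb (mulT y z).
Definition mform0 (y z : atom) : R^o := 192%:R^-1 * pev x (gramT y z).

Lemma mmul0C y z : mmul0 y z = mmul0 z y.
Proof.
rewrite /mmul0; congr (_ *: _).
case: (boolP (basic y)) => [y_|]; last by case: y => // u w _; case: z.
case: (boolP (basic z)) => [z_|]; last by case: z => // u w _; case: y {y_}.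
by have := all_basics (all_basics mulTC y_) z_; move/(feq_ev x mb).
Qed.

Definition mmul (u v : model_mod) : model_mod := bilin_ext mmul0 u v.
Definition mform (u v : model_mod) : R := bilin_ext mform0 u v.

Fact mmulC : commutative mmul.
Proof. by move=> u v; apply/bilin_extC => y z; apply: mmul0C. Qed.
Fact mmulDl : left_distributive mmul +%R.
Proof. by move=> *; apply: bilin_extDl. Qed.
Fact mmulZl r u v : mmul (r *: u) v = r *: mmul u v.
Proof. exact: bilin_extZl. Qed.
Fact mformDl u v w : mform (u + v) w = mform u w + mform v w.
Proof. exact: (@bilin_extDl _ _ R^o). Qed.
Fact mformDr u v w : mform u (v + w) = mform u v + mform u w.
Proof. exact: (@bilin_extDr _ _ R^o). Qed.
Fact mformZl r u v : mform (r *: u) v = r * mform u v.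
Proof. exact: (@bilin_extZl _ _ R^o). Qed.
Fact mformZr r u v : mform u (r *: v) = r * mform u v.
Proof. exact: (@bilin_extZr _ _ R^o). Qed.

Definition model : formAlg R :=
  @FormAlg R model_mod mmul mform mmulC mmulDl mmulZl mformDl mformDr mformZl mformZr.

Local Notation MB := (mb : atom -> model).

Lemma model_table y z : ev x MB (mulT y z) = 192%:R *: (MB y *a MB z).
Proof.
have -> : MB y *a MB z = mmul0 y z by exact: bilin_extU.
by rewrite /mmul0 scalerA mulfV ?scale1r // pnatr_eq0.
Qed.

Lemma model_form y z : 192%:R * aform (MB y) (MB z) = pev x (gramT y z).
Proof.
have -> : aform (MB y) (MB z) = mform0 y z by exact: (@bilin_extU _ _ R^o).
by rewrite /mform0 mulrA mulfV ?mul1r // pnatr_eq0.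
Qed.

Lemma model_frob0 y z w :
  aform (MB y) (MB z *a MB w) = aform (MB y *a MB z) (MB w).
Proof.
have n0 : 192%:R != 0 :> R by rewrite pnatr_eq0.
have formE := fun c d => @ev_form R x model MB predT 192%:R c d
  (fun u v _ _ => model_form u v) (all_predT _) (all_predT _).
have := formE (mulT y z) (mem1 w); have := formE (mem1 y) (mulT z w).
rewrite !ev_mem1 !model_table aformZl aformZr => e1 e2.
apply: (mulfI n0); apply: (mulfI n0); rewrite -e1 -e2.
have frob : [&& basic y, basic z & basic w] ->
    pev x (fform (mem1 y) (mulT z w)) = pev x (fform (mulT y z) (mem1 w)).
  move=> /and3P[y_ z_ w_].
  have /(pev_pzero x) := all_basics (all_basics (all_basics frob_checks y_) z_) w_.
  by rewrite pevD pevZ (_ : zev R _ = -1) // mulN1r => /eqP; rewrite subr_eq0 => /eqP.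
case: (boolP [&& basic y, basic z & basic w]) => [/frob //|nb]; move: nb {frob e1 e2}.
have Tgap u u' k : mulT (Gap u u') k = [::] /\ mulT k (Gap u u') = [::] by case: k.
have fgap (u u' : atom) (d : fvec) :
    pev x (fform (mem1 (Gap u u')) d) = 0 /\ pev x (fform d (mem1 (Gap u u'))) = 0.
  have gform k : aform (MB (Gap u u')) (MB k) = 0 /\ aform (MB k) (MB (Gap u u')) = 0.
    by split; apply: (mulfI n0); rewrite model_form mulr0 //; case: k.
  rewrite !formE !ev_mem1 /ev; elim: d => [|q d [IHl IHr]].
    by rewrite big_nil aform0l aform0r mulr0.
  rewrite big_cons aformDr aformDl aformZr aformZl !mulrDr IHl IHr.
  by rewrite (gform _).1 (gform _).2 !mulr0 addr0.
rewrite !negb_and => /or3P[].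
- by case: y => // u u' _; rewrite (Tgap _ _ _).1 (fgap _ _ _).1.
- by case: z => // u u' _; rewrite (Tgap _ _ _).1 (Tgap _ _ _).2.
- by case: w => // u u' _; rewrite (Tgap _ _ _).2 (fgap _ _ _).2.
Qed.

Lemma model_frob (u v w : model) : aform u (v *a w) = aform (u *a v) w.
Proof.
elim/malg_ind: u => [|u u' IH IH'|c u IH|y].
- by rewrite amul0l !aform0l.
- by rewrite amulDl !aformDl IH IH'.
- by rewrite amulZl !aformZl IH.
elim/malg_ind: v => [|v v' IH IH'|c v IH|z].
- by rewrite amul0l amul0r aform0l aform0r.
- by rewrite amulDl amulDr aformDl aformDr IH IH'.
- by rewrite amulZl amulZr aformZl aformZr IH.
elim/malg_ind: w => [|w w' IH IH'|c w IH|w].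
- by rewrite amul0r !aform0r.
- by rewrite amulDr !aformDr IH IH'.
- by rewrite amulZr !aformZr IH.
exact: model_frob0.
Qed.

Definition ix_of (i : 'I_3) : ix := match val i with 0 => X1 | 1 => X2 | _ => X3 end%N.

Fixpoint wev (u : word) : model :=
  match u with Gen i e => MB (A (ix_of i) e) | Mul u v => wev u *a wev v end.

Lemma wev_cong u v : wcong u v -> wev u = wev v.
Proof.
by elim=> //= [u1 v1|u1 u2 v1 v2 _ -> _ ->|u1 v1 w1 _ -> _ ->] //; exact: mmulC.
Qed.

Definition mev (m : magma) : model := wev (repr m).

Lemma mev_pi u : mev (\pi_magma u)%qT = wev u.
Proof.
apply/wev_cong; suff: weq (repr (\pi_magma u)%qT) u by move/asboolP.
by apply/(@eqquotP _ _ magma _ _); rewrite reprK.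
Qed.

Lemma mev_mul m n : mev (mmulw m n) = mev m *a mev n.
Proof. exact: mev_pi. Qed.

Lemma mev_gen i e : mev (mgen i e) = MB (A (ix_of i) e).
Proof. exact: mev_pi. Qed.

Definition lamv (p : pair_class) : R := aform (mev (repr p).1) (mev (repr p).2).

(** The Frobenius identity of the model makes the form of two words constant along [pair_step],
    hence on classes. *)
Lemma lamv_pi m n : lamv (\pi_pair_class (m, n))%qT = aform (mev m) (mev n).
Proof.
have st p q : clos_refl_sym_trans _ pair_step p q ->
    aform (mev p.1) (mev p.2) = aform (mev q.1) (mev q.2).
  elim=> {p q} [p q [m' n' k]| | |p q r _ -> _ ->] //.
  change (aform (mev (mmulw m' n')) (mev k) = aform (mev m') (mev (mmulw n' k))).
  by rewrite !mev_mul model_frob.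
suff: peq (repr (\pi_pair_class (m, n))%qT) (m, n) by move/asboolP/st.
by apply/(@eqquotP _ _ pair_class _ _); rewrite reprK.
Qed.

Definition monv (m : {cmonom pair_class}) : R := \prod_(p <- finsupp m) lamv p ^+ m p.

Lemma monvEw (d : {fset pair_class}) (m : {cmonom pair_class}) : (finsupp m `<=` d)%fset ->
  monv m = \prod_(p <- d) lamv p ^+ m p.
Proof.
move=> md; rewrite /monv (big_fset_incl _ md) // => p _ pm.
by rewrite fsfun_dflt // expr0.
Qed.

Fact monv_mmorphism : mmorphism monv.
Proof.
split=> [m n|]; last by rewrite /monv mdom1 big_seq_fset0.
have mn : (finsupp (mulcm m n : {cmonom pair_class}) `<=` finsupp m `|` finsupp n)%fset.
  by rewrite mdomD.
rewrite (monvEw mn) (monvEw (fsubsetUl _ (finsupp n))) (monvEw (fsubsetUr (finsupp m) _)).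
by rewrite -big_split; apply: eq_bigr => p _ /=; rewrite cmM exprD.
Qed.

HB.instance Definition _ := isMultiplicative.Build _ _ monv monv_mmorphism.

Lemma monv_ucm p : monv (ucm p) = lamv p.
Proof. by rewrite /monv mdomU big_seq_fset1 cmUU. Qed.

Definition rhat_ev : Rhat R -> R := mmap (@idfun R) monv.

HB.instance Definition _ := GRing.RMorphism.copy rhat_ev (mmap (@idfun R) monv).

Lemma rhat_ev_lam m n : rhat_ev (lam R m n) = aform (mev m) (mev n).
Proof. by rewrite /rhat_ev mmapU mul1r monv_ucm lamv_pi. Qed.

Lemma rhat_evC c : rhat_ev (@malgC {cmonom pair_class} R c) = c.
Proof. exact: mmapC. Qed.

Definition mhat_ev (u : Mhat R) : model := \sum_(m <- msupp u) rhat_ev u@_m *: mev m.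

Lemma mhat_evEw (d : {fset magma}) (u : Mhat R) : (msupp u `<=` d)%fset ->
  mhat_ev u = \sum_(m <- d) rhat_ev u@_m *: mev m.
Proof.
move=> ud; rewrite /mhat_ev (big_fset_incl _ ud) // => m _ /mcoeff_outdom ->.
by rewrite rmorph0 scale0r.
Qed.

Lemma mhat_evD u v : mhat_ev (u + v) = mhat_ev u + mhat_ev v.
Proof.
rewrite (mhat_evEw (msuppD_le u v)) (mhat_evEw (fsubsetUl _ (msupp v))).
rewrite (mhat_evEw (fsubsetUr (msupp u) _)) -big_split; apply: eq_bigr => m _ /=.
by rewrite mcoeffD rmorphD scalerDl.
Qed.

Lemma mhat_evZ r u : mhat_ev (r *: u) = rhat_ev r *: mhat_ev u.
Proof.
rewrite (mhat_evEw (msuppZ_le r u)) scaler_sumr; apply: eq_bigr => m _.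
by rewrite mcoeffZ rmorphM scalerA.
Qed.

Lemma mhat_evU m : mhat_ev << 1 *g m >> = mev m.
Proof.
rewrite (mhat_evEw (@msuppU_le _ _ m 1)) big_seq_fset1 mcoeffUU rmorph1 scale1r //.
Qed.

Lemma mhat_ev0 : mhat_ev 0 = 0.
Proof. by rewrite -(scale0r (0 : Mhat R)) mhat_evZ rmorph0 scale0r. Qed.

Lemma mhat_evB u v : mhat_ev (u - v) = mhat_ev u - mhat_ev v.
Proof. by rewrite mhat_evD -scaleN1r mhat_evZ rmorphN1 scaleN1r. Qed.

Lemma mhat_evM u v : mhat_ev (u *a v) = mhat_ev u *a mhat_ev v.
Proof.
elim/Mhat_ind: u => [|u u' IH IH'|c u IH|m].
- by rewrite amul0l mhat_ev0 amul0l.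
- rewrite amulDl; apply: (etrans (mhat_evD _ _)); apply: (etrans (congr2 +%R IH IH')).
  by rewrite -amulDl; exact: (congr1 (amul^~ (mhat_ev v)) (esym (mhat_evD u u'))).
- rewrite amulZl; apply: (etrans (mhat_evZ _ _)); apply: (etrans (congr1 (GRing.scale _) IH)).
  by rewrite -amulZl; exact: (congr1 (amul^~ (mhat_ev v)) (esym (mhat_evZ c u))).
elim/Mhat_ind: v => [|v v' IH IH'|c v IH|n].
- by rewrite amul0r mhat_ev0 amul0r.
- rewrite amulDr; apply: (etrans (mhat_evD _ _)); apply: (etrans (congr2 +%R IH IH')).
  by rewrite -amulDr; exact: (congr1 (amul _) (esym (mhat_evD v v'))).
- rewrite amulZr; apply: (etrans (mhat_evZ _ _)); apply: (etrans (congr1 (GRing.scale _) IH)).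
  by rewrite -amulZr; exact: (congr1 (amul _) (esym (mhat_evZ c v))).
apply: (etrans (congr1 mhat_ev (@bilin_extU _ _ (Mhat R) _ m n))).
by rewrite !mhat_evU mev_mul.
Qed.

Lemma mhat_ev_form u v : rhat_ev (aform u v) = aform (mhat_ev u) (mhat_ev v).
Proof.
elim/Mhat_ind: u => [|u u' IH IH'|c u IH|m].
- by rewrite aform0l mhat_ev0 aform0l rmorph0.
- rewrite aformDl rmorphD; apply: (etrans (congr2 +%R IH IH')).
  by rewrite -aformDl; exact: (congr1 (aform^~ (mhat_ev v)) (esym (mhat_evD u u'))).
- rewrite aformZl rmorphM; apply: (etrans (congr1 ( *%R _) IH)).
  by rewrite -aformZl; exact: (congr1 (aform^~ (mhat_ev v)) (esym (mhat_evZ c u))).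
elim/Mhat_ind: v => [|v v' IH IH'|c v IH|n].
- by rewrite aform0r mhat_ev0 aform0r rmorph0.
- rewrite aformDr rmorphD; apply: (etrans (congr2 +%R IH IH')).
  by rewrite -aformDr; exact: (congr1 (aform _) (esym (mhat_evD v v'))).
- rewrite aformZr rmorphM; apply: (etrans (congr1 ( *%R _) IH)).
  by rewrite -aformZr; exact: (congr1 (aform _) (esym (mhat_evZ c v))).
apply: (etrans (congr1 rhat_ev (@bilin_extU _ _ (Rhat R)^o _ m n))).
by rewrite !mhat_evU -rhat_ev_lam.
Qed.

Definition kerM : {pred Mhat R} := fun u => mhat_ev u == 0.
Definition kerR : {pred Rhat R} := fun r => rhat_ev r == 0.

Fact kerM_zmod : zmod_closed kerM.
Proof.
split=> [|u v]; first exact/eqP/mhat_ev0.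
by move=> /eqP u0 /eqP v0; apply/eqP; rewrite mhat_evB u0 v0 subr0.
Qed.
HB.instance Definition _ := GRing.isZmodClosed.Build (Mhat R) kerM kerM_zmod.

Fact kerR_ideal : idealr_closed kerR.
Proof.
split=> [||a u v]; first by apply/eqP; apply: rmorph0.
  by apply/negP => /eqP/esym/eqP; rewrite rmorph1 eq_sym oner_eq0.
by move=> /eqP u0 /eqP v0; apply/eqP; rewrite rmorphD rmorphM /= u0 v0 mulr0 addr0.
Qed.
HB.instance Definition _ := isIdealr.Build (Rhat R) kerR kerR_ideal.

Fact kerM_scale (r : Rhat R) (u : Mhat R) : u \in kerM -> r *: u \in kerM.
Proof. by move=> /eqP u0; apply/eqP; apply: (etrans (mhat_evZ r u)); rewrite u0 scaler0. Qed.

Fact kerM_mul (u v : Mhat R) : u \in kerM -> u *a v \in kerM.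
Proof. by move=> /eqP u0; apply/eqP; apply: (etrans (mhat_evM u v)); rewrite u0 amul0l. Qed.

Fact kerR_scale (r : Rhat R) (u : Mhat R) : r \in kerR -> r *: u \in kerM.
Proof. by move=> /eqP r0; apply/eqP; apply: (etrans (mhat_evZ r u)); rewrite r0 scale0r. Qed.

Fact kerM_forml (u v : Mhat R) : u \in kerM -> aform u v \in kerR.
Proof. by move=> /eqP u0; apply/eqP; rewrite mhat_ev_form u0 aform0l. Qed.

Fact kerM_formr (u v : Mhat R) : u \in kerM -> aform v u \in kerR.
Proof. by move=> /eqP u0; apply/eqP; rewrite mhat_ev_form u0 aform0r. Qed.

(** The quotient by this pair is the image of the free algebra in the model: unlike the model
    itself, it is generated by the axes. *)
Definition kerP : ideal_pair (Mhat R) :=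
  @IdealPair (Rhat R) (Mhat R) kerM kerR kerM_scale kerM_mul kerR_scale kerM_forml kerM_formr.

End Model.

(** * Spans in quotients of the free algebra *)

Section Naturality.
Variables (S1 S2 : comNzRingType) (s : {rmorphism S1 -> S2}).
Variables (V1 : lmodType S1) (V2 : lmodType S2) (f : V1 -> V2).
Hypothesis fD : forall u v, f (u + v) = f u + f v.
Hypothesis fZ : forall r u, f (r *: u) = s r *: f u.

Lemma pev_hom t p : s (pev t p) = pev (s t) p.
Proof. by elim: p => [|z p IH] /=; rewrite ?rmorph0 // rmorphD rmorphM IH rmorph_int. Qed.

Lemma ev_hom t g1 g2 c : (forall y, basic y -> f (g1 y) = g2 y) -> bas c ->
  f (ev t g1 c) = ev (s t) g2 c.
Proof.
move=> fg; elim: c => [|q c IH] /=.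
  by rewrite !ev_nil -(scale0r (0 : V1)) fZ rmorph0 scale0r.
by move=> /andP[bq bc]; rewrite !ev_cons fD fZ fg // pev_hom IH.
Qed.

End Naturality.

Section QuotSpan.
Variables (R : realType) (P : ideal_pair (Mhat R)).
Local Notation V := (quot_alg P).
Local Notation S := (qring P).
Local Notation iota := (quot_real P).

Lemma mpi_mul (u v : Mhat R) : mpi P (u *a v) = (mpi P u : V) *a mpi P v.
Proof. by symmetry; apply: qmulE. Qed.

Lemma mpi_form (u v : Mhat R) : qpi P (aform u v) = aform (mpi P u : V) (mpi P v).
Proof. by symmetry; apply: qformE. Qed.

Lemma mpi_magma_mul (m n : magma) :
  mpi P (<< 1 *g mmulw m n >> : Mhat R) =
  (mpi P (<< 1 *g m >> : Mhat R) : V) *a mpi P (<< 1 *g n >> : Mhat R).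
Proof.
rewrite -mpi_mul; congr (mpi P _); symmetry; exact: (@bilin_extU _ _ (Mhat R)).
Qed.

Lemma quot_ind (Q : V -> Prop) :
    Q 0 -> (forall u v, Q u -> Q v -> Q (u + v)) ->
    (forall (r : Rhat R) v, Q v -> Q (qpi P r *: v)) ->
    (forall i e, Q (quot_gen P i e)) ->
    (forall m n : magma, Q (mpi P (<< 1 *g m >> : Mhat R)) ->
       Q (mpi P (<< 1 *g n >> : Mhat R)) -> Q (mpi P (<< 1 *g mmulw m n >> : Mhat R))) ->
  forall v, Q v.
Proof.
move=> Q0 QD QZ Qg QM v; rewrite -(mpiK (P := P) v).
elim/Mhat_ind: (repr v) => [|u w Qu Qw|c u Qu|m].
- by rewrite raddf0.
- by rewrite raddfD; apply: QD.
- by rewrite mpiZ; apply: QZ.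
rewrite -[m]reprK; elim: (repr m) => [i e|u Qu w Qw]; first exact: Qg.
by rewrite -mmulw_pi; apply: QM.
Qed.

Lemma quot_gen_subalg : gen_subalg (marked (quot_gen P)) = setT.
Proof.
apply/seteqP; split=> // v _ B [B0 BD BZ BM] gB.
elim/quot_ind: v => [|u v|r v|i e|m n Bm Bn] //; first exact: BD.
- exact: BZ.
- by apply: gB; exists i, e.
- by rewrite mpi_magma_mul; apply: BM.
Qed.

Variables (t : S) (b : atom -> V).
Hypothesis btbl : table_ok t b.
Hypothesis bgen : forall i e, quot_gen P i e = b (A (ix_of i) e).

Variable S0 : set S.
Hypotheses (S0iota : forall r : R, S0 (iota r)) (S0t : S0 t).
Hypothesis S0D : forall r s, S0 r -> S0 s -> S0 (r + s).
Hypothesis S0M : forall r s, S0 r -> S0 s -> S0 (r * s).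

(** Restricting coefficients to [S0] has two uses: with all scalars it gives spanning, and with the
    polynomials in t it describes the coefficient ring. *)
Definition span0 (v : V) := exists2 c : atom -> S,
  forall k, S0 (c k) & v = \sum_(k <- basics) c k *: b k.

Lemma S00 : S0 0. Proof. by rewrite -(rmorph0 iota). Qed.

Lemma span00 : span0 0.
Proof.
exists (fun=> 0); first by move=> _; apply: S00.
by rewrite big1 // => k _; rewrite scale0r.
Qed.

Lemma span0D u v : span0 u -> span0 v -> span0 (u + v).
Proof.
move=> [c Sc ->] [d Sd ->]; exists (fun k => c k + d k); first by move=> k; apply: S0D.
by rewrite -big_split; apply: eq_bigr => k _ /=; rewrite scalerDl.
Qed.

Lemma span0Z r v : S0 r -> span0 v -> span0 (r *: v).
Proof.
move=> Sr [c Sc ->]; exists (fun k => r * c k); first by move=> k; apply: S0M.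
by rewrite scaler_sumr; apply: eq_bigr => k _; rewrite scalerA.
Qed.

Lemma span0b k : basic k -> span0 (b k).
Proof.
move=> bk; exists (fun y => if atomeqb y k then 1 else 0).
  by move=> y; case: ifP => _; [rewrite -(rmorph1 iota) | apply: S00].
by case: k bk => [[] []|[]|[]|] // _;
  rewrite !big_cons big_nil /= !(scale0r, scale1r, add0r, addr0).
Qed.

Lemma span0_ev c : bas c -> span0 (ev t b c).
Proof.
elim: c => [|q c IH]; first by rewrite ev_nil => _; apply: span00.
move=> /andP[bq /IH Sc]; rewrite ev_cons; apply: span0D => //.
apply: span0Z; last exact: span0b.
elim: q.2 => [|z p Sp] /=; first exact: S00.
by apply: S0D; [rewrite (zev_iota iota) | apply: S0M].
Qed.

Lemma span0_sum (r : seq atom) (F : atom -> V) :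
  all basic r -> (forall k, basic k -> span0 (F k)) -> span0 (\sum_(k <- r) F k).
Proof.
move=> + SF; elim: r => [|k r IH] /=; first by rewrite big_nil => _; apply: span00.
by move=> /andP[bk /IH Sr]; rewrite big_cons; apply: span0D => //; apply: SF.
Qed.

Lemma span0M u v : span0 u -> span0 v -> span0 (u *a v).
Proof.
move=> [c Sc ->] [d Sd ->]; rewrite amul_suml; apply: span0_sum => // y y_.
rewrite amulZl; apply: span0Z => //; rewrite amul_sumr; apply: span0_sum => // z z_.
rewrite amulZr; apply: span0Z => //.
have -> : b y *a b z = iota (192%:R^-1) *: ev t b (mulT y z).
  rewrite btbl // scalerA (@zev_nat _ _ iota _ 192) // -rmorphM mulVf ?rmorph1 ?scale1r //.
  by rewrite pnatr_eq0.
by apply: span0Z => //; apply/span0_ev/basic_mulT.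
Qed.

Lemma span0_magma (m : magma) : span0 (mpi P (<< 1 *g m >> : Mhat R)).
Proof.
rewrite -[m]reprK; elim: (repr m) => [i e|u Qu w Qw].
  by rewrite -[mpi _ _]/(quot_gen P i e) bgen; apply: span0b.
by rewrite -mmulw_pi mpi_magma_mul; apply: span0M.
Qed.

End QuotSpan.

Lemma ix_ofK : cancel ix_of ord_of.
Proof. by case=> [[|[|[|]]]] //= ?; apply: val_inj. Qed.

Lemma ord_ofK : cancel ord_of ix_of.
Proof. by case. Qed.

(** * An algebra with the table and the form belongs to the class *)

Section TableClass.
Variables (R : realType) (S : comNzRingType) (iota : {rmorphism R -> S}).
Variables (V : formAlg S) (a : 'I_3 -> bool -> V) (t : S) (b : atom -> V).
Hypotheses (tbl : table_ok t b) (spn : spanning b).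
Hypothesis ba : forall i e, a i e = b (A (ix_of i) e).
Local Notation z192 := (zev S 192%BZ).
Hypothesis frob : forall u v w : V, aform u (v *a w) = aform (u *a v) w.
Hypothesis gram : forall x y, axial_atom x -> axial_atom y ->
  z192 * aform (b x) (b y) = pev t (gramT x y).
Hypothesis gen : gen_subalg (marked a) = setT.

Lemma table_idem i e : idempotent_elt (b (A i e)).
Proof.
apply: (z192_cancel iota); rewrite -tbl //= /mulAA (introT (ixeqbP i i)) // eqxx.
by rewrite ev_cons ev_nil c0E addr0.
Qed.

Lemma zev_cancelS m (r s : S) : ~~ Z.eqb 0%BZ m -> zev S m * r = zev S m * s -> r = s.
Proof. by move=> m0; apply: (@zev_cancel R S iota S^o m). Qed.

Lemma table_norm i e : aform (b (A i e)) (b (A i e)) = 1.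
Proof.
apply: (@zev_cancelS 192%BZ) => //; rewrite gram //= (introT (ixeqbP i i)) // eqxx /=.
by rewrite mulr0 addr0 mulr1.
Qed.

Lemma axis_eigen i e l n :
  eigenspace (b (A i e)) (mval iota l) (ev t b (nth [::] (a_eig i e l) n)).
Proof.
have [eigE _ _ basE] := a_checks i e; rewrite -(ev_mem1 t b (A i e)).
apply: (K_eigen iota tbl mlabs_all (mpolE iota t) _ basE eigE) => //.
have [nE|nE] := ltnP n (size (a_eig i e l)); last first.
  by rewrite nth_default // ev_nil; apply: spanned0.
by have := spanned_nth [seq ev t b c | c <- a_eig i e l] n; rewrite (nth_map [::]).
Qed.

(** Directness of the eigenspace sum makes x - y a function of x + y; choice then produces the
    map. *)
Lemma miyamoto_exists i e : exists tau, is_miyamoto iota (b (A i e)) tau.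
Proof.
have [[dir _ _] _] := axis_fusion iota tbl spn i e.
set c := b (A i e) in dir *; set L := [set 1; 0; iota (1 / 4)].
have uniq_dec x y x' y' : eigensum c L x -> eigenspace c (iota (1 / 32)) y ->
    eigensum c L x' -> eigenspace c (iota (1 / 32)) y' -> x + y = x' + y' -> x - y = x' - y'.
  move=> Lx Ey Lx' Ey' E.
  have E' : (x - x') + (y - y') = 0 by rewrite addrACA E -opprD subrr.
  have Ed : eigenspace c (iota (1 / 32)) (y - y').
    by rewrite -scaleN1r; apply: eigenspaceD => //; apply: eigenspaceZ.
  have [s [f [[us fs] xx]]] : eigensum c L (x - x').
    by rewrite -scaleN1r; apply: eigensumD => //; apply: eigensumZ.
  have n32 : iota (1 / 32) \notin s.
    apply/negP => /fs[[[]|] + _].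
    - by move/(@mval_inj _ _ iota mon32 mon1).
    - by move/(@mval_inj _ _ iota mon32 mon0).
    - by move/(@mval_inj _ _ iota mon32 mon4).
  have y0 : y - y' = 0.
    (* The vanishing sum (x - x') + (y - y') becomes one eigenfamily on the list extended by 1/32,
       and directness kills its member y - y'. *)
    pose g l := if l == iota (1 / 32) then y - y' else f l.
    have := dir (iota (1 / 32) :: s) g; rewrite /eigen_family /= n32 us.
    move=> /(_ _ _ (iota (1 / 32))); rewrite /g eqxx mem_head; apply=> //.
      split=> // l; rewrite inE; case: eqP => [-> _|_ /= /fs[Ll cl]].
        by split=> //; exists mon32.
      split=> //; case: Ll => [[->|->]|->]; [by exists mon1 | by exists mon0 | by exists mon4].
    rewrite big_cons eqxx; apply: etrans E'; rewrite addrC xx; congr (_ + _).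
    by apply: eq_big_seq => l ls; case: eqP => // l32; rewrite -l32 ls in n32.
  move: E'; rewrite y0 addr0 => /eqP; rewrite subr_eq0 => /eqP ->.
  by move/eqP: y0; rewrite subr_eq0 => /eqP ->.
pose dec z w := forall x y, eigensum c L x -> eigenspace c (iota (1 / 32)) y ->
  z = x + y -> w = x - y.
have /choice[tau tauP] : forall z, exists w, dec z w.
  move=> z; have [[x [y [Lx Ey zE]]]|nd] := pselect (exists x y, [/\ eigensum c L x,
    eigenspace c (iota (1 / 32)) y & z = x + y]).
    by exists (x - y) => x' y' Lx' Ey'; rewrite zE; apply: uniq_dec.
  (* The value 0 is a default for vectors without a decomposition. *)
  by exists 0 => x y Lx Ey zE; exfalso; apply: nd; exists x, y.
by exists tau => x y Lx Ey; apply: tauP Lx Ey erefl.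
Qed.

Lemma eigensum_plus i e j : ~~ ixeqb j i ->
  eigensum (b (A i e)) [set 1; 0; iota (1 / 4)] (ev t b (sA j (c0 1%BZ))).
Proof.
move=> ji; pose m1 := if ixeqb j (nxt i) then 1%N else 2%N.
pose m4 := if ixeqb j (nxt i) then 0%N else 1%N.
have E l := axis_eigen i e l.
have L0 : [set 1; 0; iota (1 / 4)] 0 by left; right.
(* The same elimination of v_(i,j) as in [plusW], written out by eigenvectors. *)
have : zev S 16%BZ *: ev t b (sA j (c0 1%BZ)) = b (A i e)
  + (zev S (-2)%BZ *: ev t b (nth [::] (a_eig i e mon0) 0)
  + (zev S 3%BZ *: ev t b (nth [::] (a_eig i e mon0) m1)
  + zev S 2%BZ *: ev t b (nth [::] (a_eig i e mon4) m4))).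
  rewrite -(ev_mem1 t b (A i e)) -!(c0E t) -!ev_scale -!ev_cat; apply: feq_ev.
  by rewrite /m1 /m4; clear E L0 m1 m4; case: i ji; case: e; case: j => // _; vm_compute.
rewrite (@zev_nat _ _ iota 16%BZ 16) // => /(congr1 (GRing.scale (iota (1 / 16)))).
rewrite scalerA -rmorphM (_ : 1 / 16 * 16%:R = 1); last by lra.
rewrite rmorph1 scale1r => ->; apply: eigensumZ; apply: eigensumD.
  apply: (@eigensum1 _ _ _ _ 1); first by left; left.
  by rewrite /eigenspace /= scale1r table_idem.
apply: eigensumD; first by apply/eigensumZ/(eigensum1 L0)/(E mon0).
apply: eigensumD; first by apply/eigensumZ/(eigensum1 L0)/(E mon0).
by apply/eigensumZ/(@eigensum1 _ _ _ _ (iota (1 / 4)))/(E mon4); right.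
Qed.

(** For j other than i, half the sum of a_j and a_{-j} is fixed, and half their difference is a
    1/32-eigenvector, hence negated. *)
Lemma miyamoto_act i e tau j d : is_miyamoto iota (b (A i e)) tau ->
  tau (b (A j d)) = if ixeqb j i then b (A j d) else b (A j (~~ d)).
Proof.
move=> mi; case ji: (ixeqb j i).
  have e0 := @eigenspace0 _ _ (b (A i e)) (iota (1 / 32)).
  rewrite -{1}[b (A j d)]addr0 mi // ?subr0 //.
  move/ixeqbP: ji => ->; case: (eqVneq d e) => [->|ned].
    apply: (@eigensum1 _ _ _ _ 1); first by left; left.
    by rewrite /eigenspace /= scale1r table_idem.
  apply: (@eigensum1 _ _ _ _ 0); first by left; right.
  have -> : d = ~~ e by move: ned; case: (d); case: (e).
  by rewrite -(ev_mem1 t b (A i (~~ e))); apply: (axis_eigen i e mon0 0).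
have E32 : eigenspace (b (A i e)) (iota (1 / 32)) (ev t b (dA j (c0 1%BZ))).
  have := axis_eigen i e mon32 (if ixeqb j (nxt i) then 0%N else 1%N).
  by move: ji; case: (i); case: (j).
pose s := iota (1 / 2) *: ev t b (sA j (c0 1%BZ)).
pose r d' := zev S (if d' then 1 else -1)%BZ *: (iota (1 / 2) *: ev t b (dA j (c0 1%BZ))).
have h (u : V) : zev S 2%BZ *: (iota (1 / 2) *: u) = u.
  rewrite (@zev_nat _ _ iota 2%BZ 2) // scalerA -rmorphM.
  by rewrite (_ : 2%:R * (1 / 2) = 1) ?rmorph1 ?scale1r //; lra.
have half d' : b (A j d') = s + r d'.
  apply: (@zev_cancel _ _ iota _ 2%BZ) => //.
  rewrite /s /r scalerDr h [X in _ = _ + X]scalerA [zev S 2%BZ * _]mulrC -scalerA h.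
  rewrite -(ev_mem1 t b (A j d')) -!(c0E t) -!ev_scale -!ev_cat.
  by apply: feq_ev; case: d'; case: (j); vm_compute.
have rN : r (~~ d) = - r d.
  by rewrite /r -scaleNr; congr (_ *: _); case: (d); rewrite /zev /= ?opprK.
rewrite {1}half mi ?half ?rN //; first by apply/eigensumZ/eigensum_plus; rewrite ji.
by do 2!apply: eigenspaceZ.
Qed.

Ltac zsimp := rewrite ?(@zevn _ 192%BZ 192) ?(@zevn _ 9%BZ 9) ?(@zevn _ 3%BZ 3)
  ?(@zevNn _ (-9)%BZ 8) ?(@zevn _ 60%BZ 60) ?(@zevNn _ (-12)%BZ 11) ?(@zevn _ 36%BZ 36)
  ?(@zevNn _ (-24)%BZ 23) ?(@zevn _ 96%BZ 96) ?(@zevNn _ (-96)%BZ 95) //.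

Lemma table_mulAA i e j d : ~~ ixeqb i j ->
  b (A i e) *a b (A j d) = iota (1 / 64) *:
    (b (A i e) *+ 3 + b (A j d) *+ 3 + b (A i (~~ e)) + b (A j (~~ d))
     - b (W (third i j)) *+ 3).
Proof.
move=> ij; apply: (z192_cancel iota); rewrite -tbl //= /mulAA (negPf ij).
rewrite scalerA; zsimp; rewrite (@iota_nat _ _ iota _ _ 3); last by lra.
rewrite !ev_cons ev_nil addr0 !c0E; zsimp.
rewrite -!scaler_nat !(scalerDr, scalerN, scalerA) -!natrM scaleNr.
by rewrite !addrA.
Qed.

Lemma table_mulAW i e j : ~~ ixeqb i j ->
  b (A i e) *a b (W j) = iota (1 / 16) *:
    (b (A i e) *+ 5 - b (A i (~~ e)) - b (A (third i j) true) *+ 2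
     - b (A (third i j) false) *+ 2 + b (W j) *+ 3).
Proof.
move=> ij; apply: (z192_cancel iota); rewrite -tbl //= /mulAW (negPf ij).
rewrite scalerA; zsimp; rewrite (@iota_nat _ _ iota _ _ 12); last by lra.
rewrite !ev_cons ev_nil addr0 !c0E; zsimp.
rewrite -!scaler_nat !(scalerDr, scalerN, scalerA) -!natrM !scaleNr.
rewrite -!addrA; congr (_ + (_ + _)).
by rewrite [LHS]addrC -[LHS]addrA.
Qed.

Lemma table_mul_opp i e : b (A i e) *a b (A i (~~ e)) = 0.
Proof.
apply: (z192_cancel iota); rewrite -tbl //= /mulAA (introT (ixeqbP i i)) //.
by case: e; rewrite ev_nil scaler0.
Qed.

Lemma table_idemW i : idempotent_elt (b (W i)).
Proof.
apply: (z192_cancel iota); rewrite -tbl //= /mulWW (introT (ixeqbP i i)) //.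
by rewrite ev_cons ev_nil c0E addr0.
Qed.

Lemma form_iota x y (n : Z) (m : nat) (r : R) :
    axial_atom x -> axial_atom y -> gramT x y = [:: n] ->
  int_of_Z n = Posz m -> 192%:R * r = m%:R -> aform (b x) (b y) = iota r.
Proof.
move=> ax ay Gn nm rE; apply: (@zev_cancelS 192%BZ) => //; rewrite gram // Gn /= mulr0 addr0.
by rewrite (zevn S nm); zsimp; rewrite (iota_nat iota rE).
Qed.

Definition atoms4A i j := [:: A i true; A i false; A j true; A j false; W (third i j)].

Lemma gen_atoms4A i j (B : set V) : ~~ ixeqb i j -> is_subalg B ->
  B (b (A i true)) -> B (b (A j true)) -> B (b (A j false)) /\ B (ev t b (gen1 i j)).
Proof.
move=> ij [B0 BD BZ BM] Bi Bj.
have Bev c : (forall q, List.In q c -> B (b q.1)) -> B (ev t b c).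
  elim: c => [|q c IH] Bc; first by rewrite ev_nil.
  by rewrite ev_cons; apply: BD; [apply/BZ/Bc; left | apply: IH => q' ?; apply: Bc; right].
have Bmul c d : bas c -> bas d -> B (ev t b c) -> B (ev t b d) -> B (ev t b (fbil mulT c d)).
  by move=> bc bd Bc Bd; rewrite ev_mul //; apply/BZ/BM.
have Bsub c d : B (ev t b c) -> B (ev t b d) -> B (ev t b (fvsub c d)).
  by move=> Bc Bd; rewrite ev_cat ev_scale; apply/BD/BZ.
have B1 x : B (b x) -> B (ev t b (mem1 x)) by rewrite ev_mem1.
have g1 : B (ev t b (gen1 i j)).
  by apply: Bsub; [apply: Bmul => //; apply: B1 | apply: Bev => q /= [<-|[<-|]]].
have bg1 : bas (gen1 i j) by clear; case: i; case: j.
have bg2 : bas (gen2 i j) by clear; case: i; case: j.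
have g2 : B (ev t b (gen2 i j)).
  by apply: Bsub; apply: Bmul => //; apply: B1.
have g3 : B (ev t b (gen3 i j)).
  apply: Bsub; first by apply: Bmul => //; apply: B1.
  rewrite ev_cat ev_scale; apply: BD; first exact: BZ.
  by apply: Bev => q /= [<-|[<-|]].
split=> //; have /(feq_ev t b) : feq (fscale (c0 756%BZ) (mem1 (A j false))) (gen3 i j).
  by clear - ij; case: i ij; case: j => // _; vm_compute.
rewrite ev_scale ev_mem1 c0E (zev_iota iota) => gE.
have -> : b (A j false) = iota ((int_of_Z 756%BZ)%:~R^-1) *: ev t b (gen3 i j).
  by rewrite -gE scalerA -rmorphM mulVf ?rmorph1 ?scale1r //; apply: (@zev_neq0 R 756%BZ).
exact: BZ.
Qed.

Lemma table_gen i j : ~~ ixeqb i j ->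
  gen_subalg [set b (A i true); b (A j true)] = spanned [seq b y | y <- atoms4A i j].
Proof.
move=> ij; set X := [seq b y | y <- atoms4A i j].
have sb y : has (atomeqb y) (atoms4A i j) -> spanned X (b y).
  by move=> /or4P[|||/or3P[||//]] /atomeqbP ->; [exact: (spanned_nth X 0)
   | exact: (spanned_nth X 1) | exact: (spanned_nth X 2) | exact: (spanned_nth X 3)
   | exact: (spanned_nth X 4)].
have ji : ~~ ixeqb j i by clear - ij; case: i ij; case: j.
apply/seteqP; split=> x.
  apply; last by move=> _ [->|->]; [exact: (spanned_nth X 0) | exact: (spanned_nth X 2)].
  split; [exact: spanned0 | exact: spannedD | exact: spannedZ | move=> u v].
  move=> Xu Xv; move: u Xu; apply: spanned_ind => [|u u' ? ?|r u ?|p pX].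
  - by rewrite amul0l; apply: spanned0.
  - by rewrite amulDl; apply: spannedD.
  - by rewrite amulZl; apply: spannedZ.
  move: v Xv; apply: spanned_ind => [|u u' ? ?|r u ?|q qX].
  - by rewrite amul0r; apply: spanned0.
  - by rewrite amulDr; apply: spannedD.
  - by rewrite amulZr; apply: spannedZ.
  rewrite !(nth_map (A i true)) //; set y := nth _ _ p; set z := nth _ _ q.
  have atoms4A_mul : all (fun y => all (fun z => [&& basic y, basic z & all (fun q =>
      has (atomeqb q.1) (atoms4A i j)) (mulT y z)]) (atoms4A i j)) (atoms4A i j).
    by clear - ij; case: i ij; case: j => // _; vm_compute.
  have /(all_nthP (A i true))/(_ q qX)/and3P[y_ z_] := all_nthP (A i true) atoms4A_mul p pX.
  rewrite -/y -/z in y_ z_ *; move=> sT.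
  have -> : b y *a b z = iota (192%:R^-1) *: ev t b (mulT y z).
    rewrite tbl // scalerA (@zev_nat _ _ iota _ 192) // -rmorphM mulVf ?rmorph1 ?scale1r //.
    by rewrite pnatr_eq0.
  apply: spannedZ; elim: (mulT y z) sT => [|c cs IH] /=.
    by rewrite ev_nil => _; apply: spanned0.
  by move=> /andP[/sb Xc /IH]; rewrite ev_cons; apply/spannedD/spannedZ.
move=> Xx B sB sub.
have Bi : B (b (A i true)) by apply: sub; left.
have Bj : B (b (A j true)) by apply: sub; right.
(* Exchanging i and j recovers a_{-i} as well; v_(i,j) is then read off from [gen1]. *)
have [Bj' g1] := gen_atoms4A ij sB Bi Bj; have [Bi' _] := gen_atoms4A ji sB Bj Bi.
have [B0 BD BZ BM] := sB.
move: x Xx; apply: spanned_ind => //.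
move=> [|[|[|[|[|]]]]] //= _.
have /(feq_ev t b) : feq (fscale (c0 9%BZ) (mem1 (W (third i j))))
    ([:: (A i false, c0 3%BZ); (A j false, c0 3%BZ)] ++ fscale (c0 (-1)%BZ) (gen1 i j)).
  by clear - ij; case: i ij; case: j => // _; vm_compute.
rewrite ev_scale ev_mem1 c0E (zev_iota iota) => gE.
rewrite [b _](_ : _ = iota ((int_of_Z 9%BZ)%:~R^-1) *: (iota (int_of_Z 9%BZ)%:~R *: b (W (third i j)))).
  rewrite gE ev_cat ev_scale !ev_cons ev_nil addr0.
  by apply/BZ/BD; [apply: BD; apply: BZ | apply: BZ].
by rewrite scalerA -rmorphM mulVf ?rmorph1 ?scale1r //; apply: (@zev_neq0 R 9%BZ).
Qed.

Lemma ix_of_neq (i j : 'I_3) : i != j -> ~~ ixeqb (ix_of i) (ix_of j).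
Proof. by apply: contraNN => /ixeqbP/(can_inj ix_ofK) ->. Qed.

Lemma third_out i j : ~~ ixeqb i j ->
  [/\ ~~ ixeqb i (third i j), ~~ ixeqb j (third i j), ~~ ixeqb j i, third j i = third i j
    & third i (third i j) = j /\ third j (third i j) = i].
Proof. by case: i; case: j. Qed.

Lemma table_type4A i j : i != j -> type4A iota a i j (b (W (third (ix_of i) (ix_of j)))).
Proof.
move=> /ix_of_neq; rewrite /type4A.
have aE k d : a k d = b (A (ix_of k) d) by exact: ba.
move: (ix_of i) (ix_of j) (aE i) (aE j) => {aE} i' j' ai aj ij.
have [ik jk ji tji [tik tjk]] := third_out ij.
rewrite !ai !aj table_gen //; split.
- apply/seteqP; split=> x.
    move=> [c ->]; exists (c 0%N), (c 1%N), (c 2), (c 3), (c 4).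
    by rewrite !big_ord_recl big_ord0 /= addr0 !addrA.
  move=> [c1 [c2 [c3 [c4 [c5 ->]]]]]; set X := [seq b y | y <- atoms4A i' j'].
  by do !apply: spannedD; apply: spannedZ; [exact: (spanned_nth X 0) | exact: (spanned_nth X 1)
    | exact: (spanned_nth X 2) | exact: (spanned_nth X 3) | exact: (spanned_nth X 4)].
- exact: table_idemW.
- move=> e d; rewrite !ai !aj; split.
  + by rewrite table_mulAA.
  + by rewrite table_mulAW // tik.
  + by rewrite table_mulAW // tjk.
  split.
  + by apply: (@form_iota _ _ 6%BZ 6) => //=; [rewrite (negPf ij) | lra].
  + by apply: (@form_iota _ _ 72%BZ 72) => //=; [rewrite (negPf ik) | lra].
  + by apply: (@form_iota _ _ 72%BZ 72) => //=; [rewrite (negPf jk) | lra].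
- by rewrite !table_mul_opp.
have form0 k : aform (b (A k true)) (b (A k false)) = 0.
  by apply: (@zev_cancelS 192%BZ) => //; rewrite gram //= (introT (ixeqbP k k)) //= mulr0.
split=> //; apply: (@zev_cancelS 192%BZ) => //.
rewrite gram //= (introT (ixeqbP _ _)) //= mulr0 addr0.
by rewrite (zevn S (z := 384%BZ) (n := 384)) // (zevn S (z := 192%BZ) (n := 192)) // -natrM.
Qed.

Lemma table_class : class4A iota a.
Proof.
split.
- have axE c : marked a c -> exists i e, c = b (A i e).
    by move=> [i [e ->]]; rewrite ba; exists (ix_of i), e.
  split=> //.
  + move=> _ /axE[i [e ->]]; split; last exact: (axis_primitive iota tbl spn (table_idem i e)).
    split; [exact: table_idem | exact: (axis_fusion iota tbl spn i e).1].
  + split=> //; exists (b (A X1 true)), (b (A X1 true)); rewrite table_norm.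
    exact/eqP/oner_neq0.
  + by move=> _ /axE[i [e ->]]; apply: table_norm.
- move=> i e; rewrite ba; have [tau mi] := miyamoto_exists (ix_of i) e.
  exists tau => // j d; rewrite !ba (miyamoto_act _ _ mi).
  case: eqVneq => [->|/ix_of_neq/negPf ->] //.
  by rewrite (introT (ixeqbP _ _)).
exists (fun i j => b (W (third (ix_of i) (ix_of j)))) => i j ij; split; last exact: table_type4A.
by have [_ _ _ -> _] := third_out (ix_of_neq ij).
Qed.

End TableClass.

(** * Morphisms respecting the table, and membership of the model quotient *)

Section HomTable.
Variables (R : realType) (S1 S2 : comNzRingType) (iota : {rmorphism R -> S2}).
Variables (s : {rmorphism S1 -> S2}) (V1 : formAlg S1) (V2 : formAlg S2) (f : V1 -> V2).
Hypothesis fD : forall u v, f (u + v) = f u + f v.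
Hypothesis fZ : forall r u, f (r *: u) = s r *: f u.
Hypothesis fM : forall u v, f (u *a v) = f u *a f v.
Variables (t : S1) (b1 : atom -> V1) (b2 : atom -> V2).
Hypothesis tbl1 : table_ok t b1.
Hypothesis tblAA2 : forall i e j d, ev (s t) b2 (mulT (A i e) (A j d)) =
  zev S2 192%BZ *: (b2 (A i e) *a b2 (A j d)).
Hypothesis fA : forall i e, f (b1 (A i e)) = b2 (A i e).

Let szev z : s (zev S1 z) = zev S2 z. Proof. by rewrite rmorph_int. Qed.

Let homA c : all (fun q => if q.1 is A _ _ then true else false) c ->
  f (ev t b1 c) = ev (s t) b2 c.
Proof.
elim: c => [|[q p] c IH] /=; first by rewrite !ev_nil -(scale0r (0 : V1)) fZ rmorph0 scale0r.
by case: q => //= i e /IH fc; rewrite !ev_cons fD fZ fA (pev_hom s) fc.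
Qed.

Let hom_solve x c d m : ~~ Z.eqb 0%BZ m -> feq (fscale (c0 m) (mem1 x)) (c ++ d) ->
  f (ev t b1 c) = ev (s t) b2 c -> f (ev t b1 d) = ev (s t) b2 d -> f (b1 x) = b2 x.
Proof.
move=> m0 xcd fc fd; apply: (zev_cancel iota m0).
have := feq_ev (s t) b2 xcd; have := feq_ev t b1 xcd.
rewrite !ev_scale !ev_mem1 !ev_cat !c0E => e1 ->.
by rewrite -szev -fZ e1 fD fc fd.
Qed.

(** v_(j,k) is solved from a_j a_k, whose table entry is free of t. Only products of axes are
    assumed in the target, so this is available before [s t] is identified. *)
Lemma hom_tableW i : f (b1 (W i)) = b2 (W i).
Proof.
pose j := nxt i; pose k := prv i.
apply: (@hom_solve _ [:: (A j true, c0 9%BZ); (A k true, c0 9%BZ); (A j false, c0 3%BZ);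
  (A k false, c0 3%BZ)] (fscale (c0 (-1)%BZ) (mulT (A j true) (A k true))) 9%BZ) => //.
- by rewrite /j /k; case: i {j k}; vm_compute.
- exact: homA.
- by rewrite !ev_scale fZ (pev_hom s) tbl1 // tblAA2 fZ fM szev !fA.
Qed.

Lemma hom_table y : table_ok (s t) b2 -> basic y -> f (b1 y) = b2 y.
Proof.
move=> tbl2; case: y => [i e|i|i|//] _; [exact: fA | exact: hom_tableW |].
apply: (@hom_solve _ [:: (A i true, c1 (-96)%BZ); (A i false, c1 96%BZ)]
    (mulT (A i true) (W i)) 192%BZ) => //.
- by case: i; vm_compute.
- exact: homA.
- by rewrite tbl1 // tbl2 // fZ fM szev fA hom_tableW.
Qed.

End HomTable.

Section KerClass.
Variables (R : realType) (x : R).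
Local Notation MB := (@mb R : atom -> model x).

(** [W] and [H] are solved from the products a_j a_k and a_i v_(j,k). Having [basic y] under the
    existential lets choice pick a lift for every atom. *)
Lemma model_lift y : exists u : Mhat R, basic y -> mhat_ev x u = MB y.
Proof.
pose im (v : model x) := exists u : Mhat R, mhat_ev x u = v.
have imD u v : im u -> im v -> im (u + v).
  by move=> [u' <-] [v' <-]; exists (u' + v'); apply: mhat_evD.
have imZ r u : im u -> im (r *: u).
  move=> [u' <-]; exists ((@malgC {cmonom pair_class} R r : Rhat R) *: u').
  by rewrite mhat_evZ rhat_evC.
have imM u v : im u -> im v -> im (u *a v).
  by move=> [u' <-] [v' <-]; exists (u' *a v'); apply: mhat_evM.
have imA i e : im (MB (A i e)).
  by exists (hgen R (ord_of i) e); rewrite mhat_evU mev_gen ord_ofK.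
have onA c : all (fun q => if q.1 is A _ _ then true else false) c -> im (ev x MB c).
  elim: c => [_|[q p] c IH] /=; first by exists 0; rewrite ev_nil; apply: mhat_ev0.
  by case: q => //= i e /IH fc; rewrite ev_cons; apply: imD => //; apply/imZ/imA.
have solve y' c d m : ~~ Z.eqb 0%BZ m -> feq (fscale (c0 m) (mem1 y')) (c ++ d) ->
    im (ev x MB c) -> im (ev x MB d) -> im (MB y').
  move=> m0 /(feq_ev x MB); rewrite ev_scale ev_mem1 ev_cat c0E => E ic id.
  have -> : MB y' = (zev R m)^-1 *: (ev x MB c + ev x MB d).
    by rewrite -E scalerA mulVf ?scale1r //; exact: (zev_neq0 R m0).
  by apply/imZ/imD.
have imW i : im (MB (W i)).
  pose j := nxt i; pose k := prv i.
  apply: (@solve _ [:: (A j true, c0 9%BZ); (A k true, c0 9%BZ); (A j false, c0 3%BZ);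
    (A k false, c0 3%BZ)] (fscale (c0 (-1)%BZ) (mulT (A j true) (A k true))) 9%BZ) => //.
  - by rewrite /j /k; case: i {j k}; vm_compute.
  - exact: onA.
  - by rewrite ev_scale; apply/imZ; rewrite model_table; apply/imZ/imM; apply: imA.
case: y => [i e|i|i|u v].
- by have [u uE] := imA i e; exists u.
- by have [u uE] := imW i; exists u.
- have [u uE] : im (MB (H i)); last by exists u.
  apply: (@solve _ [:: (A i true, c1 (-96)%BZ); (A i false, c1 96%BZ)]
    (mulT (A i true) (W i)) 192%BZ) => //.
  + by case: i; vm_compute.
  + exact: onA.
  + by rewrite model_table; apply/imZ/imM; [apply: imA | apply: imW].
by exists 0.
Qed.

Local Notation V := (quot_alg (kerP x)).
Local Notation S := (qring (kerP x)).
Local Notation iota := (quot_real (kerP x)).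
Local Notation xC := (@malgC {cmonom pair_class} R x : Rhat R).

Lemma kerP_vec (u v : Mhat R) : mhat_ev x u = mhat_ev x v -> mpi (kerP x) u = mpi (kerP x) v.
Proof. by move=> uv; apply/mpi_eq/eqP; rewrite mhat_evB uv subrr. Qed.

Lemma kerP_scal (r s : Rhat R) : rhat_ev x r = rhat_ev x s -> qpi (kerP x) r = qpi (kerP x) s.
Proof. by move=> rs; apply/qpi_eq/eqP; rewrite rmorphB /= rs subrr. Qed.

Lemma kerP_class : in_C4A (kerP x).
Proof.
have [bh bhE] := choice model_lift.
pose b y : V := mpi (kerP x) (bh y).
have mD (u v : Mhat R) : (mpi (kerP x) (u + v) : V) = mpi (kerP x) u + mpi (kerP x) v.
  exact: raddfD.
have mZ (r : Rhat R) (u : Mhat R) : (mpi (kerP x) (r *: u) : V) = qpi (kerP x) r *: mpi (kerP x) u.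
  exact: mpiZ.
have evE c : bas c -> ev (iota x) b c = mpi (kerP x) (ev xC bh c).
  move=> bc; symmetry.
  exact: (@ev_hom (Rhat R) S (qpi (kerP x)) (Mhat R) V (mpi (kerP x)) mD mZ xC bh b c (fun y _ => erefl) bc).
have mevE c : bas c -> mhat_ev x (ev xC bh c) = ev x MB c.
  move=> bc; rewrite -[in RHS](rhat_evC x x).
  exact: (@ev_hom (Rhat R) R (rhat_ev x) (Mhat R) (model x) _ (mhat_evD x) (mhat_evZ x) xC bh MB c bhE bc).
have zh z : rhat_ev x (zev (Rhat R) z) = zev R z by rewrite rmorph_int.
have zq z : qpi (kerP x) (zev (Rhat R) z) = zev S z by rewrite rmorph_int.
have tbl : table_ok (iota x) b.
  move=> y z y_ z_; rewrite evE ?basic_mulT // -mpi_mul -zq -mpiZ; apply: kerP_vec.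
  rewrite mevE ?basic_mulT // model_table mhat_evZ mhat_evM !bhE // zh.
  by rewrite (zevn R (z := 192%BZ) (n := 192)).
have bgen i e : quot_gen (kerP x) i e = b (A (ix_of i) e).
  by apply: kerP_vec; rewrite bhE // mhat_evU mev_gen.
have frob (u v w : V) : aform u (v *a w) = aform (u *a v) w.
  rewrite -[u]mpiK -[v]mpiK -[w]mpiK -!mpi_mul -!mpi_form; apply: kerP_scal.
  move: (repr u) (repr v) (repr w) => u0 v0 w1.
  apply: (etrans (mhat_ev_form x u0 _)); symmetry; apply: (etrans (mhat_ev_form x _ w1)); symmetry.
  apply: (etrans (congr1 (aform _) (mhat_evM x v0 w1))); apply: (etrans (model_frob _ _ _)).
  by symmetry; apply: (congr1 (aform^~ (mhat_ev x w1)) (mhat_evM x u0 v0)).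
have spn : spanning b.
  move=> v; suff [c _ ->] : span0 b setT v by exists c.
  elim/quot_ind: v => [|u v|r v|i e|m n _ _].
  - exact: span00.
  - exact: span0D.
  - exact: span0Z.
  - by rewrite bgen; apply: span0b.
  - exact: (span0_magma tbl bgen).
apply: (@table_class R S iota V _ _ b tbl spn bgen frob) => [y z y_ z_|]; last exact: quot_gen_subalg.
rewrite -zq -mpi_form -rmorphM -(pev_hom (qpi (kerP x))); apply: kerP_scal.
rewrite rmorphM /= zh mhat_ev_form (pev_hom (rhat_ev x)) [GRing.RMorphism.sort _ _]/= (rhat_evC x x) -model_form.
have by_ : basic y by case: (y) y_.
have bz_ : basic z by case: (z) z_.
rewrite (bhE _ by_) (bhE _ bz_).
by rewrite (zevn R (z := 192%BZ) (n := 192)).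
Qed.

End KerClass.

(** * Specialisation of a quotient contained in the kernel of evaluation at x *)

Section Specialize.
Variables (R : realType) (P : ideal_pair (Mhat R)) (x : R).
Hypothesis subM : {subset idM P <= kerM x}.
Hypothesis subR : {subset idR P <= kerR x}.
Local Notation V := (quot_alg P).
Local Notation S := (qring P).

Definition spR (r : S) : R := rhat_ev x (repr r).
Definition spM (u : V) : model x := mhat_ev x (repr u).

Lemma spRE r : spR (qpi P r) = rhat_ev x r.
Proof.
have /subR/eqP : repr (qpi P r) - r \in idR P by apply: repr_qpi.
by rewrite rmorphB /= => /eqP; rewrite subr_eq0 => /eqP.
Qed.

Lemma spME u : spM (mpi P u) = mhat_ev x u.
Proof.
have /subM/eqP : repr (mpi P u) - u \in idM P by apply: repr_mpi.
by rewrite mhat_evB => /eqP; rewrite subr_eq0 => /eqP.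
Qed.

Fact spR_zmod : zmod_morphism spR.
Proof. by move=> r s; rewrite -[r]qpiK -[s]qpiK -rmorphB !spRE rmorphB. Qed.
Fact spR_monoid : monoid_morphism spR.
Proof.
split=> [|r s]; first by rewrite -(rmorph1 (qpi P)) spRE rmorph1.
by rewrite -[r]qpiK -[s]qpiK -rmorphM !spRE rmorphM.
Qed.
Definition spRh : {rmorphism S -> R} := HB.pack spR
  (GRing.isZmodMorphism.Build S R spR spR_zmod) (GRing.isMonoidMorphism.Build S R spR spR_monoid).

Lemma spR_real r : spR (quot_real P r) = r.
Proof. by rewrite /= spRE rhat_evC. Qed.

Lemma spMD u w : spM (u + w) = spM u + spM w.
Proof.
rewrite -[u]mpiK -[w]mpiK -(raddfD (mpi P)); apply: (etrans (spME _)).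
by apply: (etrans (mhat_evD x _ _)); rewrite !spME.
Qed.

Lemma spMZ r u : spM (r *: u) = spR r *: spM u.
Proof.
rewrite -[r]qpiK -[u]mpiK -mpiZ; apply: (etrans (spME _)).
by apply: (etrans (mhat_evZ x _ _)); rewrite spME spRE.
Qed.

Lemma spMM u w : spM (u *a w) = spM u *a spM w.
Proof.
rewrite -[u]mpiK -[w]mpiK -mpi_mul; apply: (etrans (spME _)).
by apply: (etrans (mhat_evM x _ _)); rewrite !spME.
Qed.

Lemma spM_form u w : spR (aform u w) = aform (spM u) (spM w).
Proof.
rewrite -[u]mpiK -[w]mpiK -mpi_form; apply: (etrans (spRE _)).
by apply: (etrans (mhat_ev_form x _ _)); rewrite !spME.
Qed.

Lemma spM_gen i e : spM (quot_gen P i e) = mb R (A (ix_of i) e).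
Proof. by apply: (etrans (spME _)); rewrite mhat_evU mev_gen. Qed.

End Specialize.

(** * Every coefficient is a real polynomial in t *)

Section Coefficients.
Variables (R : realType) (P : ideal_pair (Mhat R)) (v : 'I_3 -> 'I_3 -> quot_alg P).
Hypotheses (cls : in_C4A P) (hv : shape4A_vectors (quot_real P) (quot_gen P) v).
Local Notation V := (quot_alg P).
Local Notation S := (qring P).
Local Notation iota := (quot_real P).
Let t : S := aform (quot_gen P i1 true) (v i2 i3).
Let b : atom -> V := bvec iota (quot_gen P) v.

Let tbl : table_ok t b := bvec_table cls hv.

Lemma bvec_gen i e : quot_gen P i e = b (A (ix_of i) e).
Proof. by rewrite /b /= ix_ofK. Qed.

Definition polt (r : S) := exists p : {poly R}, r = (map_poly iota p).[t].

Lemma polt_iota r : polt (iota r).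
Proof. by exists r%:P; rewrite map_polyC hornerC. Qed.

Lemma polt_t : polt t.
Proof. by exists 'X; rewrite map_polyX hornerX. Qed.

Lemma poltD r s : polt r -> polt s -> polt (r + s).
Proof. by move=> [p ->] [q ->]; exists (p + q); rewrite rmorphD hornerD. Qed.

Lemma poltM r s : polt r -> polt s -> polt (r * s).
Proof. by move=> [p ->] [q ->]; exists (p * q); rewrite rmorphM hornerM. Qed.

Lemma poltB r s : polt r -> polt s -> polt (r - s).
Proof. by move=> [p ->] [q ->]; exists (p - q); rewrite rmorphB hornerD hornerN. Qed.

Lemma polt_pev p : polt (pev t p).
Proof.
elim: p => [|z p IH] /=; first by rewrite -(rmorph0 iota); apply: polt_iota.
apply: poltD; first by rewrite (zev_iota iota); apply: polt_iota.
exact: poltM polt_t IH.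
Qed.

Lemma polt_div r : polt (zev S 192%BZ * r) -> polt r.
Proof.
move=> /(poltM (polt_iota 192%:R^-1)); rewrite (@zev_nat _ _ iota _ 192) // mulrA -rmorphM.
by rewrite mulVf ?rmorph1 ?mul1r // pnatr_eq0.
Qed.

Lemma polt_form x y : axial_atom x -> axial_atom y -> polt (aform (b x) (b y)).
Proof. by move=> ax ay; apply: polt_div; rewrite (formG cls hv) //; apply: polt_pev. Qed.

(** For [H j] the Frobenius identity turns <a_i, a_j v> into <a_i a_j, v>, and a_i a_j involves only
    axes and vectors v. *)
Lemma polt_formA i e k : basic k -> polt (aform (b (A i e)) (b k)).
Proof.
case: k => [j d|j|j|//] _; [exact: polt_form | exact: polt_form |].
have -> : b (H j) = b (A j true) *a b (W j) - (iota (1 / 2) * t) *: (b (A j true) - b (A j false)).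
  by [].
rewrite -scaleN1r aformDr !aformZr -scaleN1r aformDr aformZr !mulN1r; apply: poltB; last first.
  by apply: poltM; [exact: poltM (polt_iota _) polt_t | apply: poltB; apply: polt_form].
rewrite (frobV cls); apply: polt_div; rewrite -aformZl -tbl //.
have: all (fun q => axial_atom q.1) (mulT (A i e) (A j true)) by case: (i); case: (e); case: (j).
elim: (mulT _ _) => [_|q c IH /andP[qa /IH Sc]].
  by rewrite ev_nil aform0l -(rmorph0 iota); apply: polt_iota.
 rewrite ev_cons aformDl aformZl.
exact: poltD (poltM (polt_pev _) (polt_form _ _)) Sc.
Qed.

(** Induction on the word: <w1 w2, u> = <w1, w2 u> moves factors to the right, where spans with
    coefficients polynomial in t are stable, until a generator remains. *)
Lemma polt_form_magma (m : magma) u : span0 b polt u ->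
  polt (aform (mpi P (<< 1 *g m >> : Mhat R) : V) u).
Proof.
rewrite -[m]reprK; elim: (repr m) u => [i e|w1 IH1 w2 IH2] u Su.
  rewrite -[mpi _ _]/(quot_gen P i e) bvec_gen; have [c Sc ->] := Su.
  have: all basic basics by [].
  elim: basics => [_|k r IH /andP[bk /IH Sr]].
    by rewrite big_nil aform0r -(rmorph0 iota); apply: polt_iota.
  rewrite big_cons aformDr aformZr.
  exact: poltD (poltM (Sc k) (polt_formA (ix_of i) e bk)) Sr.
rewrite -mmulw_pi mpi_magma_mul -(frobV cls); apply: IH1.
apply: (span0M tbl polt_iota polt_t poltD poltM) => //.
exact: (span0_magma tbl bvec_gen polt_iota polt_t poltD poltM).
Qed.

(** Induction on the degree splits off one indeterminate, which is the form of two words. *)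
Lemma polt_mon (m : {cmonom pair_class}) : polt (qpi P (<< 1 *g m >> : Rhat R)).
Proof.
have polt1 : polt 1 by rewrite -(rmorph1 iota); apply: polt_iota.
have [n] := ubnP (mdeg m); elim: n m => // n IH m; rewrite ltnS => mn.
have [->|[p pm]] : m = onecm pair_class \/ exists p, p \in finsupp m.
- have [m0|[p pm]] := fset_0Vmem (finsupp m); last by right; exists p.
  left; apply/eqP/cmP => p; rewrite onecmE; apply/eqP.
  by rewrite cmE_eq0 m0 in_fset0.
- by rewrite (_ : << _ >> = 1 :> Rhat R) ?rmorph1.
pose m' := divcm m (ucm p).
have mE : m = mulcm (ucm p) m'.
  apply/eqP/cmP => q; rewrite mulcmE divcmE ucmE; case: eqVneq => [<-|_] /=.
    by rewrite subnKC // lt0n cmE_neq0.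
  by rewrite add0n subn0.
have degE : mdeg m = (mdeg (ucm p) + mdeg m')%N by rewrite {1}mE; apply: mdegM.
have m'n : (mdeg m' < n)%N by rewrite degE mdegU in mn.
have -> : << 1 *g m >> = << 1 *g ucm p >> * << 1 *g m' >> :> Rhat R.
  by rewrite malgM_def fgmulUU mulr1 {1}mE.
rewrite rmorphM; apply: poltM; last exact: IH.
rewrite -[p]reprK; case: (repr p) => m1 m2; rewrite -[<< _ >>]/(lam R m1 m2).
have -> : lam R m1 m2 = aform (<< 1 *g m1 >> : Mhat R) (<< 1 *g m2 >> : Mhat R).
  by symmetry; exact: (@bilin_extU _ _ (Rhat R)^o).
have := polt_form_magma m1 (span0_magma tbl bvec_gen polt_iota polt_t poltD poltM m2).
by rewrite -mpi_form.
Qed.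

Lemma polt_all (r : S) : polt r.
Proof.
rewrite -[r]qpiK; elim/malg_ind: (repr r) => [|s s' IH IH'|c s IH|m].
- by rewrite rmorph0 -(rmorph0 iota); apply: polt_iota.
- by rewrite rmorphD; apply: poltD.
- have -> : c *: s = (@malgC {cmonom pair_class} R c : Rhat R) * s by rewrite mul_malgC.
  by rewrite rmorphM; apply: poltM => //; apply: (polt_iota c).
- exact: polt_mon.
Qed.

Lemma polt_span u : exists p : atom -> {poly R},
  u = \sum_(k <- basics) (map_poly iota (p k)).[t] *: b k.
Proof.
suff [c Sc ->] : span0 b polt u.
  have [p pE] := choice Sc; exists p.
  by apply: eq_bigr => k _; rewrite pE.
elim/quot_ind: u => [|u w|r w|i e|m n _ _].
- exact: (span00 _ polt_iota).
- exact: (span0D poltD).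
- by apply: (span0Z poltM); apply: polt_all.
- by rewrite bvec_gen; apply: span0b => //; apply: polt_iota.
- exact: (span0_magma tbl bvec_gen polt_iota polt_t poltD poltM).
Qed.

End Coefficients.

Lemma poly_eq0_horner (R : realType) (p : {poly R}) : (forall x, p.[x] = 0) -> p = 0.
Proof.
move=> p0; apply/eqP/negPn/negP => pn0.
(* As many distinct roots as [size p], one more than the degree. *)
pose s := [seq n%:R : R | n <- iota 0 (size p)].
have: (size s < size p)%N.
  apply: max_poly_roots => //; first by apply/allP => y _; rewrite /root p0.
  by rewrite map_inj_uniq ?iota_uniq // => m n /eqP; rewrite eqr_nat => /eqP.
by rewrite size_map size_iota ltnn.
Qed.

Lemma mcoeff_basics (R : realType) (f : atom -> R) k : basic k ->
  mcoeff k (\sum_(l <- basics) f l *: mb R l) = f k.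
Proof.
move=> bk; rewrite raddf_sum (bigD1_seq k) //=; last by case: k bk => [[] []|[]|[]|].
rewrite mcoeffZ mcoeffUU mulr1 big1 ?addr0 // => l lk.
by rewrite mcoeffZ mcoeffU (negPf lk) mulr0.
Qed.

(** * Nonzero polynomials in t act injectively on the universal algebra *)

Section Regularity.
Variables (R : realType) (P : ideal_pair (Mhat R)) (v : 'I_3 -> 'I_3 -> quot_alg P).
Hypotheses (uni : is_M4A P) (hv : shape4A_vectors (quot_real P) (quot_gen P) v).
Local Notation V := (quot_alg P).
Local Notation S := (qring P).
Local Notation iota := (quot_real P).
Let t : S := aform (quot_gen P i1 true) (v i2 i3).
Let b : atom -> V := bvec iota (quot_gen P) v.
Let tbl : table_ok t b := bvec_table uni.1 hv.

Let subM x : {subset idM P <= kerM x} := (uni.2 _ (kerP_class x)).1.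
Let subR x : {subset idR P <= kerR x} := (uni.2 _ (kerP_class x)).2.

Local Notation MB := (@mb R).

Let spA x i e : spM x (b (A i e)) = mb R (A i e).
Proof. by rewrite -[in RHS](ord_ofK i) -(spM_gen (subM x)). Qed.

Let sp x : {rmorphism S -> R} := spRh (subR x).

Let model_tbl x : table_ok (V := model x) x MB.
Proof. by move=> y z _ _; rewrite model_table (zevn R (z := 192%BZ) (n := 192)). Qed.

(** These entries have constant coefficients, so they hold whatever [sp x t] is. *)
Let tblAA x i e j d : ev (sp x t) MB (mulT (A i e) (A j d)) =
  zev R 192%BZ *: ((MB (A i e) : model x) *a MB (A j d)).
Proof.
rewrite -(@model_tbl x (A i e) (A j d)) //= /mulAA.
by case: ixeqb; [case: eqP => _ | ]; rewrite ?ev_nil // !ev_cons !ev_nil !c0E.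
Qed.

(** Specialisation preserves the form and maps a_1 and v_(2,3) to their counterparts, whose form
    value in the model is x. *)
Let sp_t x : sp x t = x.
Proof.
have W1 := @hom_tableW R S R idfun (sp x) V (model x) (@spM R P x)
  (spMD (subM x)) (spMZ (subM x) (subR x)) (spMM (subM x)) t b MB tbl (tblAA x) (spA x) X1.
apply: (etrans (spM_form (subM x) (subR x) _ _)).
rewrite -[quot_gen P i1 true]/(b (A X1 true)) -[v i2 i3]/(b (W X1)).
rewrite spA W1; apply: (@mulfI _ 192%:R); first by rewrite pnatr_eq0.
by rewrite model_form /= mulr0 addr0 (zevn R (z := 192%BZ) (n := 192)) // (_ : zev R Z0 = 0) // add0r mulrC.
Qed.

Lemma spM_b x y : basic y -> spM x (b y) = MB y.
Proof.
move=> y_; apply: (@hom_table R S R idfun (sp x) V (model x) (@spM R P x)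
  (spMD (subM x)) (spMZ (subM x) (subR x)) (spMM (subM x)) t b MB tbl (tblAA x) (spA x)) => //.
by rewrite (sp_t x).
Qed.

(* [u] is killed after specialising t to each real number, hence all its coefficients
   on the basis can be taken to vanish. *)
Lemma horner_regular (q : {poly R}) : q != 0 -> regular V (map_poly iota q).[t].
Proof.
move=> q0 u; have [p ->] := polt_span uni.1 hv u => qu0.
have spH x (p' : {poly R}) : sp x (map_poly iota p').[t] = p'.[x].
  rewrite -(horner_map (sp x)) (sp_t x) -map_poly_comp.
  by congr (_.[x]); apply: map_poly_id => r _; apply: (spR_real (subR x)).
have p0 k : basic k -> p k = 0.
  (* Reading off the coefficient at k in the model gives q(x) p_k(x) = 0 for every x; real
     polynomials form a domain, so q cancels. *)
  move=> bk; have : q * p k = 0.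
    apply: poly_eq0_horner => x; rewrite hornerM.
    have := congr1 (@mcoeff atom R k) (congr1 (spM x) qu0).
    have sp0 : spM x (0 : V) = 0.
      rewrite -{1}(scale0r (0 : V)); apply: (etrans (spMZ (subM x) (subR x) _ _)).
      by rewrite -[spR x 0]/(sp x 0) rmorph0 scale0r.
    rewrite sp0 mcoeff0 => <-.
    rewrite (spMZ (subM x) (subR x)) (big_morph _ (spMD (subM x)) sp0).
    rewrite mcoeffZ -[spR x _]/(sp x _) spH; congr (_ * _).
    have spb k' : basic k' -> spM x ((map_poly iota (p k')).[t] *: b k') = (p k').[x] *: MB k'.
      by move=> bk'; rewrite (spMZ (subM x) (subR x)) spM_b // -[spR x _]/(sp x _) spH.
    have bas_k k' : k' \in basics -> basic k' by apply: (allP (isT : all basic basics)).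
    rewrite (eq_big_seq (fun k' => (p k').[x] *: MB k')); last by move=> k' /bas_k/spb.
    exact: (esym (mcoeff_basics (fun l => (p l).[x]) bk)).
  by move/eqP; rewrite mulf_eq0 (negPf q0) => /eqP.
apply: big1_seq => k /andP[_ kb].
rewrite p0; last by apply: (allP (isT : all basic basics)).
rewrite map_poly0.
rewrite horner0.
by rewrite scale0r.
Qed.

(** The eigenvalues are the values at t of 1, 0, 1/2, 3/8 and X, which are distinct polynomials,
    told apart in degrees 0 and 1. *)
Lemma fval_regular l m : l != m -> regular V (fval iota t l - fval iota t m).
Proof.
pose q l : {poly R} := match l with fus1 => 1%:P | fus0 => 0%:P | fus2 => (1 / 2)%:P
  | fus38 => (3 / 8)%:P | fust => 'X end.
have qE l' : fval iota t l' = (map_poly iota (q l')).[t].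
  case: l'; rewrite [LHS]/fval /q.
  - by rewrite map_polyC hornerC; apply: (esym (rmorph1 iota)).
  - by rewrite map_polyC hornerC; apply: (esym (rmorph0 iota)).
  - by rewrite map_polyC hornerC.
  - by rewrite map_polyC hornerC.
  - by rewrite map_polyX hornerX.
move=> lm; rewrite !qE -hornerN -hornerD -rmorphB; apply: horner_regular.
rewrite subr_eq0; apply: contra_neq lm => /(congr1 (fun p : {poly R} => (p`_0, p`_1))).
rewrite /q; case: l; case: m => //; rewrite !(coefC, coefX, coef1, coef0) /=; case=> *; exfalso; lra.
Qed.

End Regularity.

(** * Gradings of the fusion rule *)

Section Gradings.
Variables (R : realType) (S : comNzRingType) (iota : {rmorphism R -> S}) (t : S).

(** A degree on labels that is constant on labels of equal value survives the merging of table
    entries. *)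
Lemma F4A_grading (Z : zmodType) (cl : flabel -> Z) :
    (forall l m, fval iota t l = fval iota t m -> cl l = cl m) ->
    (forall l m n, n \in ftabs l m -> cl n = cl l + cl m) ->
  is_grading (F4A iota t) (fun s => fval iota t @` [set l | cl l = s]).
Proof.
move=> cl_val cl_mul; split.
- move=> s s' _ _ [_ [[l ls <-] [m ms ml]]].
  by rewrite -ls -ms; apply: cl_val.
- apply/seteqP; split=> [_ [s _ [l _ <-]]|_ [l _ <-]]; first by exists l.
  by exists (cl l) => //; exists l.
move=> s s' _ _ [l ls <-] [m ms <-] _ [l' [m' [vl vm [n nlm <-]]]].
exists n => //=; rewrite (cl_mul l' m') ?(cl_val _ _ vl) ?(cl_val _ _ vm) ?ls ?ms //.
exact/ftabsP.
Qed.

(** The value at [fust] is a dummy; the map is used only for the constant labels. *)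
Definition freal (l : flabel) : R :=
  match l with fus1 => 1 | fus0 => 0 | fus2 => 1 / 2 | fus38 => 3 / 8 | fust => 0 end.

Lemma fval_inj : ~ [set 1; 0; iota (1 / 2); iota (3 / 8)] t -> injective (fval iota t).
Proof.
move=> nt; have fE l : l != fust -> fval iota t l = iota (freal l).
  by case: l => //= _; rewrite ?rmorph1 ?rmorph0.
have ft l : l != fust -> fval iota t l <> t.
  move=> lt lE; apply: nt; rewrite -lE; case: l lt {lE} => //= _;
    by [left; left; left | left; left; right | left; right | right].
move=> l m; case: (eqVneq l fust) => [->|lt]; case: (eqVneq m fust) => [->|mt] //.
- by move/esym/(ft _ mt).
- by move/(ft _ lt).
rewrite !fE // => /fmorph_inj.
by case: l lt; case: m mt => //= _ _ e; exfalso; lra.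
Qed.

Lemma grading_C2xC2 : ~ [set 1; 0; iota (1 / 2); iota (3 / 8)] t ->
  F4A_admits_C2xC2_grading iota t.
Proof.
move=> nt; pose cl l : 'Z_2 * 'Z_2 :=
  match l with fus38 => (1, 0) | fust => (0, 1) | _ => 0 end.
exists (fun s => fval iota t @` [set l | cl l = s]); split.
  apply: F4A_grading => [l m /(fval_inj nt) -> //|l m n].
  by case: l; case: m; case: n => // _; apply/eqP; vm_compute.
split; apply/seteqP; split=> z.
- by move=> [[] //= _ <-]; [left; left | left; right | right].
- by move=> [[->|->]|->]; [exists fus1 | exists fus0 | exists fus2].
- by move=> [[] //= _ <-].
- by move=> ->; exists fus38.
- by move=> [[] //= _ <-].
- by move=> ->; exists fust.
- by move=> [[]].
- by [].
Qed.

End Gradings.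

Lemma grading_C2 (R : realType) : F4A_admits_C2_grading (R := R) idfun (3 / 8).
Proof.
(* At t = 3/8 the labels [fus38] and [fust] have the same value, hence must have the same degree. *)
pose cl l : 'Z_2 := match l with fus38 | fust => 1 | _ => 0 end.
exists (fun s => fval idfun (3 / 8) @` [set l | cl l = s]); split.
- apply: F4A_grading => [l m|l m n].
    by case: l; case: m => //= e; exfalso; lra.
  by case: l; case: m; case: n => // _; apply/eqP; vm_compute.
- apply/seteqP; split=> z.
    by move=> [[] //= _ <-]; [left; left | left; right | right].
  by move=> [[->|->]|->]; [exists fus1 | exists fus0 | exists fus2].
apply/seteqP; split=> z; first by move=> [[] //= _ <-].
by move=> ->; exists fus38.
Qed.

Theorem theorem7p1 (R : realType) (P : ideal_pair (Mhat R)) (hP : is_M4A P)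
  (v : 'I_3 -> 'I_3 -> quot_alg P)
  (hv : shape4A_vectors (quot_real P) (quot_gen P) v) :
  let t : qring P := aform (quot_gen P i1 true) (v i2 i3) in
  [/\ forall i j : 'I_3, (i < j)%N ->
        idempotent_elt (v i j) /\
        satisfies_fusion (v i j) (F4A (quot_real P) t),
      ~ [set 1; 0; quot_real P (1 / 2); quot_real P (3 / 8)] t ->
        F4A_admits_C2xC2_grading (quot_real P) t,
      forall x : R, ~ [set 1; 0; 1 / 2; 3 / 8] x ->
        F4A_admits_C2xC2_grading idfun x
    & F4A_admits_C2_grading (R := R) idfun (3 / 8)].
Proof.
move=> t; split; last exact: grading_C2; first last.
- by move=> x nx; apply: grading_C2xC2.
- exact: grading_C2xC2.
move=> i j ij; have neq_ij : i != j by rewrite neq_ltn ij.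
split; first by have [_ []] := hv _ _ neq_ij.
rewrite -[i]ix_ofK -[j]ix_ofK (vW hv) ?ix_of_neq //.
apply: (v_fusion (bvec_table hP.1 hv) _ _ (fval_regular hP hv)) => u.
have [p pE] := polt_span hP.1 hv u.
by exists (fun k => (map_poly (quot_real P) (p k)).[t]).
Qed.
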